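(* Let $\eta > 0$, $\nu < \eta$, $\rho \in [0,1]$, and let $X$, $(\alpha_k)_{k\ge0}$, $(Y^n)_{n\ge0}$ and $Y$ be as defined in the context. Let $t > 0$ and $x \in \mathbb{R}$. Let $(u_n)_{n\ge0}$ be defined by $u_0 = 0$ and $$u_n = \frac{\eta}{\sqrt{2(1+\rho)}} + \frac{\eta-\nu}{\sqrt{2}}\left(\frac{\lfloor n/2\rfloor}{\sqrt{1-\rho}} + \frac{\lfloor (n-1)/2\rfloor}{\sqrt{1+\rho}}\right),\quad n\ge1.$$ Let $(p_n(t,x))_{n\ge0}$ be defined by $$p_0(t,x) = \Phi\left(\frac{-x}{\sqrt{2(1+\rho)t}}\right)$$ and, for $n \ge 0$, $$p_{n+1}(t,x) = \begin{cases}\Phi\left(\frac{x-\alpha_{n+1}}{\sqrt{2(1+(-1)^n\rho)t}} - \frac{u_{n+1}}{\sqrt t}\right) - \Phi\left(\frac{x-\alpha_{n+1}}{\sqrt{2(1+(-1)^{n+1}\rho)t}} - \frac{u_{n+1}}{\sqrt t}\right) & \text{if } x < \alpha_{n+1},\\[2mm] \Phi\left(\frac{x-\alpha_{n+1}}{\sqrt{2(1+(-1)^n\rho)t}} + \frac{u_{n+1}}{\sqrt t}\right) - \Phi\left(\frac{x-\alpha_{n+1}}{\sqrt{2(1+(-1)^{n+1}\rho)t}} + \frac{u_{n+1}}{\sqrt t}\right) & \text{if } x \ge \alpha_{n+1}.\end{cases}$$ Then, for every $n\ge 0$, $$\mathbb{P}\left(X_t - Y^n_t \ge x\right) = \sum_{k=0}^n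 p_k(t,x),$$ and $$\mathbb{P}\left(X_t - Y_t \ge x\right) = \sum_{k=0}^\infty p_k(t,x).$$
   Context: $\Phi$ is the cumulative distribution function of a standard normal random variable and $\lfloor\cdot\rfloor$ is the floor function. $B^X$ and $B^Y$ are independent standard Brownian motions (started at $0$) with respect to a filtration $(\mathcal{F}_t)_{t\ge0}$ on a filtered probability space $(\Omega,\mathcal{F},(\mathcal{F}_t)_{t\ge0},\mathbb{P})$ satisfying the usual conditions (right continuity and completeness); $X$ denotes $B^X$. Set $\alpha_0 = 0$, $\alpha_k = \eta$ if $k$ is odd, and $\alpha_k = \nu$ if $k$ is even and $k \ne 0$. For a Brownian motion $B$ and a stopping time $\tau$, $\mathcal{R}(B,\tau)$ denotes the reflection of $B$ at time $\tau$: $\mathcal{R}(B,\tau)_t = B_t - 2(B_t - B_\tau)\mathbf{1}_{t \ge \tau}$ (that is, $B_t$ for $t<\tau$ and $2B_\tau - B_t$ for $t \ge \tau$). Define recursively $\tau_0 = 0$, $\tilde{B}^0 = -B^X$, $Y^0 = \rho\tilde{B}^0 + \sqrt{1-\rho^2}\,B^Y$, and for $k \ge 1$ $$\tau_k = \inf\{t \ge \tau_{k-1} : B^X_t - Y^{k-1}_t = \alpha_k\},\quad \tilde{B}^k = \mathcal{R}(\tilde{B}^{k-1},\tau_k),\quad Y^k = \rho\tilde{B}^k + \sqrt{1-\rho^2}\,B^Y,$$ with $\inf\emptyset = +\infty$. $N_t = \sum_{n=1}^\infty \mathbf{1}_{\tau_n \le t}$ is the number of reflections up to time $t$; it is almost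 surely finite, and $Y_t = Y_t^{N_t}$.
   Formalization: The case ρ = 1, x = η is excluded (first claim: only for n ≥ 1), as p_1 then contains 0/0 and is undefined; for ρ = 1 otherwise, quotients by 0 are read as ±∞ by sign (0/0 = 0), with Φ(−∞) = 0 and Φ(+∞) = 1. *)

(* Defs.v *)
From HB Require Import structures.
From mathcomp Require Import all_boot all_order all_algebra.
From mathcomp Require Import all_classical all_reals all_analysis.

Set Implicit Arguments.
Unset Strict Implicit.
Unset Printing Implicit Defensive.

Import Order.TTheory GRing.Theory Num.Theory.
Import numFieldNormedType.Exports.

Local Open Scope classical_set_scope.
Local Open Scope ring_scope.

(* Processes, filtrations and the like are indexed by [R]; only their values at
   times [0 <= t] are ever constrained or used. *)

Section Processes.
Context {d : measure_display} {T : measurableType d} {R : realType}.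
Variable P : probability T R.

Record is_filtration (F : R -> set (set T)) : Prop := IsFiltration {
  filtration_sigma : forall t : R, 0 <= t -> sigma_algebra setT (F t) ;
  filtration_sub : forall t : R, 0 <= t -> F t `<=` measurable ;
  filtration_mono : forall s t : R, 0 <= s -> s <= t -> F s `<=` F t }.

Record usual_conditions (F : R -> set (set T)) : Prop := UsualConditions {
  usual_complete : measure_is_complete P ;
  usual_null : P.-negligible `<=` F 0 ;
  usual_right_continuous : forall t : R, 0 <= t ->
    \bigcap_(s in [set s | t < s]) F s = F t }.

Record is_brownian (F : R -> set (set T)) (B : R -> T -> R) : Prop :=
  IsBrownian {
  brownian_adapted : forall t : R, 0 <= t ->
    forall U : set R, measurable U -> F t (B t @^-1` U) ;
  brownian_start : {ae P, forall w, B 0 w = 0} ;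
  brownian_continuous :
    {ae P, forall w, {within [set t | 0 <= t], continuous (B ^~ w)}} ;
  brownian_increment : forall s t : R, 0 <= s -> s < t ->
    forall U : set R, measurable U ->
    P [set w | U (B t w - B s w)] = normal_prob 0 (Num.sqrt (t - s)) U ;
  brownian_independent_increment : forall s t : R, 0 <= s -> s < t ->
    forall (A : set T) (U : set R), F s A -> measurable U ->
    P (A `&` [set w | U (B t w - B s w)]) =
      (P A * P [set w | U (B t w - B s w)%R])%E }.

Definition sigma_of_process (B : R -> T -> R) : set (set T) :=
  <<s [set A | exists (t : R) (U : set R),
        [/\ 0 <= t, measurable U & A = B t @^-1` U]] >>.

Definition independent_processes (B B' : R -> T -> R) : Prop :=
  forall A A', sigma_of_process B A -> sigma_of_process B' A' ->
  P (A `&` A') = (P A * P A')%E.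

End Processes.

Definition alpha {R : realType} (eta nu : R) (k : nat) : R :=
  if k == 0%N then 0 else if odd k then eta else nu.

Section Reflections.
Context {T : Type} {R : realType}.

(* Since [t >= tau w] forces [tau w < +oo], the value of [fine] at [+oo] plays
   no role. *)
Definition reflection (B : R -> T -> R) (tau : T -> \bar R) : R -> T -> R :=
  fun t w => B t w - 2 * (B t w - B (fine (tau w)) w) * (tau w <= t%:E)%E%:R.

Variables (eta nu rho : R) (BX BY : R -> T -> R).

Definition correlated (Bt : R -> T -> R) : R -> T -> R :=
  fun t w => rho * Bt t w + Num.sqrt (1 - rho ^+ 2) * BY t w.

(* The first time from [sigma] on at which [BX - Z] is at level [a]; it is
   [+oo] if there is none. *)
Definition hitting_time (sigma : T -> \bar R) (Z : R -> T -> R) (a : R)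
    : T -> \bar R :=
  fun w => ereal_inf [set s%:E | s in
    [set s : R | [/\ 0 <= s, (sigma w <= s%:E)%E & BX s w - Z s w = a]]].

(* The pair (tau_k, tilde B^k). *)
Fixpoint tau_Btilde (k : nat) : (T -> \bar R) * (R -> T -> R) :=
  if k is k'.+1 then
    let: (tau', Bt') := tau_Btilde k' in
    let tau_k := hitting_time tau' (correlated Bt') (alpha eta nu k) in
    (tau_k, reflection Bt' tau_k)
  else (fun=> 0%E, fun t w => - BX t w).

Definition tau (k : nat) : T -> \bar R := (tau_Btilde k).1.

Definition Btilde (k : nat) : R -> T -> R := (tau_Btilde k).2.

Definition Yn (k : nat) : R -> T -> R := correlated (Btilde k).

Definition Nrefl (t : R) (w : T) : \bar R :=
  (\sum_(1 <= n <oo) ((tau n w <= t%:E)%E%:R)%:E)%E.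

(* Where [Nrefl t w = +oo] (almost nowhere) this is [Yn 0 t w]. *)
Definition Ylim (t : R) (w : T) : R := Yn (Num.truncn (fine (Nrefl t w))) t w.

End Reflections.

Section Formulas.
Context {R : realType}.
Implicit Types (eta nu rho t x : R) (n k : nat).

(* The standard normal distribution function, extended by its limits at the
   infinities. *)
Definition Phi (y : \bar R) : R :=
  fine (normal_prob 0 1 [set z : R | (z%:E <= y)%E]).

(* For [rho = 1] some of the denominators below vanish, so the quotients are
   taken in [\bar R], where [a / 0] is [+oo] or [-oo] according to the sign of
   [a], and [0 / 0 = 0]. No sum of opposite infinities arises. The value
   of [0 / 0] only matters, for [rho = 1], in [u_ 1], where [0] is the intended
   empty contribution, and in [p_ 1] at [x = eta]. The latter is genuinely
   indeterminate: the law of [X - Y] has an atom at [eta]. *)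
Definition u_ eta nu rho n : \bar R :=
  if n == 0%N then 0%E else
  (eta%:E / (Num.sqrt (2 * (1 + rho)))%:E +
   ((eta - nu) / Num.sqrt 2)%:E *
     ((n./2)%:R%:E / (Num.sqrt (1 - rho))%:E +
      (n.-1./2)%:R%:E / (Num.sqrt (1 + rho))%:E))%E.

Definition p_ eta nu rho t x k : R :=
  if k is n.+1 then
    let a := alpha eta nu n.+1 in
    let v := (u_ eta nu rho n.+1 / (Num.sqrt t)%:E)%E in
    let q m :=
      ((x - a)%:E / (Num.sqrt (2 * (1 + (-1) ^+ m * rho) * t))%:E)%E in
    if x < a then Phi (q n - v)%E - Phi (q n.+1 - v)%E
    else Phi (q n + v)%E - Phi (q n.+1 + v)%E
  else Phi ((- x)%:E / (Num.sqrt (2 * (1 + rho) * t))%:E)%E.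

End Formulas.

(* Main.v *)
(* Between tau_n and tau_(n+1), X - Y^n moves by (1 + (-1)^n rho) dX -
   sqrt (1 - rho^2) dY, a Brownian motion of variance 2 (1 + (-1)^n rho) per unit
   time. Normalising each phase and flipping its sign when the target level is
   below gives a process W with dW = a dX + b dY, a^2 + b^2 = 1, where a and b are
   constant on each phase. W goes from u_n to u_(n+1) during the n-th phase, so it
   first reaches u_n at time tau_n. After tau_n both X - Y^n and X - Y^(n-1)
   start from alpha_n; continuing W with the normalised increments of either one,
   with either sign, and comparing with u_n expresses
   P (X_t - Y^m_t >= x, tau_n <= t) for x >= alpha_n, and the complementary event
   for x < alpha_n, by the law of W_t alone, whence p_n.
   W_t is normal of variance t: Lindeberg's replacement argument on a grid is
   applied to the solutions Phi ((y - m) / sqrt v) of the heat equation, so neither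
   stochastic integrals nor Levy's characterisation are needed. *)

Require Import Defs.
From HB Require Import structures.
From mathcomp Require Import all_boot all_order all_algebra.
From mathcomp Require Import all_classical all_reals all_analysis.
From mathcomp Require Import measurable_realfun ring lra.

Set Implicit Arguments.
Unset Strict Implicit.
Unset Printing Implicit Defensive.

Import Order.TTheory GRing.Theory Num.Theory.
Import numFieldNormedType.Exports.

Local Open Scope classical_set_scope.
Local Open Scope ring_scope.

(** The gaps X - Y^n and X - Y^(n+1) coincide up to tau_(n+1), so their tail probabilities differ
    only through the event tau_(n+1) <= t. Subtracting the two values on that event is what makes
    each summand a difference of two values of [Phi]. The shape of the normality argument comes from
    the hypotheses: each Brownian motion has increments independent of the past, and the two motions
    are independent of each other, but the pair is not assumed to be jointly Brownian for the
    filtration. That a product of two increments has mean zero against bounded past variables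
    therefore has to be proved. The degenerate case is rho = 1: after tau_1 the gap stays at eta and
    never reaches nu. The terms from [p_ 2] on vanish, and only the atom at eta has to be left out.
    The infinite series needs P (tau_n <= t) to tend to 0. The same glued process gives this:
    continued from tau_n with either sign, it yields two normal variables, at least one of which is
    no smaller than u_n on that event, and u_n grows at least linearly when rho < 1. *)

Section Taylor.
Context {R : realType}.
Implicit Types (f df ddf dddf : R -> R) (a b x y d C M : R).

(** Increments of either sign are inserted into the Taylor bounds, so the segment from [a] to [b]
    carries no orientation. *)
Definition between a b x := a <= x <= b \/ b <= x <= a.

Lemma between_trans a b x y : between a b x -> between a x y -> between a b y.
Proof. rewrite /between; lra. Qed.

Lemma between_norm a b x : between a b x -> `|x - a| <= `|b - a|.
Proof.
by case=> /andP[ax xb]; [rewrite !ger0_norm|rewrite !ler0_norm]; lra.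
Qed.

Lemma MVT_bound f df C a b :
  (forall x, between a b x -> is_derive x 1 f (df x)) ->
  (forall x, between a b x -> `|df x| <= C) ->
  `|f b - f a| <= C * `|b - a|.
Proof.
move=> fdf dfC.
have [ab|ba] := leP a b.
  have H x : x \in `[a, b] -> between a b x by rewrite in_itv/=; left.
  have [||c cab ->] := @MVT_segment R f df a b ab.
  - move=> x xab; apply: fdf; apply: H; exact: subset_itv_oo_cc.
  - by apply: derivable_within_continuous => x xab; case: (fdf _ (H _ xab)).
  - by rewrite normrM ler_wpM2r//; apply: dfC; exact: H.
have ba' := ltW ba.
have H x : x \in `[b, a] -> between a b x by rewrite in_itv/=; right.
rewrite -normrN opprB -(normrN (b - a)) opprB.
have [||c cab ->] := @MVT_segment R f df b a ba'.
- move=> x xab; apply: fdf; apply: H; exact: subset_itv_oo_cc.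
- by apply: derivable_within_continuous => x xab; case: (fdf _ (H _ xab)).
- by rewrite normrM ler_wpM2r//; apply: dfC; exact: H.
Qed.

(** Each order follows from the previous one applied to the derivative, after subtracting the Taylor
    polynomial and using the mean value bound. The factorials in the remainder are given up; only
    its order matters later. *)
Lemma taylor2_bound f df ddf C a b :
  (forall x, between a b x -> is_derive x 1 f (df x)) ->
  (forall x, between a b x -> is_derive x 1 df (ddf x)) ->
  (forall x, between a b x -> `|ddf x| <= C) ->
  `|f b - f a - df a * (b - a)| <= C * `|b - a| ^+ 2.
Proof.
move=> f1 f2 f2C.
pose g x := f x - df a * x.
have -> : f b - f a - df a * (b - a) = g b - g a by rewrite /g; ring.
rewrite expr2 mulrA; apply: (@MVT_bound g (fun x => df x - df a)) => x xab.
  have ? := f1 _ xab.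
  by apply: is_derive_eq; rewrite /GRing.scale/=; ring.
rewrite (@le_trans _ _ (C * `|x - a|))//; last first.
  rewrite ler_wpM2l ?between_norm//; rewrite (le_trans _ (f2C a _))//; move: xab; rewrite /between; lra.
apply: (@MVT_bound df ddf) => y /(between_trans xab); first exact: f2.
exact: f2C.
Qed.

Lemma taylor3_bound f df ddf dddf C a b :
  (forall x, between a b x -> is_derive x 1 f (df x)) ->
  (forall x, between a b x -> is_derive x 1 df (ddf x)) ->
  (forall x, between a b x -> is_derive x 1 ddf (dddf x)) ->
  (forall x, between a b x -> `|dddf x| <= C) ->
  `|f b - f a - df a * (b - a) - ddf a * (b - a) ^+ 2 / 2| <= C * `|b - a| ^+ 3.
Proof.
move=> f1 f2 f3 f3C.
pose g x := f x - df a * x - ddf a * (x - a) ^+ 2 / 2.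
have -> : f b - f a - df a * (b - a) - ddf a * (b - a) ^+ 2 / 2 = g b - g a.
  by rewrite /g; field.
rewrite exprSr mulrA.
apply: (@MVT_bound g (fun x => df x - df a - ddf a * (x - a))) => x xab.
  have ? := f1 _ xab.
  by apply: is_derive_eq; rewrite /GRing.scale/=; field.
rewrite (@le_trans _ _ (C * `|x - a| ^+ 2))//; last first.
  rewrite ler_wpM2l ?lerXn2r ?nnegrE ?between_norm//.
  rewrite (le_trans _ (f3C a _))//; move: xab; rewrite /between; lra.
apply: (@taylor2_bound df ddf dddf) => y /(between_trans xab).
- exact: f2.
- exact: f3.
- exact: f3C.
Qed.

End Taylor.

(** * Heat equation for the normal distribution function *)

Section Phi_derivative.
Context {R : realType}.
Implicit Types (x y z s w h v : R).

Local Notation phi := (@normal_pdf R 0 1).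

Lemma PhiE y : Phi y%:E = \int[lebesgue_measure]_(z in `]-oo, y]) phi z.
Proof. by rewrite /Phi /normal_prob /Rintegral set_itvNyc. Qed.

Lemma Phi_pinfty : Phi (+oo%E : \bar R) = 1.
Proof.
rewrite /Phi (_ : [set z | _] = setT) ?probability_setT//.
by apply/seteqP; split => z //= _; rewrite leey.
Qed.

Lemma Phi_ninfty : Phi (-oo%E : \bar R) = 0.
Proof. by rewrite /Phi (_ : [set z | _] = set0) ?measure0//; apply/seteqP; split. Qed.

Lemma Phi_ge0 (y : \bar R) : 0 <= Phi y.
Proof. by rewrite /Phi fine_ge0. Qed.

Lemma measurable_Phi_set (y : \bar R) : measurable [set z : R | (z%:E <= y)%E].
Proof.
case: y => [y||].
- have -> : [set z : R | (z%:E <= y%:E)%E] = [set` `]-oo, y]].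
    by rewrite set_itvNyc; apply/seteqP; split => z; rewrite /= ?lee_fin.
  exact: measurable_itv.
- by rewrite (_ : [set z | _] = setT)//; apply/seteqP; split => z //= _; rewrite leey.
- by rewrite (_ : [set z | _] = set0)//; apply/seteqP; split.
Qed.

Lemma Phi_le1 (y : \bar R) : Phi y <= 1.
Proof.
rewrite /Phi -lee_fin fineK; last by rewrite fin_num_measure//; exact: measurable_Phi_set.
by apply: probability_le1; exact: measurable_Phi_set.
Qed.

Lemma le_Phi (y z : \bar R) : (y <= z)%E -> Phi y <= Phi z.
Proof.
move=> yz; rewrite /Phi fine_le ?fin_num_measure//; try exact: measurable_Phi_set.
apply: le_measure; rewrite ?inE; try exact: measurable_Phi_set.
by move=> x /= /le_trans; apply.
Qed.

(** The identity, seen as a random variable under the standard normal law, has [Phi] as its [cdf];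
    the limits at both infinities are inherited from there. *)
Let idTR : measurableTypeR R -> R := idfun.

#[local] HB.instance Definition _ :=
  @isMeasurableFun.Build _ _ _ _ idTR (@measurable_id _ _ setT).

Let N01 : probability (measurableTypeR R) R := normal_prob 0 1.

Let Phi_cdf : (fun y => (Phi y%:E)%:E) = cdf (idTR : {RV N01 >-> R}).
Proof.
apply/funext => y; rewrite /Phi fineK.
  by rewrite /cdf /distribution /pushforward preimage_id set_itvNyc.
by rewrite fin_num_measure//; exact: measurable_Phi_set.
Qed.

Lemma cvg_Phi_pinfty : Phi y%:E @[y --> +oo] --> (1 : R).
Proof.
apply: fine_cvg; rewrite [X in X @ _ --> _](_ : _ = cdf (idTR : {RV N01 >-> R})).
  exact: cvg_cdfy1.
by rewrite -Phi_cdf; apply/funext => y; rewrite /Phi fineK// fin_num_measure//; exact: measurable_Phi_set.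
Qed.

Lemma cvg_Phi_ninfty : Phi y%:E @[y --> -oo] --> (0 : R).
Proof.
apply: fine_cvg; rewrite [X in X @ _ --> _](_ : _ = cdf (idTR : {RV N01 >-> R})).
  exact: cvg_cdfNy0.
by rewrite -Phi_cdf; apply/funext => y; rewrite /Phi fineK// fin_num_measure//; exact: measurable_Phi_set.
Qed.

Lemma is_derive_Phi y : is_derive y 1 (fun z => Phi z%:E) (phi y).
Proof.
have [||||dF F'] := @continuous_FTC1 R phi -oo%O y (y + 1).
- by rewrite ltrDl.
- apply: integrableS (integrable_normal_pdf 0 1) => //.
- by rewrite ltNyr.
- by apply: continuous_normal_pdf.
have -> : (fun z => Phi z%:E) = (fun x => \int[lebesgue_measure]_(t in [set` `]-oo, x]]) phi t).
  by apply/funext => z; rewrite PhiE.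
by apply: DeriveDef; [exact: dF|rewrite -derive1E].
Qed.

Definition gauss_cst : R := normal_peak 1.

Lemma phiE y : phi y = gauss_cst * expR (- (y ^+ 2) / 2).
Proof. by rewrite normal_pdfE// /normal_fun subr0 expr1n. Qed.

Lemma is_derive_phi y : is_derive y 1 phi (- y * phi y).
Proof.
rewrite (_ : phi = fun y => gauss_cst * expR (- (y ^+ 2) / 2)); last first.
  by apply/funext => z; exact: phiE.
have D1 : is_derive y 1 (fun y : R => - (y ^+ 2) / 2) (- y).
  by apply: is_derive_eq; rewrite /GRing.scale/=; field.
have D2 := is_derive1_comp (is_derive_expR _) D1.
have D3 := @is_deriveZ _ _ _ _ gauss_cst y 1 _ D2.
by apply: is_derive_eq; rewrite /GRing.scale/=; ring.
Qed.

(** With [a = y ^+ 2], [expR (a / 2)] is at least [(1 + a / 4) ^+ 2], which dominates both [1] and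
    [a ^+ 2 / 16]; hence 17 = 1 + 16. *)
Lemma gauss_decay y : (1 + y ^+ 4) * expR (- (y ^+ 2) / 2) <= 17.
Proof.
rewrite mulNr expRN ler_pdivrMr ?expR_gt0//.
have E : expR (y ^+ 2 / 2) = expR (y ^+ 2 / 4) ^+ 2.
  by rewrite [RHS]expr2 -expRD; congr expR; field.
have := expR_ge1Dx (y ^+ 2 / 4); rewrite E => H.
have y0 := sqr_ge0 y; rewrite (_ : y ^+ 4 = (y ^+ 2) ^+ 2); last by rewrite -exprM.
move: (y ^+ 2) (expR _) H y0 => a e H a0.
have : (1 + a / 4) ^+ 2 <= e ^+ 2 by rewrite lerXn2r ?nnegrE//; nra.
nra.
Qed.

Lemma gauss_cst_ge0 : 0 <= gauss_cst. Proof. exact: normal_peak_ge0. Qed.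

Lemma phi_decay y : (1 + y ^+ 4) * phi y <= 17 * gauss_cst.
Proof.
rewrite phiE mulrCA (mulrC 17) ler_wpM2l ?gauss_cst_ge0//; exact: gauss_decay.
Qed.

(* The two second order bounds below combine through the heat equation
   [d/dw Phi (y / sqrt w) = 1/2 d^2/dy^2 Phi (y / sqrt w)]. *)
Definition heat1 w y := phi (y / Num.sqrt w) / Num.sqrt w.
Definition heat2 w y := - (y / Num.sqrt w * phi (y / Num.sqrt w) / w).

(** Every derivative of [Phi] met below is [phi] times a polynomial of degree at most 3, so this
    gives bounds uniform in the space variable. *)
Lemma poly_phi_bound (p : R -> R) C :
  (forall z, `|p z| <= C * (1 + z ^+ 4)) -> forall z, `|p z * phi z| <= 17 * C * gauss_cst.
Proof.
move=> pC z; rewrite normrM (ger0_norm (normal_pdf_ge0 _ _ _)).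
apply: (@le_trans _ _ (C * (1 + z ^+ 4) * phi z)).
  by rewrite ler_wpM2r// normal_pdf_ge0.
rewrite -mulrA (mulrC 17) -!mulrA ler_wpM2l ?phi_decay//.
have := pC 0; rewrite expr0n addr0 mulr1; apply: le_trans; exact: normr_ge0.
Qed.

Lemma Phi_heat_space w y d : 0 < w ->
  `|Phi ((y + d) / Num.sqrt w)%:E - Phi (y / Num.sqrt w)%:E - heat1 w y * d
    - heat2 w y * d ^+ 2 / 2| <= 17 * gauss_cst / Num.sqrt w ^+ 3 * `|d| ^+ 3.
Proof.
move=> w0; set s := Num.sqrt w.
have s0 : 0 < s by rewrite sqrtr_gt0.
have ws : w = s ^+ 2 by rewrite sqr_sqrtr// ltW.
rewrite /heat1 /heat2 -/s ws.
have Ds x : is_derive x 1 (fun x : R => x / s) s^-1.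
  by apply: is_derive_eq; rewrite /GRing.scale/=; ring.
have D0 x : is_derive x 1 (fun x => Phi (x / s)%:E) (phi (x / s) / s).
  exact: (@is_derive1_comp _ (fun x => Phi x%:E) (fun x => x / s) x _ _ (is_derive_Phi _) (Ds x)).
have Dp x : is_derive x 1 (fun x => phi (x / s)) (- (x / s) * phi (x / s) / s).
  exact: (@is_derive1_comp _ phi (fun x => x / s) x _ _ (is_derive_phi _) (Ds x)).
have D1 x : is_derive x 1 (fun x => phi (x / s) / s) (- (x / s * phi (x / s) / s ^+ 2)).
  have ? := Dp x.
  apply: is_derive_eq; rewrite /GRing.scale/=; field; exact: lt0r_neq0.
have D2 x : is_derive x 1 (fun x => - (x / s * phi (x / s) / s ^+ 2))
    (((x / s) ^+ 2 - 1) * phi (x / s) / s ^+ 3).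
  have ? := Dp x; have ? := Ds x.
  apply: is_derive_eq; rewrite /GRing.scale/=; field; exact: lt0r_neq0.
have Ed : y + d - y = d by ring.
have := @taylor3_bound _ _ _ _ _ (17 * gauss_cst / s ^+ 3) y (y + d)
  (fun x _ => D0 x) (fun x _ => D1 x) (fun x _ => D2 x).
rewrite Ed; apply => x _.
rewrite normrM (ger0_norm (_ : 0 <= (s ^+ 3)^-1)); last by rewrite invr_ge0 exprn_ge0// ltW.
rewrite ler_wpM2r ?invr_ge0 ?exprn_ge0 ?(ltW s0)//.
rewrite (_ : 17 = 17 * 1); last by rewrite mulr1.
apply: (@poly_phi_bound (fun z => z ^+ 2 - 1)) => z.
rewrite mul1r ler_norml; nra.
Qed.

Lemma Phi_heat_time w y h : 0 < w -> 0 <= h ->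
  `|Phi (y / Num.sqrt (w + h))%:E - Phi (y / Num.sqrt w)%:E - heat2 w y / 2 * h|
    <= 17 * gauss_cst / w ^+ 2 * h ^+ 2.
Proof.
move=> w0 h0.
have Ds x : 0 < x -> is_derive x 1 (fun x : R => y / Num.sqrt x) (- (y / Num.sqrt x / (2 * x))).
  move=> x0; have s0 : 0 < Num.sqrt x by rewrite sqrtr_gt0.
  have xs : x = Num.sqrt x ^+ 2 by rewrite sqr_sqrtr// ltW.
  have D1 := is_derive1_sqrt x0.
  have D2 := @is_deriveV _ Num.sqrt x _ _ (lt0r_neq0 s0) D1.
  have D3 := @is_deriveZ _ _ _ _ y x 1 _ D2.
  apply: is_derive_eq; rewrite /GRing.scale/=.
  by move: (Num.sqrt x) s0 xs => s s0 ->; field; exact: lt0r_neq0.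
have D0 x : 0 < x -> is_derive x 1 (fun x => Phi (y / Num.sqrt x)%:E) (heat2 x y / 2).
  move=> x0; have D := @is_derive1_comp _ (fun x => Phi x%:E) (fun x => y / Num.sqrt x) x _ _
    (is_derive_Phi _) (Ds x x0).
  apply: is_derive_eq; rewrite /heat2; field.
  by rewrite !lt0r_neq0// sqrtr_gt0.
have D1 x : 0 < x -> is_derive x 1 (fun x => heat2 x y / 2)
    ((3 * (y / Num.sqrt x) - (y / Num.sqrt x) ^+ 3) / 4 * phi (y / Num.sqrt x) / x ^+ 2).
  move=> x0; have D := @is_derive1_comp _ phi (fun x => y / Num.sqrt x) x _ _
    (is_derive_phi _) (Ds x x0).
  have D' := @is_deriveV _ id x _ _ (lt0r_neq0 x0) (is_derive_id x 1).
  have DM := is_deriveM (is_deriveM (Ds x x0) D) D'.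
  have D3 := @is_deriveZ _ _ _ _ (- 2^-1) x 1 _ DM.
  rewrite (_ : (fun x => _) = (- 2^-1) \*: ((fun x : R => y / Num.sqrt x) *
    (phi \o (fun x : R => y / Num.sqrt x)) * (fun y : R => y^-1))); last first.
    apply/funext => z; rewrite /heat2 !fctE.
    by rewrite -[RHS]/(- 2^-1 * (y / Num.sqrt z * phi (y / Num.sqrt z) / z)); ring.
  apply: is_derive_eq; rewrite /GRing.scale/= !fctE; field.
  by rewrite !lt0r_neq0// sqrtr_gt0.
have B x : between w (w + h) x -> w <= x by rewrite /between; lra.
have Ed : w + h - w = h by ring.
have := @taylor2_bound _ _ _ _ (17 * gauss_cst / w ^+ 2) w (w + h)
  (fun x xb => D0 x (lt_le_trans w0 (B x xb)))
  (fun x xb => D1 x (lt_le_trans w0 (B x xb))).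
rewrite Ed (ger0_norm h0); apply => x xb; have wx := B x xb.
have x0 := lt_le_trans w0 wx.
rewrite normrM (ger0_norm (_ : 0 <= (x ^+ 2)^-1)); last by rewrite invr_ge0 exprn_ge0// ltW.
apply: ler_pM => //; first by rewrite invr_ge0 exprn_ge0// ltW.
  rewrite (_ : 17 = 17 * 1); last by rewrite mulr1.
  apply: (@poly_phi_bound (fun z => (3 * z - z ^+ 3) / 4)) => z.
  rewrite mul1r ler_norml.
  have := sqr_ge0 z; have := sqr_ge0 (z ^+ 2); have := sqr_ge0 (z ^+ 2 - z).
  have := sqr_ge0 (z ^+ 2 + z); have := sqr_ge0 (z - 1); have := sqr_ge0 (z + 1).
  have -> : z ^+ 4 = (z ^+ 2) ^+ 2 by rewrite -exprM.
  have -> : z ^+ 3 = z ^+ 2 * z by rewrite -exprSr.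
  nra.
by rewrite lef_pV2 ?posrE ?exprn_gt0// lerXn2r// nnegrE ltW.
Qed.

(** The remainders scale like negative powers of [w], so one [K] serves all [w >= v]. The form suits
    the replacement of a normal variable of variance [h] by an increment [d]: the correction terms
    have mean zero once [d] is centred with variance [h] given the past. *)
Lemma Phi_heat v : 0 < v -> exists2 K, 0 <= K & forall w h y d, v <= w -> 0 <= h ->
  `|Phi ((y + d) / Num.sqrt w)%:E - Phi (y / Num.sqrt (w + h))%:E - heat1 w y * d
    - heat2 w y / 2 * (d ^+ 2 - h)| <= K * (`|d| ^+ 3 + h ^+ 2).
Proof.
move=> v0; pose c : R := 17 * gauss_cst.
have c0 : 0 <= c by rewrite mulr_ge0// gauss_cst_ge0.
have sv : 0 < Num.sqrt v by rewrite sqrtr_gt0.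
exists (c / Num.sqrt v ^+ 3 + c / v ^+ 2).
  by rewrite addr_ge0// divr_ge0// exprn_ge0// ltW.
move=> w h y d vw h0; have w0 := lt_le_trans v0 vw.
have svw : Num.sqrt v <= Num.sqrt w by rewrite ler_sqrt// ltW.
have H1 := Phi_heat_space y d w0; have H2 := Phi_heat_time y w0 h0.
have -> : Phi ((y + d) / Num.sqrt w)%:E - Phi (y / Num.sqrt (w + h))%:E - heat1 w y * d
    - heat2 w y / 2 * (d ^+ 2 - h) =
  (Phi ((y + d) / Num.sqrt w)%:E - Phi (y / Num.sqrt w)%:E - heat1 w y * d
    - heat2 w y * d ^+ 2 / 2) -
  (Phi (y / Num.sqrt (w + h))%:E - Phi (y / Num.sqrt w)%:E - heat2 w y / 2 * h) by field.
apply: (le_trans (ler_normB _ _)).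
have L1 : c / Num.sqrt w ^+ 3 <= c / Num.sqrt v ^+ 3.
  rewrite ler_wpM2l// lef_pV2 ?posrE ?exprn_gt0//; last exact: lt_le_trans svw.
  by rewrite lerXn2r// nnegrE ltW// (lt_le_trans sv).
have L2 : c / w ^+ 2 <= c / v ^+ 2.
  by rewrite ler_wpM2l// lef_pV2 ?posrE ?exprn_gt0// lerXn2r// nnegrE ltW.
have L3 : 0 <= c / Num.sqrt v ^+ 3 by rewrite divr_ge0// exprn_ge0// ltW.
have L4 : 0 <= c / v ^+ 2 by rewrite divr_ge0// exprn_ge0// ltW.
have d3 : 0 <= `|d| ^+ 3 by rewrite exprn_ge0.
have h2 : 0 <= h ^+ 2 by rewrite exprn_ge0.
move: H1 H2; rewrite -/c; nra.
Qed.

End Phi_derivative.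

(** * Moments and independence *)

Section Gaussian_moments.
Context {R : realType}.
Implicit Types (f : R -> \bar R) (s m l : R).

Lemma ge0_integral_normal_prob m s f : measurable_fun setT f ->
  (forall y, (0 <= f y)%E) ->
  (\int[normal_prob m s]_y f y = \int[lebesgue_measure]_y (f y * (normal_pdf m s y)%:E))%E.
Proof.
move=> mf f0; have dom := @normal_prob_dominates R m s.
rewrite -(Radon_Nikodym_SigmaFinite.change_of_variables dom)//.
apply: ae_eq_integral => //.
- apply: emeasurable_funM => //; apply: (measurable_int lebesgue_measure).
  exact: Radon_Nikodym_SigmaFinite.f_integrable.
- apply: emeasurable_funM => //; apply/measurable_EFinP; exact: measurable_normal_pdf.
- apply: ae_eqe_mul2l; apply: integral_ae_eq => //.
  + exact: Radon_Nikodym_SigmaFinite.f_integrable.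
  + apply/measurable_EFinP; exact: measurable_normal_pdf.
  + by move=> A _ mA; rewrite -Radon_Nikodym_SigmaFinite.f_integral.
Qed.

(** Completing the square turns [expR (l * y)] times the centred density into a constant times the
    density of mean [l * s ^+ 2]. *)
Lemma normal_mgf s l : s != 0 ->
  (\int[normal_prob 0 s]_y (expR (l * y))%:E = (expR (l ^+ 2 * s ^+ 2 / 2))%:E)%E.
Proof.
move=> s0; rewrite ge0_integral_normal_prob//; last first.
  by apply/measurable_EFinP/measurableT_comp => //; exact: measurable_funM.
transitivity (\int[lebesgue_measure]_y ((expR (l ^+ 2 * s ^+ 2 / 2))%:E *
    (normal_pdf (l * s ^+ 2) s y)%:E))%E.
  apply: eq_integral => y _; rewrite -!EFinM; congr EFin.
  rewrite !normal_pdfE// /normal_fun mulrCA [RHS]mulrCA; congr (_ * _).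
  rewrite -!expRD; congr expR; rewrite -mulr_natr; field.
  by rewrite s0.
rewrite ge0_integralZl//.
- by rewrite integral_normal_pdf mule1.
- apply/measurable_EFinP; exact: measurable_normal_pdf.
- by move=> y _; rewrite lee_fin normal_pdf_ge0.
Qed.

End Gaussian_moments.

Section Expectation.
Context {d : measure_display} {T : measurableType d} {R : realType}.
Variable P : probability T R.
Implicit Types (U V f g : T -> R).

Definition integrableR f := P.-integrable setT (EFin \o f).
Definition expect f : R := \int[P]_w f w.

Lemma integrableRD f g : integrableR f -> integrableR g -> integrableR (fun w => f w + g w).
Proof. exact: (@integrableD _ _ _ P setT measurableT (EFin \o f) (EFin \o g)). Qed.

Lemma integrableRB f g : integrableR f -> integrableR g -> integrableR (fun w => f w - g w).
Proof. exact: (@integrableB _ _ _ P setT measurableT (EFin \o f) (EFin \o g)). Qed.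

Lemma integrableRZ (c : R) f : integrableR f -> integrableR (fun w => c * f w).
Proof. exact: (@integrableZl _ _ _ P setT measurableT c (EFin \o f)). Qed.

Lemma integrableR_cst (c : R) : integrableR (fun=> c).
Proof. exact: finite_measure_integrable_cst. Qed.

Lemma le_integrableR f g : measurable_fun setT f ->
  (forall w, `|f w| <= g w) -> integrableR g -> integrableR f.
Proof.
move=> mf fg; apply: le_integrable => //; first exact/measurable_EFinP.
by move=> w _; rewrite /= lee_fin (le_trans (fg w))// ler_norm.
Qed.

Lemma integrableR_measurable f : integrableR f -> measurable_fun setT f.
Proof. by move=> /integrableP[/measurable_EFinP]. Qed.

Lemma bounded_integrableR (C : R) f : measurable_fun setT f ->
  (forall w, `|f w| <= C) -> integrableR f.
Proof. by move=> mf fC; apply: (le_integrableR mf fC); exact: integrableR_cst. Qed.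

Lemma integrableRM_bounded (C : R) f g : measurable_fun setT f ->
  (forall w, `|f w| <= C) -> integrableR g -> integrableR (fun w => f w * g w).
Proof.
move=> mf fC ig; apply: (@le_integrableR _ (fun w => C * `|g w|)).
- by apply: measurable_funM => //; exact: integrableR_measurable.
- by move=> w; rewrite normrM ler_wpM2r.
- by apply: integrableRZ; exact: (integrable_norm (mu := P)).
Qed.

Lemma expectD f g : integrableR f -> integrableR g ->
  expect (fun w => f w + g w) = expect f + expect g.
Proof. by move=> *; exact: RintegralD. Qed.

Lemma expectB f g : integrableR f -> integrableR g ->
  expect (fun w => f w - g w) = expect f - expect g.
Proof. by move=> *; exact: RintegralB. Qed.

Lemma expectZ (c : R) f : integrableR f -> expect (fun w => c * f w) = c * expect f.
Proof. by move=> *; exact: RintegralZl. Qed.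

Lemma expect_cst (c : R) : expect (fun=> c) = c.
Proof. by rewrite /expect Rintegral_cst//= [X in fine X]probability_setT mulr1. Qed.

Lemma le_expect f g : integrableR f -> integrableR g ->
  (forall w, f w <= g w) -> expect f <= expect g.
Proof. by move=> *; apply: le_Rintegral. Qed.

Lemma eq_expect f g : f =1 g -> expect f = expect g.
Proof. by move=> /funext ->. Qed.

Lemma expect_norm_le f g : integrableR f -> integrableR g ->
  (forall w, `|f w| <= g w) -> `|expect f| <= expect g.
Proof.
move=> fi gi fg; apply: (le_trans (le_normr_Rintegral measurableT fi)).
by apply: le_expect => //; exact: (integrable_norm (mu := P)).
Qed.

Lemma normal_rv_mgf V s l : measurable_fun setT V -> s != 0 ->
  (forall A, measurable A -> P (V @^-1` A) = normal_prob 0 s A) ->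
  (\int[P]_w (expR (l * V w))%:E = (expR (l ^+ 2 * s ^+ 2 / 2))%:E)%E.
Proof.
move=> mV s0 VN; rewrite -(normal_mgf l s0).
have mexp : measurable_fun setT (fun y : R => (expR (l * y))%:E).
  by apply/measurable_EFinP/measurableT_comp => //; exact: measurable_funM.
have mV' : @measurable_fun _ _ T (measurableTypeR R) setT V by exact: mV.
pose X : {mfun T >-> measurableTypeR R} := HB.pack (V : T -> measurableTypeR R)
  (isMeasurableFun.Build _ _ _ _ (V : T -> measurableTypeR R) mV').
transitivity (\int[distribution P X]_y (expR (l * y))%:E)%E.
  by rewrite ge0_integral_distribution// => y; rewrite lee_fin expR_ge0.
apply: eq_measure_integral => A mA _; exact: (VN A mA).
Qed.

Section Independence.
Variables U V : T -> R.
Hypotheses (mU : measurable_fun setT U) (mV : measurable_fun setT V).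
Hypothesis UV_indep : forall A B, measurable A -> measurable B ->
  P (U @^-1` A `&` V @^-1` B) = (P (U @^-1` A) * P (V @^-1` B))%E.

Let UV w := (U w, V w).

Let mUV : measurable_fun setT UV. Proof. exact: measurable_fun_pair. Qed.

Let RU : {mfun T >-> R} := HB.pack U (isMeasurableFun.Build _ _ _ _ U mU).
Let RV : {mfun T >-> R} := HB.pack V (isMeasurableFun.Build _ _ _ _ V mV).
Let RUV : {mfun T >-> (R * R)%type} := HB.pack UV (isMeasurableFun.Build _ _ _ _ UV mUV).

Let m1 : probability R R := distribution P RU.
Let m2 : probability R R := distribution P RV.
Let m12 : probability (R * R)%type R := distribution P RUV.

Let m12E X : measurable X -> (m1 \x m2)%E X = m12 X.
Proof.
apply: product_measure_unique => A B mA mB.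
by rewrite -UV_indep.
Qed.

Let ge0_prod (f g : R -> R) : measurable_fun setT f -> measurable_fun setT g ->
  (forall y, 0 <= f y) -> (forall y, 0 <= g y) ->
  (\int[P]_w (f (U w) * g (V w))%:E =
   (\int[P]_w (f (U w))%:E) * (\int[P]_w (g (V w))%:E))%E.
Proof.
move=> mf mg f0 g0.
have mfg : measurable_fun [set: R * R] (fun z : R * R => (f z.1 * g z.2)%:E).
  apply/measurable_EFinP; apply: measurable_funM.
    exact: measurableT_comp.
  exact: measurableT_comp.
transitivity (\int[m12]_z (f z.1 * g z.2)%:E)%E.
  rewrite ge0_integral_distribution// => z; by rewrite lee_fin mulr_ge0.
transitivity (\int[m1 \x m2]_z (f z.1 * g z.2)%:E)%E.
  by apply: eq_measure_integral => X mX _; exact/esym/m12E.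
rewrite fubini_tonelli1//; last by move=> z; rewrite lee_fin mulr_ge0.
rewrite /fubini_F/=.
transitivity (\int[m1]_x ((f x)%:E * \int[m2]_y (g y)%:E))%E.
  apply: eq_integral => x _; under eq_integral do rewrite EFinM.
  rewrite ge0_integralZl//; [exact/measurable_EFinP|..].
    by move=> y _; rewrite lee_fin.
  by rewrite lee_fin.
have mf' := (measurable_EFinP setT f).2 mf.
have mg' := (measurable_EFinP setT g).2 mg.
have fE y : (0 <= (f y)%:E)%E by rewrite lee_fin.
have gE y : (0 <= (g y)%:E)%E by rewrite lee_fin.
rewrite ge0_integralZr//; last exact: integral_ge0.
by rewrite !ge0_integral_distribution.
Qed.

Let intU (f : R -> R) : measurable_fun setT f -> (forall y, `|f y| <= `|y|) ->
  integrableR U -> integrableR (fun w => f (U w)).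
Proof.
move=> mf fy; apply: le_integrable => //.
  by apply/measurable_EFinP; exact: measurableT_comp.
by move=> w _; rewrite /= lee_fin.
Qed.

Let intV (f : R -> R) : measurable_fun setT f -> (forall y, `|f y| <= `|y|) ->
  integrableR V -> integrableR (fun w => f (V w)).
Proof.
move=> mf fy; apply: le_integrable => //.
  by apply/measurable_EFinP; exact: measurableT_comp.
by move=> w _; rewrite /= lee_fin.
Qed.

(** Tonelli's theorem on the product law covers nonnegative functions only, so both variables are
    split into positive and negative parts and the four products are recombined. *)
Lemma expectM_indep : integrableR U -> integrableR V ->
  integrableR (fun w => U w * V w) /\ expect (fun w => U w * V w) = expect U * expect V.
Proof.
move=> iU iV.
have iUV : integrableR (fun w => U w * V w).
  apply/integrableP; split.
    by apply/measurable_EFinP; exact: measurable_funM.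
  under eq_integral do rewrite /= normrM.
  rewrite (ge0_prod (f := Num.norm) (g := Num.norm))//.
  have /integrableP[_ fU] := iU; have /integrableP[_ fV] := iV.
  rewrite lte_mul_pinfty//.
  - by apply: integral_ge0 => y _; rewrite lee_fin.
  - by rewrite ge0_fin_numE//; apply: integral_ge0 => y _; rewrite lee_fin.
split=> //.
pose p := fun x : R => Num.max x 0; pose n := fun x : R => Num.max (- x) 0.
have mp : measurable_fun setT p by exact: measurable_maxr.
have mn : measurable_fun setT n by apply: measurable_maxr.
have p0 x : 0 <= p x by rewrite /p le_max lexx orbT.
have n0 x : 0 <= n x by rewrite /n le_max lexx orbT.
have pn x : x = p x - n x.
  by rewrite /p /n; case: (leP x 0) => x0; case: (leP (- x) 0) => x1; lra.
have pl x : `|p x| <= `|x|.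
  by rewrite ger0_norm// /p ge_max ler_norm normr_ge0.
have nl x : `|n x| <= `|x|.
  by rewrite ger0_norm// /n ge_max -normrN ler_norm normr_ge0.
have key (f g : R -> R) : measurable_fun setT f -> measurable_fun setT g ->
    (forall x, 0 <= f x) -> (forall x, 0 <= g x) ->
    (forall x, `|f x| <= `|x|) -> (forall x, `|g x| <= `|x|) ->
    integrableR (fun w => f (U w) * g (V w)) /\
    expect (fun w => f (U w) * g (V w)) = expect (f \o U) * expect (g \o V).
  move=> mf mg f0 g0 fl gl; split.
    apply: le_integrable iUV => //.
      apply/measurable_EFinP; apply: measurable_funM; exact: measurableT_comp.
    by move=> w _; rewrite /= lee_fin !normrM ler_pM.
  rewrite /expect /Rintegral ge0_prod// fineM//; apply: integrable_fin_num => //.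
    exact: intU.
  exact: intV.
have [i1 e1] := key _ _ mp mp p0 p0 pl pl.
have [i2 e2] := key _ _ mp mn p0 n0 pl nl.
have [i3 e3] := key _ _ mn mp n0 p0 nl pl.
have [i4 e4] := key _ _ mn mn n0 n0 nl nl.
have jU1 := intU mp pl iU; have jU2 := intU mn nl iU.
have jV1 := intV mp pl iV; have jV2 := intV mn nl iV.
have -> : expect U = expect (p \o U) - expect (n \o U).
  by rewrite /expect -RintegralB//; apply: eq_Rintegral => w _; exact: pn.
have -> : expect V = expect (p \o V) - expect (n \o V).
  by rewrite /expect -RintegralB//; apply: eq_Rintegral => w _; exact: pn.
transitivity (expect (fun w => p (U w) * p (V w)) - expect (fun w => p (U w) * n (V w)) -
  (expect (fun w => n (U w) * p (V w)) - expect (fun w => n (U w) * n (V w)))).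
  rewrite -(expectB i1 i2) -(expectB i3 i4) -expectB; [|exact: integrableRB..].
  by apply: eq_expect => w; rewrite {1}(pn (U w)) {1}(pn (V w)); ring.
by rewrite e1 e2 e3 e4; ring.
Qed.

End Independence.

End Expectation.

(** * Moments of a normal variable, from its moment generating function *)

Section Normal_moments.
Context {d : measure_display} {T : measurableType d} {R : realType}.
Variable P : probability T R.
Variables (V : T -> R) (s : R).
Hypothesis mV : measurable_fun setT V.
Hypothesis s0 : 0 < s.
Hypothesis VN : forall A, measurable A -> P (V @^-1` A) = normal_prob 0 s A.

Let mexp (l : R) : measurable_fun setT (fun w => expR (l * V w)).
Proof. by apply: measurableT_comp => //; exact: measurable_funM. Qed.

Let iexp (l : R) : integrableR P (fun w => expR (l * V w)).
Proof.
apply/integrableP; split; first exact/measurable_EFinP.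
under eq_integral do rewrite /= ger0_norm ?expR_ge0//.
by rewrite (normal_rv_mgf l mV (lt0r_neq0 s0) VN) ltry.
Qed.

Let Eexp (l : R) : expect P (fun w => expR (l * V w)) = expR (l ^+ 2 * s ^+ 2 / 2).
Proof. by rewrite /expect /Rintegral (normal_rv_mgf l mV (lt0r_neq0 s0) VN). Qed.

(** For [0 <= z], [z / 4 <= expR (z / 4)]; the fourth power gives 256 = 4 ^ 4. The second
    exponential takes care of negative [z]. *)
Lemma pow4_le_cosh (z : R) : z ^+ 4 <= 256 * (expR z + expR (- z)).
Proof.
wlog z0 : z / 0 <= z.
  move=> H; have [/H//|z0] := leP 0 z; have := H (- z); rewrite opprK oppr_ge0 ltW//.
  by rewrite addrC (_ : (- z) ^+ 4 = z ^+ 4); [apply|ring].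
have H := expR_ge1Dx (z / 4).
have -> : expR z = expR (z / 4) ^+ 4.
  by rewrite -expRM_natl; congr expR; field.
have := expR_ge0 (- z).
have : (z / 4) ^+ 4 <= expR (z / 4) ^+ 4.
  by rewrite lerXn2r ?nnegrE ?expR_ge0 ?divr_ge0//; lra.
by rewrite exprMn exprVn; lra.
Qed.

Lemma normal_moment4_integrable : integrableR P (fun w => V w ^+ 4).
Proof.
apply: (@le_integrableR _ _ _ _ _ (fun w => 256 * (expR (1 * V w) + expR (- 1 * V w)))).
- exact: measurable_funX.
- move=> w; rewrite ger0_norm; last by rewrite (exprM _ 2 2) sqr_ge0.
  by rewrite mul1r mulN1r; exact: pow4_le_cosh.
- by apply: integrableRZ; apply: integrableRD.
Qed.

(** [pow4_le_cosh] is used at [V w / s], whose two exponential moments both equal [expR (2^-1)];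
    hence 512 = 2 * 256. Only the scaling [s ^+ 4] matters later. *)
Lemma normal_moment4_le : expect P (fun w => V w ^+ 4) <= 512 * expR (2^-1) * s ^+ 4.
Proof.
apply: (@le_trans _ _ (expect P (fun w => 256 * s ^+ 4 *
    (expR (s^-1 * V w) + expR (- s^-1 * V w))))).
  apply: le_expect; first exact: normal_moment4_integrable.
    by apply: integrableRZ; apply: integrableRD.
  move=> w; have := pow4_le_cosh (s^-1 * V w); rewrite -mulNr exprMn exprVn.
  by rewrite mulrC ler_pdivrMr ?exprn_gt0//; lra.
rewrite expectZ; last by apply: integrableRD.
rewrite expectD// !Eexp sqrrN exprVn mulVf ?expf_neq0 ?lt0r_neq0// mul1r; lra.
Qed.

Lemma normal_moment2_integrable : integrableR P (fun w => V w ^+ 2).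
Proof.
apply: (@le_integrableR _ _ _ _ _ (fun w => 1 + V w ^+ 4)).
- exact: measurable_funX.
- move=> w; rewrite ger0_norm ?sqr_ge0// (exprM _ 2 2); have := sqr_ge0 (V w ^+ 2 - 1); nra.
- by apply: integrableRD; [exact: integrableR_cst|exact: normal_moment4_integrable].
Qed.

Lemma normal_moment1_integrable : integrableR P V.
Proof.
apply: (@le_integrableR _ _ _ _ _ (fun w => 1 + V w ^+ 2)) => //.
- by move=> w; rewrite ler_norml; nra.
- by apply: integrableRD; [exact: integrableR_cst|exact: normal_moment2_integrable].
Qed.

Lemma small_eq0 (a K : R) : (forall l, 0 < l -> l <= 1 -> `|a| <= K * l) -> a = 0.
Proof.
move=> H; apply/eqP; rewrite -normr_le0; apply/ler_addgt0Pl => e e0.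
rewrite addr0.
have K0 : 0 <= K by have := H 1 ltr01 (lexx _); rewrite mulr1; apply: le_trans.
pose l := Num.min 1 (e / (K + 1)).
have l0 : 0 < l by rewrite lt_min ltr01 divr_gt0//; lra.
have := H l l0; rewrite /l ge_min lexx => /(_ isT) /le_trans; apply.
apply: (@le_trans _ _ (K * (e / (K + 1)))); first by rewrite ler_wpM2l// ge_min lexx orbT.
by rewrite mulrA ler_pdivrMr; nra.
Qed.

Let E1 := expect P V.
Let E2 := expect P (fun w => V w ^+ 2).

Lemma expR_taylor2 (z : R) : `|expR z - 1 - z - z ^+ 2 / 2| <= expR `|z| * `|z| ^+ 3.
Proof.
have := @taylor3_bound _ (@expR R) expR expR expR (expR `|z|) 0 z
  (fun x _ => is_derive_expR x) (fun x _ => is_derive_expR x) (fun x _ => is_derive_expR x).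
rewrite expR0 subr0 !mul1r; apply => x xz.
rewrite ger0_norm ?expR_ge0// ler_expR.
have := between_norm xz; rewrite !subr0; apply: le_trans; exact: ler_norm.
Qed.

(** The moment generating function is known exactly, so expanding under the expectation to second
    order in [l] identifies the first two moments. *)
Let mgf_expansion : exists K, forall l, `|l| <= 1 ->
  `|expR (l ^+ 2 * s ^+ 2 / 2) - 1 - l * E1 - l ^+ 2 * E2 / 2| <= K * `|l| ^+ 3.
Proof.
(* With [a = |V w|], the Taylor remainder is at most [|l| ^+ 3 * (expR a * a ^+ 3)], and
   [a ^+ 3 <= 27 * expR a] because [a / 3 <= expR (a / 3)]. *)
exists (expect P (fun w => 27 * (expR (2 * V w) + expR (- 2 * V w)))) => l l1.
have iV := normal_moment1_integrable; have iV2 := normal_moment2_integrable.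
have -> : expR (l ^+ 2 * s ^+ 2 / 2) - 1 - l * E1 - l ^+ 2 * E2 / 2 =
    expect P (fun w => expR (l * V w) - 1 - l * V w - (l ^+ 2 / 2) * V w ^+ 2).
  rewrite expectB; [|by do !apply: integrableRB => //; [exact: integrableR_cst|exact: integrableRZ]|
    exact: integrableRZ].
  rewrite expectB; [|by apply: integrableRB => //; exact: integrableR_cst|exact: integrableRZ].
  rewrite expectB//; last exact: integrableR_cst.
  by rewrite Eexp expect_cst !expectZ// /E1 /E2; field.
rewrite [X in _ <= X]mulrC -expectZ; last by apply: integrableRZ; exact: integrableRD.
apply: expect_norm_le.
- do !apply: integrableRB => //; [exact: integrableR_cst|exact: integrableRZ..].
- by do 2 apply: integrableRZ; exact: integrableRD.
move=> w; have := expR_taylor2 (l * V w); rewrite exprMn.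
have -> : expR (l * V w) - 1 - l * V w - l ^+ 2 * V w ^+ 2 / 2 =
  expR (l * V w) - 1 - l * V w - l ^+ 2 / 2 * V w ^+ 2 by field.
move=> /le_trans; apply; rewrite normrM exprMn mulrCA.
rewrite ler_wpM2l ?exprn_ge0//.
set y := V w; set a := `|y|.
have a0 : 0 <= a by exact: normr_ge0.
have e1 : expR (`|l| * a) <= expR a by rewrite ler_expR ler_piMl.
have a3 : a ^+ 3 <= 27 * expR a.
  have H := expR_ge1Dx (a / 3).
  have -> : expR a = expR (a / 3) ^+ 3.
    by rewrite -expRM_natl; congr expR; field.
  have : (a / 3) ^+ 3 <= expR (a / 3) ^+ 3.
    by rewrite lerXn2r ?nnegrE ?expR_ge0 ?divr_ge0//; lra.
  by rewrite exprMn exprVn; lra.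
have e2 : expR a * expR a <= expR (2 * y) + expR (- 2 * y).
  rewrite -expRD /a; have [y0|y0] := leP 0 y.
    by rewrite ger0_norm// -[X in X <= _]addr0 lerD ?expR_ge0// ler_expR; lra.
  by rewrite ltr0_norm// -[X in X <= _]add0r lerD ?expR_ge0// ler_expR; lra.
apply: (@le_trans _ _ (expR a * (27 * expR a))).
  by apply: ler_pM => //; rewrite ?expR_ge0 ?exprn_ge0.
by rewrite mulrCA; lra.
Qed.

Let mgf_moments : exists K, forall l, 0 < l -> l <= 1 ->
  `|l * E1| <= K * l ^+ 3 /\ `|l ^+ 2 * (s ^+ 2 - E2)| <= K * l ^+ 3.
Proof.
have [K HK] := mgf_expansion.
exists (2 * (K + expR (s ^+ 2 / 2) * (s ^+ 2 / 2) ^+ 2)) => l l0 l1.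
(* The difference of the expansions at [l] and [- l] isolates the odd term [l * E1], their sum the
   even term. *)
have := HK (- l); have := HK l; rewrite !normrN sqrrN.
rewrite (ger0_norm (ltW l0)) => /(_ l1) H1 /(_ l1) H2.
set x := l ^+ 2 * s ^+ 2 / 2.
have x0 : 0 <= x by rewrite divr_ge0// mulr_ge0 ?sqr_ge0.
have l21 : l ^+ 2 <= 1 by rewrite exprn_ile1// ltW.
have H3 : `|expR x - 1 - x| <= (expR (s ^+ 2 / 2) * (s ^+ 2 / 2) ^+ 2) * l ^+ 3.
  have := @taylor2_bound _ (@expR R) expR expR (expR x) 0 x
    (fun x _ => is_derive_expR x) (fun x _ => is_derive_expR x).
  rewrite expR0 subr0 mul1r => H; apply: (le_trans (H _)).
    move=> y yx; rewrite ger0_norm ?expR_ge0// ler_expR; move: yx; rewrite /between; lra.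
  rewrite -mulrA ler_pM ?expR_ge0 ?exprn_ge0//.
    by rewrite ler_expR /x -mulrA ler_piMl// divr_ge0// sqr_ge0.
  rewrite (ger0_norm x0) /x -mulrA exprMn mulrC ler_wpM2l ?sqr_ge0//.
  by rewrite -exprM (exprS _ 3) ler_piMl// exprn_ge0// ltW.
move: H1 H2 H3; rewrite -/x !ler_norml; move: (expR x) => e.
have -> : x = l ^+ 2 * s ^+ 2 / 2 by [].
move: (expR (s ^+ 2 / 2) * (s ^+ 2 / 2) ^+ 2) => C.
move=> /andP[a1 a2] /andP[b1 b2] /andP[c1 c2].
by split; apply/andP; split; lra.
Qed.

Lemma normal_moment1 : expect P V = 0.
Proof.
have [K HK] := mgf_moments; apply: (@small_eq0 _ K) => l l0 l1.
have [+ _] := HK l l0 l1; rewrite normrM (ger0_norm (ltW l0)) exprS mulrCA.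
rewrite ler_pM2l// => /le_trans; apply.
have K0 : 0 <= K by have [+ _] := HK 1 ltr01 (lexx _); rewrite expr1n mulr1; apply: le_trans.
by rewrite ler_wpM2l// expr2 ler_piMl// ltW.
Qed.

Lemma normal_moment2 : expect P (fun w => V w ^+ 2) = s ^+ 2.
Proof.
apply/esym/eqP; rewrite -subr_eq0; apply/eqP.
have [K HK] := mgf_moments; apply: (@small_eq0 _ K) => l l0 l1.
have [_] := HK l l0 l1; rewrite normrM (ger0_norm (sqr_ge0 l)) (exprSr _ 2) mulrCA.
by rewrite ler_pM2l// exprn_gt0.
Qed.

End Normal_moments.

(** * Increments of Brownian motions *)

Section Filtration_measurability.
Context {d : measure_display} {T : measurableType d} {R : realType}.
Implicit Types (G H : set (set T)) (f g : T -> R).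

(** Stated on the measurable type generated by [G], so that closure under sums, products and
    pointwise limits applies to each [F t] directly. *)
Definition Gmeas G f := @measurable_fun _ _ (g_sigma_algebraType G) R setT f.

Lemma GmeasP G f : sigma_algebra setT G ->
  Gmeas G f <-> forall U, measurable U -> G (f @^-1` U).
Proof.
move=> sG; have E := sigma_algebra_id sG; split.
  by move=> mf U mU; have := mf measurableT U mU; rewrite setTI /measurable/= E.
move=> mf _ U mU; rewrite setTI /measurable/= E; exact: mf.
Qed.

Lemma Gmeas_sub G H f : sigma_algebra setT G -> sigma_algebra setT H -> G `<=` H ->
  Gmeas G f -> Gmeas H f.
Proof.
move=> sG sH GH /(GmeasP _ sG) mf; apply/(GmeasP _ sH) => U mU; exact/GH/mf.
Qed.

Lemma Gmeas_measurable G f : sigma_algebra setT G -> G `<=` measurable ->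
  Gmeas G f -> measurable_fun setT f.
Proof.
move=> sG Gm /(GmeasP _ sG) mf _ U mU; rewrite setTI; exact/Gm/mf.
Qed.

Lemma Gmeas_indic G (A : set T) : sigma_algebra setT G -> G A -> Gmeas G (\1_A : T -> R).
Proof.
move=> sG GA; apply: measurable_indic.
by rewrite /measurable/= sigma_algebra_id.
Qed.

End Filtration_measurability.

Section Brownian_increments.
Context {d : measure_display} {T : measurableType d} {R : realType}.
Variable P : probability T R.
Variable F : R -> set (set T).
Hypothesis hF : is_filtration F.
Implicit Types (s t r h : R) (B : R -> T -> R) (Z U : T -> R).

(** The almost sure clauses of [is_brownian] are strengthened to hold for every [w], and continuity
    to the whole line; [regular_version] provides such processes. *)
Record bm_facts B : Prop := BmFacts {
  bm_continuous : forall w, continuous (B ^~ w) ;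
  bm_start : forall w, B 0 w = 0 ;
  bm_adapted : forall t, 0 <= t -> Gmeas (F t) (B t) ;
  bm_normal : forall s t, 0 <= s -> s < t -> forall V, measurable V ->
    P ((fun w => B t w - B s w) @^-1` V) = normal_prob 0 (Num.sqrt (t - s)) V ;
  bm_indep : forall s t, 0 <= s -> s < t -> forall A V, F s A -> measurable V ->
    P (A `&` (fun w => B t w - B s w) @^-1` V) =
    (P A * P ((fun w => (B t w - B s w)%R) @^-1` V))%E }.

Lemma Fsigma t : 0 <= t -> sigma_algebra setT (F t).
Proof. exact: filtration_sigma. Qed.

Lemma Fmeas_measurable t Z : 0 <= t -> Gmeas (F t) Z -> measurable_fun setT Z.
Proof. by move=> t0; apply: Gmeas_measurable; [exact: Fsigma|exact: (filtration_sub hF)]. Qed.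

Lemma Fmeas_le s t Z : 0 <= s -> s <= t -> Gmeas (F s) Z -> Gmeas (F t) Z.
Proof.
move=> s0 st; apply: Gmeas_sub; [exact: Fsigma|apply: Fsigma|exact: (filtration_mono hF)].
exact: le_trans st.
Qed.

Section One.
Variable B : R -> T -> R.
Hypothesis hB : bm_facts B.

Definition incr B s t w := B t w - B s w.

Lemma incr_Fmeas s t r : 0 <= s -> s <= r -> 0 <= t -> t <= r -> Gmeas (F r) (incr B s t).
Proof.
move=> s0 sr t0 tr; apply: measurable_funB.
  by apply: Fmeas_le (bm_adapted hB t0) => //.
by apply: Fmeas_le (bm_adapted hB s0) => //.
Qed.

Lemma incr_measurable s t : 0 <= s -> s <= t -> measurable_fun setT (incr B s t).
Proof.
move=> s0 st; have t0 := le_trans s0 st.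
by apply: (Fmeas_measurable t0); apply: incr_Fmeas.
Qed.

Lemma incr_int4 s t : 0 <= s -> s <= t -> integrableR P (fun w => incr B s t w ^+ 4).
Proof.
move=> s0; rewrite le_eqVlt => /predU1P[<-|st].
  rewrite (_ : (fun=> _) = fun=> 0); first exact: integrableR_cst.
  by apply/funext => w; rewrite /incr subrr expr0n.
apply: normal_moment4_integrable (bm_normal hB s0 st).
  exact: incr_measurable (ltW st).
by rewrite sqrtr_gt0 subr_gt0.
Qed.

Lemma incr_int2 s t : 0 <= s -> s <= t -> integrableR P (fun w => incr B s t w ^+ 2).
Proof.
move=> s0 st.
apply: (@le_integrableR _ _ _ _ _ (fun w => 1 + incr B s t w ^+ 4)).
- by apply: measurable_funX; exact: incr_measurable.
- move=> w; rewrite ger0_norm ?sqr_ge0// (exprM _ 2 2); have := sqr_ge0 (incr B s t w ^+ 2 - 1); nra.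
- by apply: integrableRD; [exact: integrableR_cst|exact: incr_int4].
Qed.

Lemma incr_int1 s t : 0 <= s -> s <= t -> integrableR P (incr B s t).
Proof.
move=> s0 st.
apply: (@le_integrableR _ _ _ _ _ (fun w => 1 + incr B s t w ^+ 2)).
- exact: incr_measurable.
- by move=> w; rewrite ler_norml; nra.
- by apply: integrableRD; [exact: integrableR_cst|exact: incr_int2].
Qed.

Lemma incr_mean s t : 0 <= s -> s <= t -> expect P (incr B s t) = 0.
Proof.
move=> s0; rewrite le_eqVlt => /predU1P[<-|st].
  rewrite -[RHS](expect_cst P 0); apply: eq_expect => w; exact: subrr.
apply: normal_moment1 (bm_normal hB s0 st).
  exact: incr_measurable (ltW st).
by rewrite sqrtr_gt0 subr_gt0.
Qed.

Lemma incr_var s t : 0 <= s -> s <= t -> expect P (fun w => incr B s t w ^+ 2) = t - s.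
Proof.
move=> s0; rewrite le_eqVlt => /predU1P[<-|st].
  rewrite subrr -[RHS](expect_cst P 0); apply: eq_expect => w.
  by rewrite /incr subrr expr0n.
rewrite (normal_moment2 _ _ (bm_normal hB s0 st)).
- by rewrite sqr_sqrtr// subr_ge0 ltW.
- exact: incr_measurable (ltW st).
by rewrite sqrtr_gt0 subr_gt0.
Qed.

Definition moment4_cst : R := 512 * expR (2^-1).

Lemma incr_moment4 s t : 0 <= s -> s < t ->
  expect P (fun w => incr B s t w ^+ 4) <= moment4_cst * (t - s) ^+ 2.
Proof.
move=> s0 st.
apply: le_trans (normal_moment4_le _ _ (bm_normal hB s0 st)) _.
- exact: incr_measurable (ltW st).
- by rewrite sqrtr_gt0 subr_gt0.
- by rewrite (exprM _ 2 2) sqr_sqrtr// subr_ge0 ltW.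
Qed.

Lemma incr_indep s t Z (g : R -> R) : 0 <= s -> s < t -> Gmeas (F s) Z ->
  integrableR P Z -> measurable_fun setT g -> integrableR P (g \o incr B s t) ->
  integrableR P (fun w => Z w * g (incr B s t w)) /\
  expect P (fun w => Z w * g (incr B s t w)) = expect P Z * expect P (g \o incr B s t).
Proof.
move=> s0 st mZ iZ mg ig.
have mZ' := (GmeasP _ (Fsigma s0)).1 mZ.
apply: (@expectM_indep _ _ _ _ Z (g \o incr B s t)) => //.
- exact: Fmeas_measurable mZ.
- by apply: measurableT_comp => //; apply: incr_measurable => //; exact: ltW.
move=> A V mA mV; rewrite comp_preimage (bm_indep hB s0 st)//; first exact: mZ'.
by rewrite -[X in measurable X]setTI; exact: mg.
Qed.

Lemma incr_mart s t Z : 0 <= s -> s <= t -> Gmeas (F s) Z -> integrableR P Z ->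
  integrableR P (fun w => Z w * incr B s t w) /\ expect P (fun w => Z w * incr B s t w) = 0.
Proof.
move=> s0; rewrite le_eqVlt => /predU1P[<-|st] mZ iZ.
  rewrite (_ : (fun=> _) = fun=> 0); first by split; [exact: integrableR_cst|exact: expect_cst].
  by apply/funext => w; rewrite /incr subrr mulr0.
have [] := @incr_indep s t Z id s0 st mZ iZ.
- exact: measurable_id.
- exact: incr_int1 (ltW st).
by move=> i ->; rewrite (incr_mean s0 (ltW st)) mulr0.
Qed.

Lemma incr_mart2 s t Z : 0 <= s -> s < t -> Gmeas (F s) Z -> integrableR P Z ->
  integrableR P (fun w => Z w * incr B s t w ^+ 2) /\
  expect P (fun w => Z w * incr B s t w ^+ 2) = expect P Z * (t - s).
Proof.
move=> s0 st mZ iZ.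
have [] := @incr_indep s t Z (fun x => x ^+ 2) s0 st mZ iZ.
- exact: measurable_funX.
- exact: incr_int2 (ltW st).
by move=> i ->; rewrite (incr_var s0 (ltW st)).
Qed.

End One.

(* Expanding [(\sum_i dX_i * dY_i) ^+ 2] involves only products of two increments
   of the same process. *)
Definition indep_incr_products (X Y : R -> T -> R) : Prop :=
  forall s1 t1 s2 t2, 0 <= s1 -> s1 <= t1 -> 0 <= s2 -> s2 <= t2 ->
  forall V1 V2, measurable V1 -> measurable V2 ->
  P ((fun w => incr X s1 t1 w * incr X s2 t2 w) @^-1` V1 `&`
     (fun w => incr Y s1 t1 w * incr Y s2 t2 w) @^-1` V2) =
  (P ((fun w => (incr X s1 t1 w * incr X s2 t2 w)%R) @^-1` V1) *
   P ((fun w => (incr Y s1 t1 w * incr Y s2 t2 w)%R) @^-1` V2))%E.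

Lemma integrableR_prod Z U : measurable_fun setT Z -> measurable_fun setT U ->
  integrableR P (fun w => Z w ^+ 2) -> integrableR P (fun w => U w ^+ 2) ->
  integrableR P (fun w => Z w * U w).
Proof.
move=> mZ mU iZ iU; apply: le_integrableR (integrableRD iZ iU).
  exact: measurable_funM.
by move=> w; rewrite ler_norml; nra.
Qed.

Section Two.
Variables X Y : R -> T -> R.
Hypotheses (hX : bm_facts X) (hY : bm_facts Y).
Hypothesis XY : indep_incr_products X Y.

Section Cross.
Variables (s h : R) (s0 : 0 <= s) (h0 : 0 < h).

Let r (i : nat) := s + i%:R * h.

Let r0 i : 0 <= r i. Proof. by rewrite addr_ge0// mulr_ge0// ltW. Qed.

Let rS i : r i.+1 = r i + h. Proof. by rewrite /r -natr1; ring. Qed.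

Let r_le i j : (i <= j)%N -> r i <= r j.
Proof. by move=> ij; rewrite lerD2l ler_pM2r// ler_nat. Qed.

Let rr i : r i <= r i.+1. Proof. exact: r_le. Qed.

Let a i := incr X (r i) (r i.+1).
Let b i := incr Y (r i) (r i.+1).
Let Q k w := \sum_(i < k) a i w * b i w.

Let ab_prod i k :
  integrableR P (fun w => a i w * a k w) -> integrableR P (fun w => b i w * b k w) ->
  integrableR P (fun w => (a i w * b i w) * (a k w * b k w)) /\
  expect P (fun w => (a i w * b i w) * (a k w * b k w)) =
  expect P (fun w => a i w * a k w) * expect P (fun w => b i w * b k w).
Proof.
move=> ia ib.
have [] := @expectM_indep _ _ _ P (fun w => a i w * a k w) (fun w => b i w * b k w) _ _ _ ia ib.
- exact: integrableR_measurable ia.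
- exact: integrableR_measurable ib.
- by move=> A B mA mB; exact: XY.
rewrite (_ : (fun=> _) = (fun w => a i w * b i w * (a k w * b k w))) //.
by apply/funext => w; ring.
Qed.

(** The expectation factors across the two independent processes, and [a i * a k] has mean zero
    because the later increment is centred given [F (r k)]. *)
Let offdiag i k : (i < k)%N ->
  integrableR P (fun w => (a i w * b i w) * (a k w * b k w)) /\
  expect P (fun w => (a i w * b i w) * (a k w * b k w)) = 0.
Proof.
move=> ik; have rik := r_le ik.
have [ia ea] := incr_mart hX (r0 k) (rr k)
  (incr_Fmeas hX (r0 i) (le_trans (rr i) rik) (r0 i.+1) rik) (incr_int1 hX (r0 i) (rr i)).
have [ib eb] := incr_mart hY (r0 k) (rr k)
  (incr_Fmeas hY (r0 i) (le_trans (rr i) rik) (r0 i.+1) rik) (incr_int1 hY (r0 i) (rr i)).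
by have [i1 ->] := ab_prod ia ib; split=> //; rewrite ea mul0r.
Qed.

Let diag i :
  integrableR P (fun w => (a i w * b i w) * (a i w * b i w)) /\
  expect P (fun w => (a i w * b i w) * (a i w * b i w)) = h ^+ 2.
Proof.
have E (f : T -> R) : (fun w => f w * f w) = (fun w => f w ^+ 2) by apply/funext => w; rewrite expr2.
have ia := incr_int2 hX (r0 i) (rr i); have ib := incr_int2 hY (r0 i) (rr i).
have [||i1 e1] := @ab_prod i i; try by rewrite E.
split=> //; rewrite e1 !E (incr_var hX)// (incr_var hY)// rS; ring.
Qed.

Let mab i : measurable_fun setT (fun w => a i w * b i w).
Proof. by apply: measurable_funM; apply: incr_measurable. Qed.

Let mQ k : measurable_fun setT (Q k).
Proof. by apply: measurable_sum => i; exact: mab. Qed.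

Let QS k : Q k.+1 = fun w => Q k w + a k w * b k w.
Proof. by apply/funext => w; rewrite /Q big_ord_recr. Qed.

Let Qq k m : (k <= m)%N -> integrableR P (fun w => Q k w * (a m w * b m w)) /\
  expect P (fun w => Q k w * (a m w * b m w)) = 0.
Proof.
elim: k => [_|k IH km].
  rewrite (_ : (fun=> _) = fun=> 0); first by split; [exact: integrableR_cst|exact: expect_cst].
  by apply/funext => w; rewrite /Q big_ord0 mul0r.
have [i1 e1] := IH (ltnW km); have [i2 e2] := offdiag km.
rewrite QS (_ : (fun=> _) = (fun w => Q k w * (a m w * b m w) + (a k w * b k w) * (a m w * b m w))).
  by split; [exact: integrableRD|rewrite expectD// e1 e2 addr0].
by apply/funext => w; rewrite mulrDl.
Qed.

Let Qsq k : integrableR P (fun w => Q k w ^+ 2) /\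
  expect P (fun w => Q k w ^+ 2) = k%:R * h ^+ 2.
Proof.
elim: k => [|k [i1 e1]].
  rewrite (_ : (fun=> _) = fun=> 0); first by rewrite mul0r; split; [exact: integrableR_cst|exact: expect_cst].
  by apply/funext => w; rewrite /Q big_ord0 expr0n.
have [i2 e2] := Qq (leqnn k); have [i3 e3] := diag k.
rewrite QS (_ : (fun=> _) = (fun w => Q k w ^+ 2 + (2 * (Q k w * (a k w * b k w)) +
   a k w * b k w * (a k w * b k w)))); last by apply/funext => w; ring.
have i4 : integrableR P (fun w => 2 * (Q k w * (a k w * b k w)) +
   a k w * b k w * (a k w * b k w)) by apply: integrableRD => //; exact: integrableRZ.
split; first exact: integrableRD.
rewrite expectD// expectD//; last exact: integrableRZ.
by rewrite expectZ// e1 e2 e3 -natr1; ring.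
Qed.

Variables (Z : T -> R) (C : R).
Hypotheses (mZ : Gmeas (F s) Z) (ZC : forall w, `|Z w| <= C).

Let mZ' : measurable_fun setT Z. Proof. exact: Fmeas_measurable mZ. Qed.

Let Zs i : Gmeas (F (r i)) Z.
Proof. by apply: Fmeas_le mZ => //; rewrite lerDl mulr_ge0// ltW. Qed.

Let r00 : r 0 = s. Proof. by rewrite /r mul0r addr0. Qed.
Let sr k : s <= r k. Proof. by rewrite -r00; exact: r_le. Qed.

Let iQ k : integrableR P (Q k).
Proof.
apply: (@le_integrableR _ _ _ _ _ (fun w => 1 + Q k w ^+ 2)) => //.
- by move=> w; rewrite ler_norml; nra.
- by apply: integrableRD; [exact: integrableR_cst|have [] := Qsq k].
Qed.

(** Expanding the product over one more step, the two mixed terms pair an increment with a variable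
    of [F (r k)] and have mean zero; only [a k * b k] survives. *)
Let cross_sum k : expect P (fun w => Z w * (incr X s (r k) w * incr Y s (r k) w)) =
  expect P (fun w => Z w * Q k w).
Proof.
elim: k => [|k IH].
  by apply: eq_expect => w; rewrite /Q big_ord0 r00 /incr !subrr mul0r.
pose A := incr X s (r k); pose B := incr Y s (r k).
have sk := sr k.
have iA : integrableR P (fun w => Z w * A w) by apply: integrableRM_bounded ZC _ => //; exact: incr_int1.
have iB : integrableR P (fun w => Z w * B w) by apply: integrableRM_bounded ZC _ => //; exact: incr_int1.
have mA : Gmeas (F (r k)) (fun w => Z w * A w).
  by apply: measurable_funM; [exact: Zs|exact: incr_Fmeas].
have mB : Gmeas (F (r k)) (fun w => Z w * B w).
  by apply: measurable_funM; [exact: Zs|exact: incr_Fmeas].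
have [i1 e1] := incr_mart hY (r0 k) (rr k) mA iA.
have [i2 e2] := incr_mart hX (r0 k) (rr k) mB iB.
have iAB : integrableR P (fun w => Z w * (A w * B w)).
  apply: integrableRM_bounded ZC _ => //; apply: integrableR_prod; try exact: incr_measurable.
    exact: incr_int2.
  exact: incr_int2.
have iab : integrableR P (fun w => Z w * (a k w * b k w)).
  apply: integrableRM_bounded ZC _ => //; apply: integrableR_prod; try exact: incr_measurable.
    exact: incr_int2.
  exact: incr_int2.
rewrite QS.
transitivity (expect P (fun w => Z w * (A w * B w) + (Z w * A w * b k w + (Z w * B w * a k w
   + Z w * (a k w * b k w))))).
  by apply: eq_expect => w; rewrite /A /B /a /b /incr; ring.
have i3 := integrableRD i2 iab; have i4 := integrableRD i1 i3.
rewrite expectD// expectD// expectD// e1 e2 !add0r IH.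
rewrite -expectD//; last by apply: integrableRM_bounded ZC _.
by apply: eq_expect => w; ring.
Qed.

(* [X] and [Y] are not assumed jointly independent of [F s]. Refining the mesh
   replaces the product of increments by [Q k = \sum_i dX_i * dY_i], whose second
   moment [k%:R * h ^+ 2] is small. *)
Lemma cross_bound k l : 0 < l ->
  `|expect P (fun w => Z w * (incr X s (r k) w * incr Y s (r k) w))|
    <= C * (l + k%:R * h ^+ 2 / l).
Proof.
move=> l0; rewrite cross_sum; have [iq eq] := Qsq k.
have C0 : 0 <= C by apply: le_trans (ZC point).
have -> : C * (l + k%:R * h ^+ 2 / l) = expect P (fun w => C * (l + l^-1 * Q k w ^+ 2)).
  rewrite expectZ; last by apply: integrableRD; [exact: integrableR_cst|exact: integrableRZ].
  rewrite expectD; [|exact: integrableR_cst|exact: integrableRZ].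
  by rewrite expect_cst expectZ// eq; field; exact: lt0r_neq0.
apply: expect_norm_le.
- exact: integrableRM_bounded ZC _.
- by apply: integrableRZ; apply: integrableRD; [exact: integrableR_cst|exact: integrableRZ].
(* [|q| <= l + q ^+ 2 / l] holds for every [l > 0] and replaces the Cauchy-Schwarz inequality. *)
move=> w; rewrite normrM ler_pM// mulrC.
rewrite -lerBlDl ler_pdivlMr//.
set q := Q k w; have : q ^+ 2 = `|q| ^+ 2 by rewrite real_normK// num_real.
move=> ->; have := normr_ge0 q; nra.
Qed.

End Cross.

Lemma incr_cross s t Z (C : R) : 0 <= s -> s < t -> Gmeas (F s) Z -> (forall w, `|Z w| <= C) ->
  expect P (fun w => Z w * (incr X s t w * incr Y s t w)) = 0.
Proof.
move=> s0 st mZ ZC.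
apply: (@small_eq0 _ _ (C * (1 + (t - s) ^+ 2))) => l l0 l1.
have C0 : 0 <= C by apply: le_trans (ZC point).
(* With [k >= l ^- 2] steps of length [(t - s) / k], the second term of [cross_bound] is at most
   [(t - s) ^+ 2 * l], so the whole bound is of order [l]. *)
pose k := (Num.truncn (l ^- 2)).+1.
have kl : (k%:R)^-1 <= l ^+ 2.
  rewrite -[X in _ <= X]invrK lef_pV2 ?posrE ?ltr0n// ?invr_gt0 ?exprn_gt0//.
  by rewrite ltW// truncnS_gt.
have k0 : (k%:R : R) != 0 by rewrite pnatr_eq0.
have h0 : 0 < (t - s) / k%:R by rewrite divr_gt0 ?subr_gt0// ltr0n.
have := cross_bound s0 h0 mZ ZC k l0.
rewrite (_ : s + _ = t); last by field.
move=> /le_trans; apply; rewrite -(mulrA C) ler_wpM2l//.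
rewrite [X in _ <= X]mulrDl mul1r lerD2l.
have -> : k%:R * ((t - s) / k%:R) ^+ 2 / l = (t - s) ^+ 2 * (k%:R^-1 / l).
  by field; rewrite k0 lt0r_neq0.
rewrite ler_wpM2l ?sqr_ge0// ler_pdivrMr//.
Qed.

End Two.

End Brownian_increments.

(** * Lindeberg's method *)

Section Heat_bounds.
Context {R : realType}.
Implicit Types (x y w v : R).

Lemma measurable_PhiR : measurable_fun setT (fun y : R => Phi y%:E).
Proof.
apply: continuous_measurable_fun => y.
by apply/differentiable_continuous/derivable1_diffP; case: (is_derive_Phi y).
Qed.

Lemma continuous_PhiR : continuous (fun y : R => Phi y%:E).
Proof.
by move=> y; apply/differentiable_continuous/derivable1_diffP; case: (is_derive_Phi y).
Qed.

Lemma measurable_heat1 w : measurable_fun setT (heat1 w).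
Proof.
apply: measurable_funM => //; apply: measurableT_comp.
  exact: measurable_normal_pdf.
exact: measurable_funM.
Qed.

Lemma measurable_heat2 w : measurable_fun setT (heat2 w).
Proof.
apply: measurableT_comp => //; apply: measurable_funM => //; apply: measurable_funM.
  exact: measurable_funM.
apply: measurableT_comp; first exact: measurable_normal_pdf.
exact: measurable_funM.
Qed.

Lemma heat1_bound w y : 0 < w -> `|heat1 w y| <= 17 * @gauss_cst R / Num.sqrt w.
Proof.
move=> w0; have s0 : 0 < Num.sqrt w by rewrite sqrtr_gt0.
rewrite /heat1 normrM [X in _ * X <= _]ger0_norm ?invr_ge0 ?(ltW s0)//.
rewrite ler_wpM2r ?invr_ge0 ?(ltW s0)// -[normal_pdf _ _ _]mul1r.
rewrite (_ : 17 = 17 * 1); last by rewrite mulr1.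
apply: (@poly_phi_bound _ (fun=> 1)) => z.
by rewrite normr1 mul1r lerDl (exprM _ 2 2) sqr_ge0.
Qed.

Lemma heat2_bound w y : 0 < w -> `|heat2 w y| <= 17 * @gauss_cst R / w.
Proof.
move=> w0.
rewrite /heat2 normrN normrM [X in _ * X <= _]ger0_norm ?invr_ge0 ?(ltW w0)//.
rewrite ler_wpM2r ?invr_ge0 ?(ltW w0)//.
rewrite (_ : 17 = 17 * 1); last by rewrite mulr1.
apply: (@poly_phi_bound _ id) => z.
rewrite mul1r ler_norml (exprM _ 2 2).
have := sqr_ge0 (z ^+ 2 - 1); have := sqr_ge0 (z - 1); have := sqr_ge0 (z + 1); nra.
Qed.

End Heat_bounds.

Section Lindeberg.
Context {d : measure_display} {T : measurableType d} {R : realType}.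
Variable P : probability T R.
Variable F : R -> set (set T).
Hypothesis hF : is_filtration F.
Variables X Y : R -> T -> R.
Hypotheses (hX : bm_facts P F X) (hY : bm_facts P F Y).
Hypothesis XY : indep_incr_products P X Y.

Local Notation "'EE' f" := (expect P f) (at level 10, f at level 8).

Section One_step.
Variables (s h v : R) (s0 : 0 <= s) (h0 : 0 < h) (v0 : 0 < v).
Variables (a b M : T -> R).
Hypotheses (ma : Gmeas (F s) a) (mb : Gmeas (F s) b) (mM : Gmeas (F s) M).
Hypothesis ab1 : forall w, a w ^+ 2 + b w ^+ 2 = 1.

Let x := incr X s (s + h).
Let y := incr Y s (s + h).
Let dl w := a w * x w + b w * y w.

Let ssh : s < s + h. Proof. by rewrite ltrDl. Qed.
Let shh : s + h - s = h. Proof. by ring. Qed.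
Let a_le1 w : `|a w| <= 1. Proof. by have := ab1 w; rewrite ler_norml; nra. Qed.
Let b_le1 w : `|b w| <= 1. Proof. by have := ab1 w; rewrite ler_norml; nra. Qed.
Let ma' : measurable_fun setT a. Proof. exact: Fmeas_measurable ma. Qed.
Let mb' : measurable_fun setT b. Proof. exact: Fmeas_measurable mb. Qed.
Let mM' : measurable_fun setT M. Proof. exact: Fmeas_measurable mM. Qed.
Let mx : measurable_fun setT x. Proof. exact: (incr_measurable hF hX s0 (ltW ssh)). Qed.
Let my : measurable_fun setT y. Proof. exact: (incr_measurable hF hY s0 (ltW ssh)). Qed.
Let mdl : measurable_fun setT dl.
Proof. by apply: measurable_funD; apply: measurable_funM. Qed.

Let step_mean (Z : T -> R) (C : R) : Gmeas (F s) Z -> (forall w, `|Z w| <= C) ->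
  integrableR P (fun w => Z w * dl w) /\ EE (fun w => Z w * dl w) = 0.
Proof.
move=> mZ ZC.
have b1 (f : T -> R) : Gmeas (F s) f -> (forall w, `|f w| <= 1) ->
    Gmeas (F s) (fun w => Z w * f w) /\ integrableR P (fun w => Z w * f w).
  move=> mf f1; have m1 : Gmeas (F s) (fun w => Z w * f w) by exact: measurable_funM.
  split=> //; apply: (@bounded_integrableR _ _ _ _ C); first exact: Fmeas_measurable m1.
  by move=> w; rewrite normrM -[C]mulr1 ler_pM.
have [m1 i1] := b1 a ma a_le1; have [m2 i2] := b1 b mb b_le1.
have [j1 e1] := incr_mart hF hX s0 (ltW ssh) m1 i1.
have [j2 e2] := incr_mart hF hY s0 (ltW ssh) m2 i2.
rewrite (_ : (fun=> _) = (fun w => Z w * a w * x w + Z w * b w * y w)).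
  by split; [exact: integrableRD|rewrite expectD// e1 e2 addr0].
by apply/funext => w; rewrite /dl; ring.
Qed.

(** The cross term vanishes by [incr_cross], and [ab1] makes the two variances add up to [h]. *)
Let step_var (Z : T -> R) (C : R) : Gmeas (F s) Z -> (forall w, `|Z w| <= C) ->
  integrableR P (fun w => Z w * (dl w ^+ 2 - h)) /\ EE (fun w => Z w * (dl w ^+ 2 - h)) = 0.
Proof.
move=> mZ ZC.
have b1 (f : T -> R) : Gmeas (F s) f -> (forall w, `|f w| <= 1) ->
    [/\ Gmeas (F s) (fun w => Z w * f w), forall w, `|Z w * f w| <= C
      & integrableR P (fun w => Z w * f w)].
  move=> mf f1; have m1 : Gmeas (F s) (fun w => Z w * f w) by exact: measurable_funM.
  have bZ w : `|Z w * f w| <= C by rewrite normrM -[C]mulr1 ler_pM.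
  by split=> //; apply: (@bounded_integrableR _ _ _ _ C) => //; exact: Fmeas_measurable m1.
have [||m1 _ i1] := b1 (fun w => a w ^+ 2); first exact: measurable_funX.
  by move=> w; rewrite normrX exprn_ile1.
have [||m2 _ i2] := b1 (fun w => b w ^+ 2); first exact: measurable_funX.
  by move=> w; rewrite normrX exprn_ile1.
have [||m3 bd3 i3] := b1 (fun w => a w * b w); first exact: measurable_funM.
  by move=> w; rewrite normrM mulr_ile1.
have [j1 e1] := incr_mart2 hF hX s0 ssh m1 i1.
have [j2 e2] := incr_mart2 hF hY s0 ssh m2 i2.
have e3 := incr_cross hF hX hY XY s0 ssh m3 bd3.
have j3 : integrableR P (fun w => Z w * (a w * b w) * (x w * y w)).
  apply: integrableRM_bounded bd3 _; first exact: Fmeas_measurable m3.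
  apply: integrableR_prod => //; first exact: (incr_int2 hF hX s0 (ltW ssh)).
  exact: (incr_int2 hF hY s0 (ltW ssh)).
have iZ : integrableR P Z by apply: bounded_integrableR ZC; exact: Fmeas_measurable mZ.
rewrite (_ : (fun=> _) = (fun w => Z w * a w ^+ 2 * x w ^+ 2 + (Z w * b w ^+ 2 * y w ^+ 2 +
   (2 * (Z w * (a w * b w) * (x w * y w)) - h * Z w)))); last first.
  by apply/funext => w; rewrite /dl; ring.
have k3 : integrableR P (fun w => 2 * (Z w * (a w * b w) * (x w * y w)) - h * Z w).
  by apply: integrableRB; exact: integrableRZ.
have k2 := integrableRD j2 k3.
split; first exact: integrableRD.
rewrite expectD// expectD// expectB; [|exact: integrableRZ..].
rewrite !expectZ// e1 e2 e3 !shh.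
have -> : EE Z = EE (fun w => Z w * a w ^+ 2) + EE (fun w => Z w * b w ^+ 2).
  by rewrite -expectD//; apply: eq_expect => w; rewrite -mulrDr ab1 mulr1.
ring.
Qed.

Let step_cube : integrableR P (fun w => `|dl w| ^+ 3) /\
  EE (fun w => `|dl w| ^+ 3) <= (1 + 2 * moment4_cst) * (h * Num.sqrt h).
Proof.
set q := Num.sqrt h; have q0 : 0 < q by rewrite sqrtr_gt0.
have hq : h = q ^+ 2 by rewrite sqr_sqrtr// ltW.
(* [G] comes from [e ^+ 3 <= (q * e ^+ 2 + e ^+ 4 / q) / 2] with [e = |dl w|]; the weight
   [q = Num.sqrt h] gives both terms an expectation of order [h * Num.sqrt h]. *)
pose G w := q / 2 * (x w ^+ 2 + y w ^+ 2) + q^-1 * (x w ^+ 4 + y w ^+ 4).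
have ix2 := incr_int2 hF hX s0 (ltW ssh); have iy2 := incr_int2 hF hY s0 (ltW ssh).
have ix4 := incr_int4 hF hX s0 (ltW ssh); have iy4 := incr_int4 hF hY s0 (ltW ssh).
have iG : integrableR P G.
  by apply: integrableRD; apply: integrableRZ; exact: integrableRD.
have dG w : `|dl w| ^+ 3 <= G w.
  have d2 : dl w ^+ 2 <= x w ^+ 2 + y w ^+ 2.
    have := sqr_ge0 (a w * y w - b w * x w); rewrite /dl; have := ab1 w.
    move: (a w) (b w) (x w) (y w) => a1 b1 x1 y1 E.
    have -> : x1 ^+ 2 + y1 ^+ 2 = (a1 ^+ 2 + b1 ^+ 2) * (x1 ^+ 2 + y1 ^+ 2) by rewrite E mul1r.
    lra.
  have d4 : (x w ^+ 2 + y w ^+ 2) ^+ 2 <= 2 * (x w ^+ 4 + y w ^+ 4).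
    rewrite !(exprM _ 2 2); have := sqr_ge0 (x w ^+ 2 - y w ^+ 2); lra.
  move: d2 d4; rewrite /G.
  move: (x w ^+ 2 + y w ^+ 2) (x w ^+ 4 + y w ^+ 4) => S2 S4.
  have -> : dl w ^+ 2 = `|dl w| ^+ 2 by rewrite real_normK// num_real.
  have := normr_ge0 (dl w); move: `|dl w| => e e0 eS2 S24.
  have e4 : (e ^+ 2) ^+ 2 <= 2 * S4.
    apply: le_trans S24; rewrite lerXn2r ?nnegrE ?sqr_ge0//; apply: le_trans eS2; exact: sqr_ge0.
  rewrite -(ler_pM2l q0) mulrDr !mulrA mulfV ?lt0r_neq0// mul1r.
  have := sqr_ge0 (q * e - e ^+ 2); have : q * q * e ^+ 2 <= q * q * S2.
    by rewrite ler_pM2l// mulr_gt0.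
  rewrite exprSr; nra.
split.
  apply: (le_integrableR _ _ iG); first by apply: measurable_funX; exact: measurableT_comp.
  by move=> w; rewrite ger0_norm// exprn_ge0.
apply: (@le_trans _ _ (EE G)).
  apply: le_expect => //; apply: (le_integrableR _ _ iG).
    by apply: measurable_funX; exact: measurableT_comp.
  by move=> w; rewrite ger0_norm// exprn_ge0.
rewrite /G expectD; [|by apply: integrableRZ; exact: integrableRD..].
rewrite !expectZ; [|exact: integrableRD..].
rewrite !expectD// (incr_var hF hX s0 (ltW ssh)) (incr_var hF hY s0 (ltW ssh)) shh.
have m1 := incr_moment4 hF hX s0 ssh; have m2 := incr_moment4 hF hY s0 ssh.
rewrite shh in m1 m2.
have : q^-1 * (EE (fun w => x w ^+ 4) + EE (fun w => y w ^+ 4)) <=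
    q^-1 * (2 * moment4_cst * h ^+ 2).
  by rewrite ler_pM2l ?invr_gt0//; rewrite /x /y; lra.
have -> : q^-1 * (2 * moment4_cst * h ^+ 2) = 2 * moment4_cst * (h * q).
  by rewrite hq; field; exact: lt0r_neq0.
have -> : q / 2 * (h + h) = h * q by field.
by move=> ?; rewrite [X in _ <= X]mulrDl mul1r lerD2l.
Qed.

(** The first and second order terms have mean zero by [step_mean] and [step_var]. What is left is
    of order [h * Num.sqrt h], small enough to be summed over a grid of mesh [h]. *)
Lemma lindeberg_step K u m : 0 <= K -> v <= u ->
  (forall u h' z e, v <= u -> 0 <= h' ->
    `|Phi ((z + e) / Num.sqrt u)%:E - Phi (z / Num.sqrt (u + h'))%:E - heat1 u z * e
      - heat2 u z / 2 * (e ^+ 2 - h')| <= K * (`|e| ^+ 3 + h' ^+ 2)) ->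
  `|EE (fun w => Phi ((M w + dl w - m) / Num.sqrt u)%:E) -
    EE (fun w => Phi ((M w - m) / Num.sqrt (u + h))%:E)| <=
  K * ((1 + 2 * moment4_cst) * (h * Num.sqrt h) + h ^+ 2).
Proof.
move=> K0 vu HK; have u0 := lt_le_trans v0 vu.
have mMm : Gmeas (F s) (fun w => M w - m) by apply: measurable_funB.
have bPhi (f : T -> R) : measurable_fun setT f -> integrableR P (fun w => Phi (f w)%:E).
  move=> mf; apply: (@bounded_integrableR _ _ _ _ 1).
    by apply: (measurableT_comp measurable_PhiR).
  by move=> w; rewrite ger0_norm ?Phi_ge0 ?Phi_le1.
have [iA eA] := @step_mean (fun w => heat1 u (M w - m)) _
  (measurableT_comp (measurable_heat1 u) mMm) (fun w => heat1_bound _ u0).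
have [||iB eB] := @step_var (fun w => heat2 u (M w - m) / 2) (17 * @gauss_cst R / u / 2).
- apply: measurable_funM => //; exact: (measurableT_comp (measurable_heat2 u) mMm).
- move=> w; rewrite normrM (ger0_norm (_ : 0 <= 2^-1))// ler_wpM2r//.
  exact: heat2_bound.
have i1 : integrableR P (fun w => Phi ((M w + dl w - m) / Num.sqrt u)%:E).
  by apply: bPhi; apply: measurable_funM => //; apply: measurable_funB => //; exact: measurable_funD.
have i2 : integrableR P (fun w => Phi ((M w - m) / Num.sqrt (u + h))%:E).
  by apply: bPhi; apply: measurable_funM => //; exact: measurable_funB.
have [i3 e3] := step_cube.
have -> : EE (fun w => Phi ((M w + dl w - m) / Num.sqrt u)%:E) -
    EE (fun w => Phi ((M w - m) / Num.sqrt (u + h))%:E) =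
  EE (fun w => Phi ((M w + dl w - m) / Num.sqrt u)%:E - Phi ((M w - m) / Num.sqrt (u + h))%:E
    - heat1 u (M w - m) * dl w - heat2 u (M w - m) / 2 * (dl w ^+ 2 - h)).
  rewrite expectB//; last by do !apply: integrableRB.
  by rewrite eB subr0 expectB// ?eA ?subr0 ?expectB//; exact: integrableRB.
apply: (@le_trans _ _ (EE (fun w => K * (`|dl w| ^+ 3 + h ^+ 2)))).
  apply: expect_norm_le.
  - by do !apply: integrableRB.
  - by apply: integrableRZ; apply: integrableRD => //; exact: integrableR_cst.
  move=> w; have := HK u h (M w - m) (dl w) vu (ltW h0).
  by rewrite (_ : M w - m + dl w = M w + dl w - m)//; ring.
rewrite expectZ; last by apply: integrableRD => //; exact: integrableR_cst.
rewrite expectD//; last exact: integrableR_cst.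
by rewrite expect_cst ler_wpM2l// lerD2r.
Qed.

End One_step.

End Lindeberg.

Lemma cvg_dist_bound {R : realType} (e u : R^nat) (l : R) :
  (forall N, `|u N - l| <= e N) -> e N @[N --> \oo] --> 0 -> u N @[N --> \oo] --> l.
Proof.
move=> ue e0; apply/cvgrPdist_le => eps eps0.
have /cvgrPdist_le/(_ _ eps0) := e0; apply: filterS => N.
rewrite sub0r normrN => /(le_trans (ler_norm _)) eN.
by rewrite distrC (le_trans (ue N)).
Qed.

(** * Normal law for limits of grid sums with unit coefficients *)

Section Glued_law.
Context {d : measure_display} {T : measurableType d} {R : realType}.
Variable P : probability T R.
Variable F : R -> set (set T).
Hypothesis hF : is_filtration F.
Variables X Y : R -> T -> R.
Hypotheses (hX : bm_facts P F X) (hY : bm_facts P F Y).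
Hypothesis XY : indep_incr_products P X Y.

(** The Riemann sum of a stochastic integral of [a] against [X] plus [b] against [Y], with
    integrands taken at the left end points. *)
Definition walk h (a b : nat -> T -> R) k w : R := \sum_(j < k)
  (a j w * incr X (j%:R * h) (j%:R * h + h) w + b j w * incr Y (j%:R * h) (j%:R * h + h) w).

Section Fixed_grid.
Variables (h : R) (h0 : 0 < h) (a b : nat -> T -> R).
Hypotheses (ma : forall j, Gmeas (F (j%:R * h)) (a j)) (mb : forall j, Gmeas (F (j%:R * h)) (b j)).
Hypothesis ab1 : forall j w, a j w ^+ 2 + b j w ^+ 2 = 1.

Let jh0 j : 0 <= j%:R * h. Proof. by rewrite mulr_ge0// ltW. Qed.

Lemma walk_Gmeas k : Gmeas (F (k%:R * h)) (walk h a b k).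
Proof.
apply: measurable_sum => i.
have ik : i%:R * h + h <= k%:R * h.
  rewrite (_ : i%:R * h + h = i.+1%:R * h); last by rewrite -natr1 mulrDl mul1r.
  by rewrite ler_pM2r// ler_nat.
have i1 : i%:R * h <= i%:R * h + h by rewrite lerDl ltW.
have i2 := le_trans i1 ik; have i3 := le_trans (jh0 i) i1.
apply: measurable_funD; apply: measurable_funM.
- exact: (Fmeas_le hF (jh0 i) i2 (@ma i)).
- exact: (incr_Fmeas hF hX (jh0 i) i2 i3 ik).
- exact: (Fmeas_le hF (jh0 i) i2 (@mb i)).
- exact: (incr_Fmeas hF hY (jh0 i) i2 i3 ik).
Qed.

Lemma walk_lindeberg v K m n : 0 < v -> 0 <= K ->
  (forall u h' z e, v <= u -> 0 <= h' ->
    `|Phi ((z + e) / Num.sqrt u)%:E - Phi (z / Num.sqrt (u + h'))%:E - heat1 u z * e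
      - heat2 u z / 2 * (e ^+ 2 - h')| <= K * (`|e| ^+ 3 + h' ^+ 2)) ->
  `|expect P (fun w => Phi ((walk h a b n w - m) / Num.sqrt v)%:E) -
    Phi (- m / Num.sqrt (v + n%:R * h))%:E| <=
  n%:R * (K * ((1 + 2 * moment4_cst) * (h * Num.sqrt h) + h ^+ 2)).
Proof.
move=> v0 K0 HK; set B := K * _.
(* [u k] is the variance still to be supplied after [k] steps: [v + n%:R * h] at the start and [v]
   at the end, so that consecutive one-step comparisons telescope. *)
pose u k := v + (n%:R - k%:R) * h.
have H k : (k <= n)%N ->
  `|expect P (fun w => Phi ((walk h a b k w - m) / Num.sqrt (u k))%:E) -
    Phi (- m / Num.sqrt (v + n%:R * h))%:E| <= k%:R * B.
  elim: k => [_|k IH kn].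
    rewrite mul0r normr_le0 subr_eq0; apply/eqP.
    rewrite -[RHS](expect_cst P); apply: eq_expect => w.
    by rewrite /walk big_ord0 sub0r /u subr0.
  have vu : v <= u k.+1.
    by rewrite /u lerDl mulr_ge0 ?(ltW h0)// subr_ge0 ler_nat.
  have := lindeberg_step hF hX hY XY (jh0 k) h0 v0 (@ma k) (@mb k) (@walk_Gmeas k) (ab1 k) m K0 vu HK.
  rewrite -/B (_ : u k.+1 + h = u k); last by rewrite /u -natr1; ring.
  have := IH (ltnW kn).
  have -> : (fun w => Phi ((walk h a b k.+1 w - m) / Num.sqrt (u k.+1))%:E) =
    (fun w => Phi ((walk h a b k w +
        (a k w * incr X (k%:R * h) (k%:R * h + h) w + b k w * incr Y (k%:R * h) (k%:R * h + h) w)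
        - m) / Num.sqrt (u k.+1))%:E).
    by apply/funext => w; rewrite /walk big_ord_recr.
  move=> H1 H2; rewrite -natr1 mulrDl mul1r [X in _ <= X]addrC.
  exact: (le_trans (ler_distD _ _ _) (lerD H2 H1)).
have := H n (leqnn n); by rewrite /u subrr mul0r addr0.
Qed.

End Fixed_grid.

Variables (t : R) (t0 : 0 < t).
Variables (a b : nat -> nat -> T -> R) (W : T -> R).
Let h (N : nat) := t / N.+1%:R.
Hypotheses (ma : forall N j, Gmeas (F (j%:R * h N)) (a N j))
  (mb : forall N j, Gmeas (F (j%:R * h N)) (b N j)).
Hypothesis ab1 : forall N j w, a N j w ^+ 2 + b N j w ^+ 2 = 1.
Hypothesis W_lim : forall w, walk (h N) (a N) (b N) N.+1 w @[N --> \oo] --> W w.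

Let h0 N : 0 < h N. Proof. by rewrite divr_gt0. Qed.

Let Nh N : N.+1%:R * h N = t. Proof. by rewrite mulrC divfK// pnatr_eq0. Qed.

Lemma glued_Gmeas : Gmeas (F t) W.
Proof.
apply: (@measurable_fun_cvg _ (g_sigma_algebraType (F t)) R setT (fun N => walk (h N) (a N) (b N) N.+1)) => //.
by move=> N; have := @walk_Gmeas _ (h0 N) _ _ (@ma N) (@mb N) N.+1; rewrite Nh.
Qed.

Let mW : measurable_fun setT W.
Proof. exact: (Fmeas_measurable hF (ltW t0) glued_Gmeas). Qed.

Let h_cvg0 : h N @[N --> \oo] --> 0.
Proof.
rewrite -(mulr0 t); apply: cvgM; first exact: cvg_cst.
exact: cvg_harmonic.
Qed.

(* [Phi ((z - m) / sqrt v)] is the probability that [z] plus an independent normal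
   variable of variance [v] exceeds [m]; [v] tends to [0] in [glued_law]. *)
Lemma glued_Phi v m : 0 < v ->
  expect P (fun w => Phi ((W w - m) / Num.sqrt v)%:E) = Phi (- m / Num.sqrt (v + t))%:E.
Proof.
move=> v0; have [K K0 HK] := Phi_heat v0.
pose f N w := Phi ((walk (h N) (a N) (b N) N.+1 w - m) / Num.sqrt v)%:E.
have mf N : measurable_fun setT (f N).
  apply: (measurableT_comp measurable_PhiR); apply: measurable_funM => //.
  apply: measurable_funB => //.
  apply: (@Fmeas_measurable _ _ _ _ hF t) (ltW t0) _.
  by have := @walk_Gmeas _ (h0 N) _ _ (@ma N) (@mb N) N.+1; rewrite Nh.
have c1 : expect P (f N) @[N --> \oo] --> expect P (fun w => Phi ((W w - m) / Num.sqrt v)%:E).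
  have mfW : measurable_fun setT (fun w => Phi ((W w - m) / Num.sqrt v)%:E).
    apply: (measurableT_comp measurable_PhiR); apply: measurable_funM => //.
    exact: measurable_funB.
  have bPhi (g : T -> R) : measurable_fun setT g -> (forall w, 0 <= g w <= 1) -> integrableR P g.
    move=> mg g01; apply: (@bounded_integrableR _ _ _ _ 1) => // w.
    by have /andP[g0 g1] := g01 w; rewrite ger0_norm.
  apply: fine_cvg; rewrite fineK; last first.
    apply: integrable_fin_num => //; apply: bPhi => // w; by rewrite Phi_ge0 Phi_le1.
  have [] // := @dominated_convergence _ _ _ P setT measurableT (fun N => EFin \o f N)
    (EFin \o (fun w => Phi ((W w - m) / Num.sqrt v)%:E)) (cst 1%E).
  - by move=> N; apply/measurable_EFinP.
  - by apply/measurable_EFinP.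
  - apply: aeW => w _; apply: cvg_EFin; first by apply: nearW.
    apply: (@continuous_cvg _ _ _ _ _ _ (fun y : R => Phi y%:E)).
      exact: continuous_PhiR.
    apply: cvgM; last exact: cvg_cst.
    by apply: cvgB; [exact: W_lim|exact: cvg_cst].
  - exact: finite_measure_integrable_cst.
  - apply: aeW => w N _; rewrite /= lee_fin ger0_norm ?Phi_ge0 ?Phi_le1//.
have c2 : expect P (f N) @[N --> \oo] --> Phi (- m / Num.sqrt (v + t))%:E.
  (* The [N.+1] errors of order [h N * Num.sqrt (h N)] add up to order [t * Num.sqrt (h N)]. *)
  apply: (@cvg_dist_bound _ (fun N => K * ((1 + 2 * moment4_cst) * (t * Num.sqrt (h N)) + t * h N))).
    move=> N; have := walk_lindeberg (h0 N) (@ma N) (@mb N) (ab1 N) m N.+1 v0 K0 HK.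
    rewrite Nh => /le_trans; apply.
    rewrite le_eqVlt; apply/orP; left; apply/eqP.
    by move: (Nh N); move: (h N) => x <-; ring.
  rewrite -(mulr0 K); apply: cvgM; first exact: cvg_cst.
  rewrite -[X in _ --> X](_ : (1 + 2 * moment4_cst) * (t * 0) + t * 0 = 0); last by ring.
  apply: cvgD; last by apply: cvgM; [exact: cvg_cst|exact: h_cvg0].
  apply: cvgM; first exact: cvg_cst.
  apply: cvgM; first exact: cvg_cst.
  rewrite -[X in _ --> X](@sqrtr0 R).
  by apply: continuous_cvg; [exact: sqrt_continuous|exact: h_cvg0].
exact: (cvg_unique _ c1 c2).
Qed.

Let mge c : measurable [set w | c <= W w].
Proof.
rewrite (_ : [set w | c <= W w] = W @^-1` [set` `[c, +oo[]).
  by have := mW measurableT (measurable_itv `[c, +oo[); rewrite setTI.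
by apply/seteqP; split => w /=; rewrite in_itv/= andbT.
Qed.

Let mgt c : measurable [set w | c < W w].
Proof.
rewrite (_ : [set w | c < W w] = W @^-1` [set` `]c, +oo[]).
  by have := mW measurableT (measurable_itv `]c, +oo[); rewrite setTI.
by apply/seteqP; split => w /=; rewrite in_itv/= andbT.
Qed.

Let pr A := fine (P A).

Let expect_indic A : measurable A -> integrableR P \1_A /\ expect P \1_A = pr A.
Proof.
move=> mA; split; first exact: integrable_indic.
by rewrite /expect /Rintegral /pr integral_indic// setIT.
Qed.

Let iPhi v m : integrableR P (fun w => Phi ((W w - m) / Num.sqrt v)%:E).
Proof.
apply: (@bounded_integrableR _ _ _ _ 1).
  apply: (measurableT_comp measurable_PhiR); apply: measurable_funM => //.
  exact: measurable_funB.
by move=> w; rewrite ger0_norm ?Phi_ge0 ?Phi_le1.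
Qed.

(** On [m + e <= W] the smoothed indicator is at least [Phi (e / sqrt v)], which tends to 1 as [v]
    tends to 0; [lower] is the companion bound, by [Phi (- e / sqrt v)] off the event
    [m - e < W]. *)
Let upper v m e : 0 < v -> 0 < e ->
  pr [set w | m + e <= W w] * Phi (e / Num.sqrt v)%:E <= Phi (- m / Num.sqrt (v + t))%:E.
Proof.
move=> v0 e0; rewrite -glued_Phi//.
have [i1 <-] := expect_indic (mge (m + e)); rewrite mulrC -expectZ//.
apply: le_expect => //; first exact: integrableRZ.
move=> w; rewrite indicE; case: (boolP (w \in _)) => [|_]; last by rewrite mulr0 Phi_ge0.
rewrite inE/= mulr1 => mW'; apply: le_Phi.
by rewrite lee_fin ler_wpM2r ?invr_ge0//; lra.
Qed.

Let lower v m e : 0 < v -> 0 < e ->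
  Phi (- m / Num.sqrt (v + t))%:E <= pr [set w | m - e < W w] + Phi (- e / Num.sqrt v)%:E.
Proof.
move=> v0 e0; rewrite -glued_Phi//.
have [i1 <-] := expect_indic (mgt (m - e)).
rewrite -[X in _ <= _ + X](expect_cst P) -expectD//; last exact: integrableR_cst.
apply: le_expect => //; first by apply: integrableRD => //; exact: integrableR_cst.
move=> w; rewrite indicE; case: (boolP (w \in _)) => [_|].
  by rewrite (le_trans (Phi_le1 _))// lerDl Phi_ge0.
rewrite notin_setE/= => /negP; rewrite -leNgt add0r => mW'; apply: le_Phi.
by rewrite lee_fin ler_wpM2r ?invr_ge0//; lra.
Qed.

(** The smoothing variance runs through [n.+1%:R ^- 2], whose square root is the harmonic
    sequence. *)
Let cPhi c : Phi (- c / Num.sqrt (n.+1%:R ^- 2 + t))%:E @[n --> \oo] --> Phi (- c / Num.sqrt t)%:E.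
Proof.
apply: (@continuous_cvg _ _ _ _ _ _ (fun y : R => Phi y%:E)); first exact: continuous_PhiR.
apply: cvgM; first exact: cvg_cst.
apply: cvgV; first by rewrite gt_eqF// sqrtr_gt0.
apply: continuous_cvg; first exact: sqrt_continuous.
rewrite -[X in _ --> X]add0r; apply: cvgD; last exact: cvg_cst.
rewrite (_ : (fun n => _) = (fun n => n.+1%:R^-1 * n.+1%:R^-1 : R)).
  by rewrite -[X in _ --> X](mulr0 (0 : R)); apply: cvgM; exact: cvg_harmonic.
by apply/funext => n; rewrite expr2 invfM.
Qed.

Let sqrtV n : Num.sqrt ((n.+1%:R : R) ^- 2) = n.+1%:R^-1.
Proof. by rewrite -exprVn sqrtr_sqr ger0_norm// invr_ge0. Qed.

Let cvg_natM (e : R) : 0 < e -> e * n.+1%:R @[n --> \oo] --> +oo.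
Proof.
move=> e0; apply/cvgryPge => A; exists (Num.truncn (A / e)) => // n /= An.
rewrite mulrC -ler_pdivrMr// (le_trans (ltW (truncnS_gt _)))// ler_nat ltnS //.
Qed.

Let upper_lim m e : 0 < e -> pr [set w | m + e <= W w] <= Phi (- m / Num.sqrt t)%:E.
Proof.
move=> e0.
have c1 : pr [set w | m + e <= W w] * Phi (e / Num.sqrt (n.+1%:R ^- 2))%:E @[n --> \oo] -->
    pr [set w | m + e <= W w] * 1.
  apply: cvgM; first exact: cvg_cst.
  apply: (cvg_comp _ _ _ (@cvg_Phi_pinfty R)).
  rewrite (_ : (fun n => _) = (fun n => e * n.+1%:R)).
    exact: cvg_natM.
  by apply/funext => n; rewrite sqrtV invrK.
rewrite -[X in X <= _]mulr1; apply: ler_cvg_to c1 (@cPhi m) _.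
by apply: nearW => n; apply: upper => //; rewrite invr_gt0 exprn_gt0.
Qed.

Let lower_lim m e : 0 < e -> Phi (- m / Num.sqrt t)%:E <= pr [set w | m - e < W w].
Proof.
move=> e0.
have c1 : pr [set w | m - e < W w] + Phi (- e / Num.sqrt (n.+1%:R ^- 2))%:E @[n --> \oo] -->
    pr [set w | m - e < W w] + 0.
  apply: cvgD; first exact: cvg_cst.
  apply: (cvg_comp _ _ _ (@cvg_Phi_ninfty R)).
  rewrite (_ : (fun n => _) = (fun n => - (e * n.+1%:R))).
    by apply/cvgNrNy; exact: cvg_natM.
  by apply/funext => n; rewrite sqrtV invrK mulNr.
rewrite -[X in _ <= X]addr0; apply: ler_cvg_to (@cPhi m) c1 _.
by apply: nearW => n; apply: lower => //; rewrite invr_gt0 exprn_gt0.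
Qed.

Let cPhi_shift c (s : R) : Phi (- (c + s * n.+1%:R^-1) / Num.sqrt t)%:E @[n --> \oo] -->
  Phi (- c / Num.sqrt t)%:E.
Proof.
apply: (@continuous_cvg _ _ _ _ _ _ (fun y : R => Phi y%:E)); first exact: continuous_PhiR.
apply: cvgM; last exact: cvg_cst.
apply: cvgN; rewrite -[X in _ --> X]addr0; apply: cvgD; first exact: cvg_cst.
by rewrite -[X in _ --> X](mulr0 s); apply: cvgM; [exact: cvg_cst|exact: cvg_harmonic].
Qed.

(** Letting [e] tend to 0, the limit value bounds the strict event from below and the weak one from
    above. As the strict event is the smaller, all the inequalities are equalities; in particular
    [W] has no atom. *)
Lemma glued_law c : P [set w | c <= W w] = (Phi (- c / Num.sqrt t)%:E)%:E /\
  P [set w | c < W w] = (Phi (- c / Num.sqrt t)%:E)%:E.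
Proof.
have U : pr [set w | c <= W w] <= Phi (- c / Num.sqrt t)%:E.
  apply: ler_cvg_to (cvg_cst _) (@cPhi_shift c (- 1)) _; apply: nearW => n.
  have e0 : 0 < (n.+1%:R : R)^-1 by rewrite invr_gt0.
  have := @upper_lim (c + - 1 * n.+1%:R^-1) _ e0.
  by rewrite (_ : c + _ + _ = c)//; ring.
have L : Phi (- c / Num.sqrt t)%:E <= pr [set w | c < W w].
  apply: ler_cvg_to (@cPhi_shift c 1) (cvg_cst _) _; apply: nearW => n.
  have e0 : 0 < (n.+1%:R : R)^-1 by rewrite invr_gt0.
  have := @lower_lim (c + 1 * n.+1%:R^-1) _ e0.
  by rewrite (_ : c + _ - _ = c)//; ring.
have M : pr [set w | c < W w] <= pr [set w | c <= W w].
  rewrite fine_le ?fin_num_measure//; apply: le_measure; rewrite ?inE//.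
  by move=> w /= /ltW.
have E A : measurable A -> P A = (pr A)%:E by move=> mA; rewrite fineK ?fin_num_measure.
by rewrite !E//; split; congr EFin; apply/eqP; rewrite eq_le; apply/andP; split=> //;
  [exact: le_trans M|exact: le_trans M U].
Qed.

End Glued_law.

(** * Stopping times and glued processes *)

Section Grid_convergence.
Context {R : realType}.
Implicit Types (u : \bar R) (t r h : R) (f : R -> R).

(** The minimum of [u] and [r] as a real number, with the same case distinction as in
    [reflection]. *)
Definition stopmin u r : R := if (u <= r%:E)%E then fine u else r.

Lemma stopmin_ge u r : (r%:E <= u)%E -> stopmin u r = r.
Proof.
rewrite /stopmin; case: ifPn => // ur ru.
by have -> : u = r%:E by apply/eqP; rewrite eq_le ur.
Qed.

Lemma stopmin_le_r u r : (0 <= u)%E -> stopmin u r <= r.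
Proof.
move=> u0; rewrite /stopmin; case: ifPn => // ur; rewrite -lee_fin fineK//.
by rewrite ge0_fin_numE// (le_lt_trans ur)// ltry.
Qed.

Lemma stopmin_ge0 u r : (0 <= u)%E -> 0 <= r -> 0 <= stopmin u r.
Proof. by move=> u0 r0; rewrite /stopmin; case: ifPn => // _; exact: fine_ge0. Qed.

Lemma sum_threshold (p : nat -> bool) (x : nat -> R) N :
  (forall i j, (i <= j)%N -> p i -> p j) ->
  exists2 m, (m <= N)%N & [/\ \sum_(j < N) (p j)%:R * (x j.+1 - x j) = x N - x m,
    forall j, (j < m)%N -> ~~ p j & (m < N)%N -> p m].
Proof.
move=> pm; elim: N => [|N [m mN [IH np mp]]].
  by exists 0%N => //; rewrite big_ord0 subrr.
case: (boolP (p N)) => pN.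
  exists m; first exact: leqW.
  split=> //; first by rewrite big_ord_recr /= IH pN mul1r; ring.
  by rewrite ltnS leq_eqVlt => /predU1P[->|/mp].
have mE : m = N.
  by apply/eqP; rewrite eqn_leq mN leqNgt; apply: contra pN => mN'; apply: pm (mp mN'); exact: ltnW.
exists N.+1 => //; split; last by rewrite ltnn.
  by rewrite big_ord_recr /= IH mE (negbTE pN) !subrr mul0r addr0.
move=> j; rewrite ltnS leq_eqVlt => /predU1P[->//|jN]; apply: np; by rewrite mE.
Qed.

Definition grid_sum u t f (N : nat) : R :=
  \sum_(j < N.+1) ((u <= (j%:R * (t / N.+1%:R))%:E)%E)%:R *
     (f (j%:R * (t / N.+1%:R) + t / N.+1%:R) - f (j%:R * (t / N.+1%:R))).

(** The indicators switch on once, so the sum telescopes from a grid point that lies within one mesh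
    of [stopmin u t]; continuity of [f] does the rest. *)
Lemma grid_cvg u t f : (0 <= u)%E -> 0 < t -> continuous f ->
  grid_sum u t f N @[N --> \oo] --> f t - f (stopmin u t).
Proof.
rewrite /grid_sum => u0 t0 cf; pose h N : R := t / N.+1%:R.
have h0 N : 0 < h N by rewrite divr_gt0.
have Nh N : N.+1%:R * h N = t by rewrite mulrC divfK// pnatr_eq0.
have H N : {c : R | `|c - stopmin u t| <= h N & \sum_(j < N.+1) ((u <= (j%:R * h N)%:E)%E)%:R *
     (f (j%:R * h N + h N) - f (j%:R * h N)) = f t - f c}.
  apply: cid2.
  have [|m mN [Es np mp]] := @sum_threshold (fun j => (u <= (j%:R * h N)%:E)%E)
    (fun j => f (j%:R * h N)) N.+1.
    move=> i j ij /le_trans; apply; rewrite lee_fin ler_pM2r// ler_nat //.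
  exists (m%:R * h N); last first.
    rewrite Nh in Es; rewrite -Es; apply: eq_bigr => j _.
    by congr (_ * (f _ - _)); rewrite -natr1; ring.
  have mt : m%:R * h N <= t by rewrite -(Nh N) ler_pM2r// ler_nat.
  have c1 : stopmin u t <= m%:R * h N.
    case: (ltnP m N.+1) => mN1.
      have um := mp mN1; have ut : (u <= t%:E)%E by apply: le_trans um _; rewrite lee_fin.
      rewrite /stopmin ut -lee_fin fineK//.
      by rewrite ge0_fin_numE// (le_lt_trans um)// ltry.
    have -> : m = N.+1 by apply/eqP; rewrite eqn_leq mN.
    by rewrite Nh stopmin_le_r.
  rewrite ger0_norm ?subr_ge0// lerBlDr addrC -lerBlDr.
  case: m mN np {mp Es mt c1} => [|m] mN np.
    have hN := h0 N; have c0 : 0 <= stopmin u t by apply: stopmin_ge0 => //; exact: ltW.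
    by rewrite mul0r sub0r (@le_trans _ _ 0)// oppr_le0 ltW.
  have um := np m (ltnSn m); rewrite -ltNge in um.
  have -> : m.+1%:R * h N - h N = m%:R * h N by rewrite -natr1; ring.
  rewrite /stopmin; case: ifPn => ut.
    by rewrite -lee_fin fineK ?ge0_fin_numE ?(le_lt_trans ut) ?ltry// ltW.
  by rewrite -(Nh N) ler_pM2r// ler_nat ltnW.
rewrite (_ : (fun N => _) = (fun N => f t - f (s2val (H N)))); last first.
  by apply/funext => N; exact: (s2valP' (H N)).
apply: cvgB; first exact: cvg_cst.
apply: continuous_cvg; first exact: cf.
apply: (@cvg_dist_bound _ h) => [N|]; first exact: (s2valP (H N)).
rewrite -(mulr0 t); apply: cvgM; first exact: cvg_cst.
exact: cvg_harmonic.
Qed.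

End Grid_convergence.

Section Glued.
Context {d : measure_display} {T : measurableType d} {R : realType}.
Variable P : probability T R.
Variable F : R -> set (set T).
Hypothesis hF : is_filtration F.
Variables X Y : R -> T -> R.
Hypotheses (hX : bm_facts P F X) (hY : bm_facts P F Y).
Hypothesis XY : indep_incr_products P X Y.

Definition stopping (u : T -> \bar R) := (forall w, 0 <= u w)%E /\
  forall r, 0 <= r -> F r [set w | (u w <= r%:E)%E].

Lemma stopping_indic u r : stopping u -> 0 <= r ->
  Gmeas (F r) (fun w => ((u w <= r%:E)%E)%:R : R).
Proof.
move=> [_ su] r0.
rewrite (_ : (fun w => _) = (\1_[set w | (u w <= r%:E)%E] : T -> R)).
  exact: (Gmeas_indic (filtration_sigma hF r0) (su r r0)).
apply/funext => w; rewrite indicE; congr (_%:R); congr nat_of_bool.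
by apply/idP/idP; rewrite inE.
Qed.

(** The increment from the stopped time to [t] is a pointwise limit of grid sums of variables of
    [F t], so progressive measurability is not invoked. *)
Lemma stopped_Gmeas B u t : bm_facts P F B -> stopping u -> 0 <= t ->
  Gmeas (F t) (fun w => B (stopmin (u w) t) w).
Proof.
move=> hB su; rewrite le_eqVlt => /predU1P[<-|t0].
  rewrite (_ : (fun w => _) = B 0); first exact: (@bm_adapted _ _ _ _ _ _ hB 0 (lexx 0)).
  by apply/funext => w; rewrite stopmin_ge// su.1.
pose S (N : nat) w := \sum_(j < N.+1) ((u w <= (j%:R * (t / N.+1%:R))%:E)%E)%:R *
     incr B (j%:R * (t / N.+1%:R)) (j%:R * (t / N.+1%:R) + t / N.+1%:R) w.
have mS N : Gmeas (F t) (S N).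
  have h0 : 0 < t / N.+1%:R :> R by rewrite divr_gt0.
  have Nh : N.+1%:R * (t / N.+1%:R) = t :> R by rewrite mulrC divfK// pnatr_eq0.
  apply: measurable_sum => j.
  have j0 : 0 <= j%:R * (t / N.+1%:R) :> R by rewrite mulr_ge0// ltW.
  have j1 : j%:R * (t / N.+1%:R) + t / N.+1%:R <= t.
    by rewrite -{3}Nh -[X in _ + X]mul1r -mulrDl natr1 ler_pM2r// ler_nat.
  have j2 : j%:R * (t / N.+1%:R) <= j%:R * (t / N.+1%:R) + t / N.+1%:R by rewrite lerDl ltW.
  apply: measurable_funM.
    exact: (Fmeas_le hF j0 (le_trans j2 j1) (@stopping_indic u _ su j0)).
  exact: (incr_Fmeas hF hB j0 (le_trans j2 j1) (le_trans j0 j2) j1).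
have mlim : Gmeas (F t) (fun w => B t w - B (stopmin (u w) t) w).
  apply: (@measurable_fun_cvg _ (g_sigma_algebraType (F t)) R setT S _) => [N|w _]; first exact: (@mS N).
  exact: (@grid_cvg R (u w) t (B ^~ w) (su.1 w) t0 (@bm_continuous _ _ _ _ _ _ hB w)).
rewrite (_ : (fun w => _) = (fun w => B t w - (B t w - B (stopmin (u w) t) w))); last first.
  by apply/funext => w; ring.
apply: measurable_funB => //; exact: (@bm_adapted _ _ _ _ _ _ hB t (ltW t0)).
Qed.

Variable u : nat -> T -> \bar R.
Hypothesis su : forall k, stopping (u k).
Hypothesis u_le : forall k w, (u k w <= u k.+1 w)%E.

Implicit Types a b : nat -> R.

(** The step process with value [a 0] before [u 1], [a k] from [u k] until [u k.+1], and [a n] from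
    [u n] on. Written as a sum of jumps, it reduces measurability and convergence to single
    indicators. *)
Definition coef a n r w : R :=
  a 0%N + \sum_(k < n) (a k.+1 - a k) * ((u k.+1 w <= r%:E)%E)%:R.

Lemma coefS a n r w : coef a n.+1 r w =
  coef a n r w + (a n.+1 - a n) * ((u n.+1 w <= r%:E)%E)%:R.
Proof. by rewrite /coef big_ord_recr addrA. Qed.

Lemma u_le_trans k n w : (k <= n)%N -> (u k w <= u n w)%E.
Proof.
elim: n => [|n IH]; first by rewrite leqn0 => /eqP ->.
by rewrite leq_eqVlt => /predU1P[->//|/IH /le_trans]; apply.
Qed.

Lemma coef_phase n r w : exists2 k, (k <= n)%N & forall a, coef a n r w = a k.
Proof.
(* The induction also records that [u k.+1] is still to come when [k < n]; this forces [k = n] once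
   [u n.+1] has occurred. *)
suff [k kn [H _]] : exists2 k, (k <= n)%N &
    (forall a, coef a n r w = a k) /\ ((k < n)%N -> ~~ (u k.+1 w <= r%:E)%E) by exists k.
elim: n => [|n [k kn [H Hk]]].
  by exists 0%N => //; split=> // a; rewrite /coef big_ord0 addr0.
case: (boolP (u n.+1 w <= r%:E)%E) => un.
  exists n.+1 => //; split=> [a|]; last by rewrite ltnn.
  have kE : k = n.
    apply/eqP; rewrite eqn_leq kn leqNgt; apply/negP => /[dup] kn' /Hk/negP; apply.
    exact: le_trans (u_le_trans w kn') (le_trans (u_le n w) un).
  by rewrite coefS H un mulr1 kE; ring.
exists k; first exact: leqW.
split=> [a|]; first by rewrite coefS H (negbTE un) mulr0 addr0.
by rewrite ltnS leq_eqVlt => /predU1P[->//|/Hk].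
Qed.

Lemma coef_Gmeas a n r : 0 <= r -> Gmeas (F r) (coef a n r).
Proof.
move=> r0.
have mk k : Gmeas (F r) (fun w => (a k.+1 - a k) * ((u k.+1 w <= r%:E)%E)%:R : R).
  apply: measurable_funM; first exact: measurable_cst.
  exact: (@stopping_indic (u k.+1) r (@su k.+1) r0).
have ms : Gmeas (F r) (fun w => \sum_(k < n) (a k.+1 - a k) * ((u k.+1 w <= r%:E)%E)%:R : R).
  by apply: measurable_sum => k; exact: (@mk k).
by apply: measurable_funD; [exact: measurable_cst|exact: ms].
Qed.

(** The stochastic integral of [coef a n] against [B], evaluated path by path; [coef_cvg] identifies
    it as the limit of its Riemann sums. *)
Definition integ B a n t w : R :=
  a 0%N * B t w + \sum_(k < n) (a k.+1 - a k) * (B t w - B (stopmin (u k.+1 w) t) w).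

Lemma integS B a n t w : integ B a n.+1 t w =
  integ B a n t w + (a n.+1 - a n) * (B t w - B (stopmin (u n.+1 w) t) w).
Proof. by rewrite /integ big_ord_recr addrA. Qed.

Definition coef_sum B a n t w N : R := \sum_(j < N.+1) coef a n (j%:R * (t / N.+1%:R)) w *
  incr B (j%:R * (t / N.+1%:R)) (j%:R * (t / N.+1%:R) + t / N.+1%:R) w.

Lemma coef_cvg B a n t w : bm_facts P F B -> 0 < t ->
  coef_sum B a n t w N @[N --> \oo] --> integ B a n t w.
Proof.
move=> hB t0; have cB := @bm_continuous _ _ _ _ _ _ hB w.
elim: n => [|n IH].
  rewrite /integ big_ord0 addr0.
  (* The threshold [0] makes every indicator equal to 1, so the constant coefficient is a case of
     [grid_cvg]. *)
  have := @grid_cvg _ 0%E t _ (lexx _) t0 cB; rewrite /stopmin lee_fin (ltW t0) (bm_start hB) subr0.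
  move=> H.
  have H' : a 0%N * grid_sum 0%E t (B ^~ w) N @[N --> \oo] --> a 0%N * B t w.
    by apply: cvgM; [exact: cvg_cst|exact: H].
  apply: cvg_trans; last exact: H'.
  apply: near_eq_cvg; apply: nearW => N /=.
  rewrite /grid_sum /coef_sum mulr_sumr; apply: eq_bigr => j _.
  rewrite /coef big_ord0 addr0 lee_fin mulr_ge0//; last by rewrite divr_ge0// ltW.
  by rewrite mul1r.
rewrite integS.
have H : (a n.+1 - a n) * grid_sum (u n.+1 w) t (B ^~ w) N @[N --> \oo] -->
    (a n.+1 - a n) * (B t w - B (stopmin (u n.+1 w) t) w).
  apply: cvgM; first exact: cvg_cst.
  exact: (@grid_cvg _ _ _ _ ((su n.+1).1 w) t0 cB).
have H' : coef_sum B a n t w N + (a n.+1 - a n) * grid_sum (u n.+1 w) t (B ^~ w) N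
    @[N --> \oo] --> integ B a n t w + (a n.+1 - a n) * (B t w - B (stopmin (u n.+1 w) t) w).
  by apply: cvgD; [exact: IH|exact: H].
apply: cvg_trans; last exact: H'.
apply: near_eq_cvg; apply: nearW => N /=.
rewrite /grid_sum /coef_sum mulr_sumr -big_split/=; apply: eq_bigr => j _.
by rewrite coefS /incr; ring.
Qed.

Lemma glued_normal a b n t c : (forall k, a k ^+ 2 + b k ^+ 2 = 1) -> 0 < t ->
  Gmeas (F t) (fun w => integ X a n t w + integ Y b n t w) /\
  P [set w | c <= integ X a n t w + integ Y b n t w] = (Phi (- c / Num.sqrt t)%:E)%:E /\
  P [set w | c < integ X a n t w + integ Y b n t w] = (Phi (- c / Num.sqrt t)%:E)%:E.
Proof.
move=> ab1 t0.
pose A N j := coef a n (j%:R * (t / N.+1%:R)); pose B N j := coef b n (j%:R * (t / N.+1%:R)).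
have j0 N (j : nat) : 0 <= j%:R * (t / N.+1%:R) :> R by rewrite mulr_ge0// divr_ge0// ltW.
have mA N j : Gmeas (F (j%:R * (t / N.+1%:R))) (A N j) by apply: coef_Gmeas.
have mB N j : Gmeas (F (j%:R * (t / N.+1%:R))) (B N j) by apply: coef_Gmeas.
have AB1 N j w : A N j w ^+ 2 + B N j w ^+ 2 = 1.
  by rewrite /A /B; have [k _ E] := coef_phase n (j%:R * (t / N.+1%:R)) w; rewrite !E.
have lim w : walk X Y (t / N.+1%:R) (A N) (B N) N.+1 w @[N --> \oo] -->
    integ X a n t w + integ Y b n t w.
  have H : coef_sum X a n t w N + coef_sum Y b n t w N @[N --> \oo] -->
      integ X a n t w + integ Y b n t w.
    by apply: cvgD; [exact: (@coef_cvg X a n t w hX t0)|exact: (@coef_cvg Y b n t w hY t0)].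
  apply: cvg_trans; last exact: H.
  apply: near_eq_cvg; apply: nearW => N /=.
  by rewrite /walk /coef_sum -big_split.
split; first exact: (@glued_Gmeas _ _ _ _ _ hF _ _ hX hY _ t0 _ _ _ mA mB lim).
exact: (glued_law hF hX hY XY t0 mA mB AB1 lim c).
Qed.

End Glued.

(** * Reflected paths *)

Section Hitting.
Context {R : realType}.
Implicit Types (f : R -> R) (sg : \bar R) (a r : R).

Definition hits f sg a : set R := [set s | [/\ 0 <= s, (sg <= s%:E)%E & f s = a]].

Lemma hit_attained f sg a : continuous f ->
  (ereal_inf [set s%:E | s in hits f sg a] < +oo)%E ->
  exists2 c, ereal_inf [set s%:E | s in hits f sg a] = c%:E & hits f sg a c.
Proof.
move=> cf; set S := hits f sg a => infy.
have S0 : S !=set0.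
  apply/set0P/eqP => S0; move: infy; rewrite S0 image_set0 ereal_inf0 ltxx //.
have lbS : has_lbound S by exists 0 => s [].
exists (inf S); first exact: ereal_inf_EFin.
have c0 : 0 <= inf S by apply: lb_le_inf => // s [].
have csg : (sg <= (inf S)%:E)%E.
  rewrite -ereal_inf_EFin//; apply: le_ereal_inf_tmp => _ [s [_ sgs _] <-] //.
split=> //; apply: contrapT => fca.
have : \forall y \near inf S, f y != a.
  have /cvgrPdist_lt/(_ `|f (inf S) - a|) := @cf (inf S).
  rewrite normr_gt0 subr_eq0 => /(_ _)/wrap[]; first exact/eqP.
  by apply: filterS => y; apply: contraTN => /eqP ->; rewrite ltxx.
move=> /nbhs_ballP[e /= e0 He].
have [s Ss sl] := inf_adherent e0 (conj S0 lbS).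
have := He s; rewrite /ball/= ler0_norm ?subr_le0; last exact: ge_inf.
rewrite opprB => H.
have : f s != a by apply: H; lra.
by case: Ss => _ _ ->; rewrite eqxx.
Qed.

Lemma hit_lb f sg a r : hits f sg a r -> (ereal_inf [set s%:E | s in hits f sg a] <= r%:E)%E.
Proof. by move=> Sr; apply: ereal_inf_lbound; exists r. Qed.

Lemma hit_ge f sg a : (sg <= ereal_inf [set s%:E | s in hits f sg a])%E.
Proof. by apply: le_ereal_inf_tmp => _ [s [_ + _] <-]. Qed.

Lemma stopmin_continuous (u : \bar R) : (0 <= u)%E -> continuous (stopmin u).
Proof.
case: u => [c c0|_|//].
  rewrite (_ : stopmin c%:E = fun r => Num.min c r).
    by move=> r; apply: (@continuous_min _ R (cst c) id r); [exact: cvg_cst|exact: cvg_id].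
  by apply/funext => r; rewrite /stopmin lee_fin/=; case: leP.
have -> : stopmin (+oo%E : \bar R) = id.
  by apply/funext => r; rewrite stopmin_ge// leey.
by move=> r; exact: cvg_id.
Qed.

End Hitting.

Section Reflected_paths.
Context {T : Type} {R : realType}.
Variables (eta nu rho : R) (X Y : R -> T -> R).
Hypotheses (heta : 0 < eta) (hnu : nu < eta).
Hypotheses (cX : forall w, continuous (X ^~ w)) (cY : forall w, continuous (Y ^~ w)).
Hypotheses (X0 : forall w, X 0 w = 0) (Y0 : forall w, Y 0 w = 0).

Local Notation al := (alpha eta nu).
Local Notation tk := (tau eta nu rho X Y).
Local Notation Bt := (Btilde eta nu rho X Y).
Local Notation Y_ := (Yn eta nu rho X Y).

Definition gap k r w := X r w - Y_ k r w.
Definition slope k : R := 1 + (-1) ^+ k * rho.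
Definition cslope : R := Num.sqrt (1 - rho ^+ 2).

Lemma tauS k w : tk k.+1 w =
  ereal_inf [set s%:E | s in hits (fun s => gap k s w) (tk k w) (al k.+1)].
Proof. by rewrite /tau /gap /Yn /Btilde /=; case: (tau_Btilde _ _ _ _ _ k). Qed.

Lemma BtildeS k : Bt k.+1 = reflection (Bt k) (tk k.+1).
Proof. by rewrite /tau /Btilde /=; case: (tau_Btilde _ _ _ _ _ k). Qed.

Lemma tau_le k w : (tk k w <= tk k.+1 w)%E.
Proof. by rewrite tauS; exact: hit_ge. Qed.

Lemma tau_ge0 k w : (0 <= tk k w)%E.
Proof. by elim: k => [|k IH]; [exact: lexx|exact: le_trans IH (tau_le k w)]. Qed.

(** In this form the reflection has no case distinction, and continuity passes through it by
    composition. *)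
Lemma BtildeS_stopmin k r w : Bt k.+1 r w = 2 * Bt k (stopmin (tk k.+1 w) r) w - Bt k r w.
Proof.
rewrite BtildeS /reflection /stopmin; case: ifPn => _ /=; first by rewrite mulr1; ring.
by rewrite mulr0; ring.
Qed.

Lemma Btilde_continuous k w : continuous (Bt k ^~ w).
Proof.
elim: k => [|k IH]; first by move=> r; apply: cvgN; exact: cX.
rewrite (_ : _ ^~ w = (fun r => 2 * Bt k (stopmin (tk k.+1 w) r) w - Bt k r w)); last first.
  by apply/funext => r; exact: BtildeS_stopmin.
move=> r; apply: cvgB; last exact: IH.
apply: cvgM; first exact: cvg_cst.
apply: (@continuous_comp _ _ _ (stopmin (tk k.+1 w)) (Bt k ^~ w)); last exact: IH.
exact: (stopmin_continuous (tau_ge0 _ _)).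
Qed.

Lemma gap_continuous k w : continuous (gap k ^~ w).
Proof.
move=> r; apply: cvgB; first exact: cX.
apply: cvgD; (apply: cvgM; first exact: cvg_cst); [exact: Btilde_continuous|exact: cY].
Qed.

(** From [tk k] on all [k] reflections are in force, each one changing the sign of later increments;
    the initial sign comes from [- X]. *)
Lemma Btilde_incr k s r w : (tk k w <= s%:E)%E -> s <= r ->
  Bt k r w - Bt k s w = (-1) ^+ k.+1 * (X r w - X s w).
Proof.
elim: k s r => [|k IH] s r ks sr; first by rewrite expr1 /Btilde/=; ring.
have kr : (tk k.+1 w <= r%:E)%E by apply: le_trans ks _; rewrite lee_fin.
rewrite !BtildeS_stopmin /stopmin ks kr exprS.
have := IH s r (le_trans (tau_le k w) ks) sr; lra.
Qed.

Lemma gap_incr k s r w : (tk k w <= s%:E)%E -> s <= r ->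
  gap k r w - gap k s w = slope k * (X r w - X s w) - cslope * (Y r w - Y s w).
Proof.
move=> ks sr; have := Btilde_incr ks sr; rewrite /gap /slope /Yn /correlated /cslope exprS => E.
have -> : Bt k r w = Bt k s w + -1 * (-1) ^+ k * (X r w - X s w) by rewrite -E; ring.
ring.
Qed.

Lemma gap_before k r w : (r%:E <= tk k.+1 w)%E -> gap k.+1 r w = gap k r w.
Proof.
move=> kr; rewrite /gap /Yn /correlated BtildeS_stopmin stopmin_ge//.
by rewrite (_ : 2 * _ - _ = Bt k r w)//; ring.
Qed.

Lemma gap_at k c w : tk k w = c%:E -> gap k c w = al k.
Proof.
case: k => [[<-]|k kc].
  by rewrite /gap /Yn /correlated /Btilde/= X0 Y0 oppr0 !mulr0 addr0 subr0.
rewrite gap_before ?kc//; have := kc; rewrite tauS => E.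
have [|c' E' [_ _ <-]] := @hit_attained _ (fun s => gap k s w) (tk k w) (al k.+1)
  (@gap_continuous k w); first by rewrite E ltry.
by move: E'; rewrite E => -[->].
Qed.

Lemma gap_after k r w : (tk k w <= r%:E)%E ->
  gap k r w = al k + (slope k * (X r w - X (stopmin (tk k w) r) w)
                      - cslope * (Y r w - Y (stopmin (tk k w) r) w)).
Proof.
move=> kr; have kf : tk k w = (fine (tk k w))%:E.
  by rewrite fineK// ge0_fin_numE ?tau_ge0// (le_lt_trans kr)// ltry.
rewrite /stopmin kr -(gap_incr (s := fine (tk k w))) ?(gap_at kf); first by ring.
  by rewrite -kf.
by rewrite -lee_fin -kf.
Qed.

Lemma gap_neq k r w : 0 <= r -> (tk k w <= r%:E)%E -> (r%:E < tk k.+1 w)%E ->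
  gap k r w != al k.+1.
Proof.
move=> r0 kr; rewrite ltNge; apply: contraNneq => E.
by rewrite tauS; apply: hit_lb; split.
Qed.

Lemma al_neq k : al k != al k.+1.
Proof.
case: k => [|k]; rewrite /alpha/=; first by rewrite lt_eqF.
by case: (odd k) => /=; [rewrite lt_eqF|rewrite gt_eqF].
Qed.

End Reflected_paths.

(** * Reflection times are stopping times *)

Section Reflected_stopping.
Context {d : measure_display} {T : measurableType d} {R : realType}.
Variable P : probability T R.
Variable F : R -> set (set T).
Hypothesis hF : is_filtration F.
Variables (eta nu rho : R) (X Y : R -> T -> R).
Hypotheses (heta : 0 < eta) (hnu : nu < eta).
Hypotheses (hX : bm_facts P F X) (hY : bm_facts P F Y).

Local Notation al := (alpha eta nu).
Local Notation tk := (tau eta nu rho X Y).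
Local Notation gp := (gap eta nu rho X Y).

Let cX w : continuous (X ^~ w) := @bm_continuous _ _ _ _ _ _ hX w.
Let cY w : continuous (Y ^~ w) := @bm_continuous _ _ _ _ _ _ hY w.
Let X0 := bm_start hX.
Let Y0 := bm_start hY.

(** It agrees with the gap from [tk k] on and involves only [X], [Y] and their values stopped at
    [tk k], so its measurability needs nothing about [Btilde]. *)
Definition gap_stopped k r w : R := al k + (slope rho k * (X r w - X (stopmin (tk k w) r) w)
                      - cslope rho * (Y r w - Y (stopmin (tk k w) r) w)).

Lemma gap_stoppedE k r w : (tk k w <= r%:E)%E -> gp k r w = gap_stopped k r w.
Proof. by move=> kr; rewrite (gap_after cX cY X0 Y0 kr). Qed.

Lemma gap_stopped_Gmeas k r : stopping F (tk k) -> 0 <= r -> Gmeas (F r) (gap_stopped k r).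
Proof.
move=> sk r0; apply: measurable_funD; first exact: measurable_cst.
apply: measurable_funB; apply: measurable_funM; try exact: measurable_cst.
  apply: measurable_funB; first exact: (@bm_adapted _ _ _ _ _ _ hX r r0).
  exact: (stopped_Gmeas hF hX sk r0).
apply: measurable_funB; first exact: (@bm_adapted _ _ _ _ _ _ hY r r0).
exact: (stopped_Gmeas hF hY sk r0).
Qed.

Let near_hit k m (q : rat) : set T := [set w | [/\ (tk k w <= (ratr q : R)%:E)%E &
   `|gap_stopped k (ratr q) w - al k.+1| < m.+1%:R^-1]].

(** Hitting before [r] becomes a countable condition: arbitrarily close approaches at rational
    times. Consecutive levels differ, so a hit comes strictly after [tk k], which leaves room for
    such times; conversely, compactness turns approaches into a hit. *)
Lemma tau_hitP k r w : 0 <= r -> (tk k.+1 w <= r%:E)%E <->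
  forall m, exists2 q : rat, 0 <= (ratr q : R) <= r & near_hit k m q w.
Proof.
move=> r0; split=> [kr m|H].
  have := kr; rewrite tauS => kr'.
  have [|c Ec [c0 kc gc]] := @hit_attained _ (fun s => gp k s w) (tk k w) (al k.+1)
    (@gap_continuous _ _ _ _ _ _ _ cX cY k w).
    exact: le_lt_trans kr' (ltry _).
  have cr : c <= r by rewrite Ec lee_fin in kr'.
  have kf : tk k w = (fine (tk k w))%:E.
    by rewrite fineK// ge0_fin_numE ?tau_ge0// (le_lt_trans kc)// ltry.
  have {}kc : fine (tk k w) < c.
    rewrite lt_neqAle -lee_fin -kf kc andbT; apply/eqP => kE.
    by have := gap_at cX cY X0 Y0 kf; rewrite kE gc => /eqP; rewrite eq_sym (negbTE (al_neq heta hnu k)).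
  have m0 : 0 < m.+1%:R^-1 :> R by rewrite invr_gt0.
  have /cvgrPdist_lt/(_ _ m0) := @gap_continuous _ _ eta nu rho X Y cX cY k w c.
  move=> /nbhs_ballP[e /= e0 He].
  have lt_c : Num.max (fine (tk k w)) (c - e) < c by rewrite gt_max kc/=; lra.
  have [q] := rat_in_itvoo lt_c; rewrite in_itv/= gt_max => /andP[/andP[kq cq] qc].
  have q0 : 0 <= ratr q :> R by rewrite (le_trans _ (ltW kq))// fine_ge0// tau_ge0.
  exists q; first by rewrite q0 (le_trans (ltW qc)).
  have kq' : (tk k w <= (ratr q : R)%:E)%E by rewrite kf lee_fin ltW.
  split=> //; rewrite -gap_stoppedE// -gc distrC; apply: He.
  by rewrite /ball/= ger0_norm; lra.
have [q0 /andP[_ q0r] [kq0 _]] := H 0%N.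
have kr : (tk k w <= r%:E)%E by apply: le_trans kq0 _; rewrite lee_fin.
have kf : tk k w = (fine (tk k w))%:E.
  by rewrite fineK// ge0_fin_numE ?tau_ge0// (le_lt_trans kr)// ltry.
have kr' : fine (tk k w) <= r by rewrite -lee_fin -kf.
have k0 : 0 <= fine (tk k w) by rewrite fine_ge0// tau_ge0.
pose g s := `|gp k s w - al k.+1|.
have cg : continuous g.
  move=> s; apply: cvg_norm; apply: cvgB; last exact: cvg_cst.
  exact: (@gap_continuous _ _ _ _ _ _ _ cX cY k w).
(* The distance to the level attains its minimum between [tk k] and [r]; the approaches force that
   minimum to be 0. *)
have [|c /[!in_itv]/= /andP[kc cr] cmin] := @EVT_min R g _ _ kr'.
  by apply: continuous_subspaceT => s; exact: cg.
have g0 : g c = 0.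
  apply/eqP; rewrite eq_le normr_ge0 andbT; apply/ler_addgt0Pr => e e0; rewrite add0r.
  pose m := Num.truncn e^-1.
  have me : m.+1%:R^-1 < e.
    by rewrite -[ltRHS]invrK ltf_pV2 ?posrE ?invr_gt0// truncnS_gt.
  have [q /andP[q0' qr] [kq gq]] := H m.
  apply: le_trans (ltW me); apply: le_trans (ltW gq); rewrite -gap_stoppedE//.
  by apply: cmin; rewrite in_itv/= qr andbT -lee_fin -kf.
have cE : gp k c w = al k.+1 by apply/eqP; rewrite -subr_eq0 -normr_eq0; exact/eqP.
apply: (@le_trans _ _ c%:E); last by rewrite lee_fin.
rewrite tauS; apply: hit_lb; split=> //; first exact: le_trans kc.
by rewrite kf lee_fin.
Qed.

Lemma tau_stopping k : stopping F (tk k).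
Proof.
split; first by move=> w; exact: tau_ge0.
elim: k => [|k IH] r r0.
  have [_ FC FU] := filtration_sigma hF r0; have [F0 _ _] := filtration_sigma hF r0.
  rewrite (_ : [set w | _] = setT `\` set0); first exact: FC.
  by rewrite setD0; apply/seteqP; split => w //= _; rewrite /tau/= lee_fin.
have sk : stopping F (tk k) by split=> //; exact: tau_ge0.
have E := sigma_algebra_id (filtration_sigma hF r0).
suff : @measurable _ (g_sigma_algebraType (F r)) [set w | (tk k.+1 w <= r%:E)%E].
  by rewrite /measurable/= E.
rewrite (_ : [set w | _] = \bigcap_m \bigcup_(q : rat)
    [set w | 0 <= (ratr q : R) <= r /\ near_hit k m q w]); last first.
  apply/seteqP; split => w /=.
    by move=> /(tau_hitP k w r0) H m _; have [q qr Hq] := H m; exists q.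
  move=> H; apply/(tau_hitP k w r0) => m.
  by have [q _ [qr Hq]] := H m Logic.I; exists q.
apply: bigcapT_measurable => m; apply: bigcupT_measurable_rat => q.
case: (boolP (0 <= (ratr q : R) <= r)) => qr; last first.
  by rewrite (_ : [set w | _] = set0)//; apply/seteqP; split => w // [].
have /andP[q0 qr'] := qr.
rewrite (_ : [set w | _] = [set w | (tk k w <= (ratr q : R)%:E)%E] `&`
   (gap_stopped k (ratr q)) @^-1` (ball (al k.+1) (m.+1%:R^-1))); last first.
  apply/seteqP; split => w /=; first by move=> [_ []] ? ?; split=> //; rewrite /ball/= distrC.
  by move=> [? ?]; split=> //; split=> //; rewrite distrC.
apply: measurableI.
  rewrite /measurable/= E; apply: (filtration_mono hF q0 qr'); exact: sk.2.
have mg := Fmeas_le hF q0 qr' (gap_stopped_Gmeas sk q0).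
have := mg measurableT _ (measurable_ball (al k.+1) (m.+1%:R^-1)).
by rewrite setTI.
Qed.

End Reflected_stopping.

(** * Law of the reflected gap *)

Section Assembly.
Context {d : measure_display} {T : measurableType d} {R : realType}.
Variable P : probability T R.
Variable F : R -> set (set T).
Hypothesis hF : is_filtration F.
Variables (eta nu rho : R) (X Y : R -> T -> R).
Hypotheses (heta : 0 < eta) (hnu : nu < eta) (hrho : 0 <= rho <= 1).
Hypotheses (hX : bm_facts P F X) (hY : bm_facts P F Y).
Hypothesis XY : indep_incr_products P X Y.
Variables (t : R) (t0 : 0 < t).

Local Notation al := (alpha eta nu).
Local Notation tk := (tau eta nu rho X Y).
Local Notation gp := (gap eta nu rho X Y).
Local Notation sl := (slope rho).
Local Notation cs := (cslope rho).

Let cX w : continuous (X ^~ w) := @bm_continuous _ _ _ _ _ _ hX w.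
Let cY w : continuous (Y ^~ w) := @bm_continuous _ _ _ _ _ _ hY w.
Let X0 := bm_start hX.
Let Y0 := bm_start hY.

Let stop k : stopping F (tk k) := tau_stopping hF rho heta hnu hX hY k.
Let tk_le k w : (tk k w <= tk k.+1 w)%E := tau_le eta nu rho X Y k w.
Let tk_ge0 k w : (0 <= tk k w)%E := tau_ge0 eta nu rho X Y k w.
Let tk0 w : tk 0%N w = 0%E. Proof. by []. Qed.

Definition gap_sd k := Num.sqrt (2 * sl k).
Local Notation eps k := ((-1) ^+ k : R).

Lemma slope_ge0 k : 0 <= sl k.
Proof.
have /andP[r0 r1] := hrho; rewrite /slope -signr_odd; case: (odd k); rewrite ?expr0 ?expr1; lra.
Qed.

(** The left side is the variance of the gap per unit time in phase [k]; this is where the factor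
    [2 * (1 + (-1) ^+ k * rho)] of the formulas originates. *)
Lemma slope_sq k : sl k ^+ 2 + cs ^+ 2 = 2 * sl k.
Proof.
have /andP[r0 r1] := hrho.
rewrite /slope /cslope sqr_sqrtr; last by rewrite subr_ge0 exprn_ile1.
by rewrite sqrrD exprMn sqrr_sign; ring.
Qed.

Lemma gap_sd_gt0 k : 0 < sl k -> 0 < gap_sd k.
Proof. by move=> s0; rewrite sqrtr_gt0; lra. Qed.

Lemma gap_sd_sq k : gap_sd k ^+ 2 = 2 * sl k.
Proof. by rewrite sqr_sqrtr// mulr_ge0 ?slope_ge0. Qed.

Lemma gap_sd_unit (e : R) k : e ^+ 2 = 1 -> 0 < sl k ->
  (e * sl k / gap_sd k) ^+ 2 + (- (e * cs / gap_sd k)) ^+ 2 = 1.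
Proof.
move=> e1 s0; have s := gap_sd_gt0 s0.
rewrite sqrrN !exprMn e1 !mul1r -mulrDl slope_sq -gap_sd_sq exprVn mulfV//.
by rewrite expf_neq0// lt0r_neq0.
Qed.

(** The targets alternate, [eta] above and then [nu] below, so [(-1) ^+ k] is the direction of
    travel in phase [k]. *)
Lemma al_step k : 0 < eps k * (al k.+1 - al k).
Proof.
case: k => [|k]; first by rewrite expr0 mul1r /alpha/= subr0.
rewrite /alpha/= exprS -signr_odd.
by case: (odd k) => /=; rewrite ?expr1 ?expr0 mulN1r ?opprK ?mul1r ?mulN1r ?opprB subr_gt0.
Qed.

(** The level [u_ n] in the form in which it arises: the distance travelled in each phase over the
    standard deviation of that phase. The two agree as long as no phase involved is degenerate. *)
Definition hit_level n : R := \sum_(k < n) eps k * (al k.+1 - al k) / gap_sd k.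

Lemma hit_levelS n : hit_level n.+1 = hit_level n + eps n * (al n.+1 - al n) / gap_sd n.
Proof. by rewrite /hit_level big_ord_recr. Qed.

Lemma hit_level_le n : hit_level n <= hit_level n.+1.
Proof. by rewrite hit_levelS lerDl divr_ge0 ?sqrtr_ge0 ?ltW ?al_step. Qed.

(* Between [tk k] and [tk k.+1], [gp k] moves by [sl k * dX - cs * dY], that is
   [gap_sd k] times a unit combination of [dX] and [dY]. With [eps k] times that
   combination as coefficients, the glued process increases by
   [eps k * (al k.+1 - al k) / gap_sd k] over each such phase, and thus first
   reaches [hit_level n] at [tk n]. *)
Definition canonical_upto n (a b : nat -> R) := forall k, (k < n)%N ->
  [/\ 0 < sl k, a k = eps k * sl k / gap_sd k & b k = - (eps k * cs / gap_sd k)].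

Definition glued a b n w := integ tk X a n t w + integ tk Y b n t w.

Lemma gluedS a b n w : glued a b n.+1 w = glued a b n w +
  ((a n.+1 - a n) * (X t w - X (stopmin (tk n.+1 w) t) w) +
   (b n.+1 - b n) * (Y t w - Y (stopmin (tk n.+1 w) t) w)).
Proof. by rewrite /glued !integS; ring. Qed.

Lemma gap_at_next k w : (tk k.+1 w <= t%:E)%E ->
  gp k (stopmin (tk k.+1 w) t) w = al k.+1.
Proof.
move=> kt; have kf : tk k.+1 w = (fine (tk k.+1 w))%:E.
  by rewrite fineK// ge0_fin_numE ?tk_ge0// (le_lt_trans kt)// ltry.
rewrite /stopmin kt -gap_before; first exact: (gap_at cX cY X0 Y0 kf).
by rewrite -kf.
Qed.

Lemma tk_stopmin k w : (tk k.+1 w <= t%:E)%E -> (tk k w <= (stopmin (tk k.+1 w) t)%:E)%E.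
Proof.
move=> kt; rewrite /stopmin kt fineK//.
by rewrite ge0_fin_numE ?tk_ge0// (le_lt_trans kt)// ltry.
Qed.

Lemma stopmin_stopmin k w : (tk k.+1 w <= t%:E)%E ->
  stopmin (tk k w) (stopmin (tk k.+1 w) t) = stopmin (tk k w) t.
Proof.
move=> kt; have := tk_stopmin kt; move: (stopmin (tk k.+1 w) t) => s ks.
by rewrite /stopmin ks (le_trans (tk_le k w) kt).
Qed.

(** Every completed phase contributes exactly its normalised distance, since [gp k] goes from [al k]
    to [al k.+1] during it; only the running phase keeps its random increment. *)
Lemma glued_hit a b n w : canonical_upto n a b -> (tk n w <= t%:E)%E ->
  glued a b n w = hit_level n + (a n * (X t w - X (stopmin (tk n w) t) w) +
                      b n * (Y t w - Y (stopmin (tk n w) t) w)).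
Proof.
elim: n => [|n IH] can nt.
  rewrite /glued /integ /hit_level !big_ord0 !addr0 add0r tk0 /stopmin lee_fin (ltW t0)/= X0 Y0 !subr0 //.
have nt' := le_trans (tk_le n w) nt.
have [sn an bn] := can n (ltnSn n); have s0 := gap_sd_gt0 sn.
rewrite gluedS IH//; last by move=> k kn; apply: can; exact: ltnW.
have := gap_after cX cY X0 Y0 (tk_stopmin nt).
rewrite gap_at_next// stopmin_stopmin// => E.
have -> : hit_level n.+1 = hit_level n + eps n / gap_sd n * (al n.+1 - al n) by rewrite hit_levelS; ring.
have {}E : al n.+1 - al n = sl n * (X (stopmin (tk n.+1 w) t) w - X (stopmin (tk n w) t) w) -
    cs * (Y (stopmin (tk n.+1 w) t) w - Y (stopmin (tk n w) t) w) by rewrite E; ring.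
by rewrite E an bn; ring.
Qed.

(** The gap starts at [al k], on the near side of its target, and by the intermediate value theorem
    it cannot be at or beyond the target without a hit. *)
Lemma gap_below k w : (tk k w <= t%:E)%E -> (t%:E < tk k.+1 w)%E ->
  eps k * (gp k t w - al k.+1) < 0.
Proof.
move=> kt tk1; rewrite ltNge; apply/negP => pos.
have kf : tk k w = (fine (tk k w))%:E.
  by rewrite fineK// ge0_fin_numE ?tk_ge0// (le_lt_trans kt)// ltry.
have kr : fine (tk k w) <= t by rewrite -lee_fin -kf.
have k0 : 0 <= fine (tk k w) by rewrite fine_ge0.
have neg : eps k * (gp k (fine (tk k w)) w - al k.+1) < 0.
  by rewrite (gap_at cX cY X0 Y0 kf); have := al_step k; lra.
pose g s := eps k * (gp k s w - al k.+1).
have cg : {within `[fine (tk k w), t], continuous g}.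
  apply: continuous_subspaceT => s; apply: cvgM; first exact: cvg_cst.
  apply: cvgB; last exact: cvg_cst.
  exact: (@gap_continuous _ _ _ _ _ _ _ cX cY k w).
have [|c /[!in_itv]/= /andP[kc ct] gc] := @IVT R g _ _ 0 kr cg.
  by rewrite ge_min le_max (ltW neg) pos orbT.
have cE : gp k c w = al k.+1.
  by apply/eqP; rewrite -subr_eq0; move/eqP: gc; rewrite /g mulf_eq0 signr_eq0.
have c0 := le_trans k0 kc.
have kc' : (tk k w <= c%:E)%E by rewrite kf lee_fin.
have tc : (c%:E < tk k.+1 w)%E by apply: le_lt_trans tk1; rewrite lee_fin.
by have := gap_neq c0 kc' tc; rewrite cE eqxx.
Qed.

(** In the running phase [gap_below] applies; if [t] lies in an earlier phase, the bound by that
    phase's smaller level suffices. *)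
Lemma glued_before a b n w : canonical_upto n.+1 a b -> (t%:E < tk n.+1 w)%E ->
  glued a b n w < hit_level n.+1.
Proof.
have hit n' : canonical_upto n'.+1 a b -> (tk n' w <= t%:E)%E -> (t%:E < tk n'.+1 w)%E ->
    glued a b n' w < hit_level n'.+1.
  move=> can nt tn; have [sn an bn] := can n' (ltnSn n'); have s0 := gap_sd_gt0 sn.
  rewrite glued_hit//; last by move=> k kn; apply: can; exact: leqW.
  rewrite hit_levelS ltrD2l ltr_pdivlMr// an bn.
  have := gap_below nt tn; rewrite (gap_after cX cY X0 Y0 nt).
  have -> : (eps n' * sl n' / gap_sd n' * (X t w - X (stopmin (tk n' w) t) w) +
    - (eps n' * cs / gap_sd n') * (Y t w - Y (stopmin (tk n' w) t) w)) * gap_sd n' =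
    eps n' * (sl n' * (X t w - X (stopmin (tk n' w) t) w) -
      cs * (Y t w - Y (stopmin (tk n' w) t) w)) by field; exact: lt0r_neq0.
  move=> H; rewrite -subr_lt0; apply: le_lt_trans H.
  by rewrite le_eqVlt; apply/orP; left; apply/eqP; ring.
elim: n => [|n IH] can tn.
  by apply: hit => //; rewrite tk0 lee_fin ltW.
have [nt|nt] := leP (tk n.+1 w) t%:E; first exact: hit.
rewrite gluedS !stopmin_ge ?ltW// !subrr !mulr0 !addr0.
apply: lt_le_trans (hit_level_le _); apply: IH => // k kn; apply: can; exact: ltnW.
Qed.

Definition override (v : R) (a : nat -> R) n k := if k == n then v else a k.

(** A degenerate phase ([rho = 1], [k] odd) receives the unit vector [(1, 0)], so that the
    coefficients have norm 1 in all cases. *)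
Definition phase_coefX k : R := if 0 < sl k then eps k * sl k / gap_sd k else 1.
Definition phase_coefY k : R := if 0 < sl k then - (eps k * cs / gap_sd k) else 0.

Lemma phase_coef_unit k : phase_coefX k ^+ 2 + phase_coefY k ^+ 2 = 1.
Proof.
rewrite /phase_coefX /phase_coefY; case: ifPn => s0; last by rewrite expr1n expr0n addr0.
by apply: gap_sd_unit => //; rewrite sqrr_sign.
Qed.

(* The coefficients from [tk n] on are [e] times those of [gp m], so that, after
   [tk n], [e = 1] follows [gp m] and [e = - 1] its mirror image. *)
Definition glued_end (e : R) m n :=
  glued (override (e * sl m / gap_sd m) phase_coefX n)
    (override (- (e * cs / gap_sd m)) phase_coefY n) n.

(* This fails only if [rho = 1] and [1 < n]. *)
Definition regular n := forall k, (k < n)%N -> 0 < sl k.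

Lemma glued_end_canonical e m n : regular n ->
  canonical_upto n (override (e * sl m / gap_sd m) phase_coefX n) (override (- (e * cs / gap_sd m)) phase_coefY n).
Proof. by move=> reg k kn; rewrite /override (ltn_eqF kn) /phase_coefX /phase_coefY (reg _ kn). Qed.

Lemma glued_end_normal e m n c : e ^+ 2 = 1 -> 0 < sl m ->
  P [set w | c <= glued_end e m n w] = (Phi (- c / Num.sqrt t)%:E)%:E /\
  P [set w | c < glued_end e m n w] = (Phi (- c / Num.sqrt t)%:E)%:E.
Proof.
move=> e1 sm.
have U k : override (e * sl m / gap_sd m) phase_coefX n k ^+ 2 +
    override (- (e * cs / gap_sd m)) phase_coefY n k ^+ 2 = 1.
  by rewrite /override; case: eqP => _; [exact: gap_sd_unit|exact: phase_coef_unit].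
exact: (glued_normal hF hX hY XY stop tk_le n c U t0).2.
Qed.

(* Compare the law of [X t] with that of [- X t]. *)
Lemma Phi_sym (z : R) : Phi (- z)%:E = 1 - Phi z%:E.
Proof.
pose a := fun k : nat => 1 : R; pose b := fun k : nat => 0 : R.
have U k : a k ^+ 2 + b k ^+ 2 = 1 by rewrite expr1n expr0n addr0.
have U' k : (- a k) ^+ 2 + b k ^+ 2 = 1 by rewrite sqrrN.
have [m1 [e1 _]] := glued_normal hF hX hY XY stop tk_le 0 (z * Num.sqrt t) U t0.
have [m2 [_ e2]] := glued_normal hF hX hY XY stop tk_le 0 (- (z * Num.sqrt t)) U' t0.
have s0 : Num.sqrt t != 0 by rewrite gt_eqF// sqrtr_gt0.
move: e1 e2; rewrite opprK -mulNr !mulfK// => e1 e2.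
have mX : measurable [set w | z * Num.sqrt t <= integ tk X a 0 t w + integ tk Y b 0 t w].
  have mW := Fmeas_measurable hF (ltW t0) m1.
  rewrite (_ : [set w | _] = (fun w => integ tk X a 0 t w + integ tk Y b 0 t w) @^-1`
    [set` `[z * Num.sqrt t, +oo[]).
    by have := mW measurableT _ (measurable_itv `[z * Num.sqrt t, +oo[); rewrite setTI.
  by apply/seteqP; split => w /=; rewrite in_itv/= andbT.
have := probability_setC P mX; rewrite e1.
rewrite (_ : ~` _ = [set w | - (z * Num.sqrt t) < integ tk X (fun k => - a k) 0 t w + integ tk Y b 0 t w]).
  by rewrite -mulNr e2 -EFinB => -[->]; ring.
apply/seteqP; split => w /=; rewrite /integ !big_ord0 /a /b !mul0r !addr0 mul1r mulN1r ltrN2.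
  by move/negP; rewrite -ltNge.
by rewrite ltNge => /negP.
Qed.

Let S n := [set w | (tk n w <= t%:E)%E].

Let mS n : measurable (S n).
Proof. by apply: (filtration_sub hF (ltW t0)); exact: (stop n).2 (ltW t0). Qed.

Lemma gap_Gmeas k : Gmeas (F t) (gp k t).
Proof.
have mg j : Gmeas (F t) (gap_stopped eta nu rho X Y j t).
  by apply: (gap_stopped_Gmeas hF hX hY) (ltW t0) => //; exact: stop.
elim: k => [|k IH].
  rewrite (_ : gp 0%N t = gap_stopped eta nu rho X Y 0 t); first exact: (@mg 0%N).
  by apply/funext => w; apply: (gap_stoppedE hX hY); rewrite tk0 lee_fin ltW.
have mi := stopping_indic hF (stop k.+1) (ltW t0).
rewrite (_ : gp k.+1 t = (fun w => ((tk k.+1 w <= t%:E)%E)%:R * gap_stopped eta nu rho X Y k.+1 t w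
   + (1 - ((tk k.+1 w <= t%:E)%E)%:R) * gp k t w)).
  apply: measurable_funD; first by apply: measurable_funM; [exact: mi|exact: (@mg k.+1)].
  apply: measurable_funM; last exact: IH.
  by apply: measurable_funB; [exact: measurable_cst|exact: mi].
apply/funext => w; case: (leP (tk k.+1 w) t%:E) => kt.
  by rewrite (gap_stoppedE hX hY kt) /=; ring.
by rewrite gap_before ?ltW//=; ring.
Qed.

Lemma gap_measurable_ge k x : measurable [set w | x <= gp k t w].
Proof.
have mg := Fmeas_measurable hF (ltW t0) (@gap_Gmeas k).
rewrite (_ : [set w | _] = gp k t @^-1` [set` `[x, +oo[]).
  by have := mg measurableT _ (measurable_itv `[x, +oo[); rewrite setTI.
by apply/seteqP; split => w /=; rewrite in_itv/= andbT.
Qed.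

Lemma gap_on_hit n m w : m = n \/ m = n.+1 -> (tk n.+1 w <= t%:E)%E ->
  gp m t w = al n.+1 + (sl m * (X t w - X (stopmin (tk n.+1 w) t) w)
                        - cs * (Y t w - Y (stopmin (tk n.+1 w) t) w)).
Proof.
move=> [->|->] nt; last exact: (gap_after cX cY X0 Y0 nt).
rewrite -(gap_at_next nt) -(gap_incr (k := n) (eta := eta) (nu := nu)) ?tk_stopmin//; first by ring.
exact: stopmin_le_r.
Qed.

Lemma glued_end_on_hit e n m w : m = n \/ m = n.+1 -> regular n.+1 -> 0 < sl m ->
  (tk n.+1 w <= t%:E)%E -> glued_end e m n.+1 w = hit_level n.+1 + e * (gp m t w - al n.+1) / gap_sd m.
Proof.
move=> mn reg sm nt; rewrite /glued_end glued_hit//; last exact: glued_end_canonical.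
by rewrite (gap_on_hit mn nt) /override eqxx; ring.
Qed.

Lemma glued_end_before e n m w : regular n.+1 -> ~~ (tk n.+1 w <= t%:E)%E -> glued_end e m n.+1 w < hit_level n.+1.
Proof.
rewrite -ltNge => reg nt; rewrite /glued_end gluedS !stopmin_ge ?ltW// !subrr !mulr0 !addr0.
by apply: glued_before => //; exact: glued_end_canonical.
Qed.

(** A threshold at or above [hit_level n.+1] cannot be reached before [tk n.+1], so the condition
    [S n.+1] is already contained in the comparison of the glued process with it. *)
Lemma prob_above n m x : m = n \/ m = n.+1 -> regular n.+1 -> 0 < sl m -> al n.+1 <= x ->
  P ([set w | x <= gp m t w] `&` S n.+1) =
  (1 - Phi ((x - al n.+1) / (gap_sd m * Num.sqrt t) + hit_level n.+1 / Num.sqrt t)%:E)%:E.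
Proof.
move=> mn reg sm ax; have s0 := gap_sd_gt0 sm.
have st0 : 0 < Num.sqrt t by rewrite sqrtr_gt0.
rewrite (_ : _ `&` _ = [set w | hit_level n.+1 + (x - al n.+1) / gap_sd m <= glued_end 1 m n.+1 w]).
  rewrite (glued_end_normal _ _ (expr1n _ _) sm).1 mulNr Phi_sym; congr (1 - Phi _)%:E.
  by congr EFin; field; rewrite !lt0r_neq0.
apply/seteqP; split => w /=.
  move=> [xg nt]; rewrite glued_end_on_hit// mul1r lerD2l ler_pM2r ?invr_gt0//; lra.
move=> h; case: (boolP (tk n.+1 w <= t%:E)%E) => nt; last first.
  have := glued_end_before 1 m reg nt; rewrite ltNge => /negP[]; apply: le_trans h.
  by rewrite lerDl divr_ge0 ?(ltW s0)// subr_ge0.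
by split=> //; move: h; rewrite glued_end_on_hit// mul1r lerD2l ler_pM2r ?invr_gt0//; lra.
Qed.

(** With [e = - 1] the gap falling below [x] becomes the glued process rising above its hitting
    level, which again implies [S n.+1]. The complement makes the inequality strict. *)
Lemma prob_below n m x : m = n \/ m = n.+1 -> regular n.+1 -> 0 < sl m -> x < al n.+1 ->
  P (S n.+1 `\` [set w | x <= gp m t w]) =
  (Phi ((x - al n.+1) / (gap_sd m * Num.sqrt t) - hit_level n.+1 / Num.sqrt t)%:E)%:E.
Proof.
move=> mn reg sm ax; have s0 := gap_sd_gt0 sm.
have st0 : 0 < Num.sqrt t by rewrite sqrtr_gt0.
rewrite (_ : _ `\` _ = [set w | hit_level n.+1 + (al n.+1 - x) / gap_sd m < glued_end (- 1) m n.+1 w]).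
  rewrite (glued_end_normal _ _ _ sm).2 ?sqrrN ?expr1n//; congr (Phi _)%:E.
  by congr EFin; field; rewrite !lt0r_neq0.
apply/seteqP; split => w /=.
  move=> [nt /negP]; rewrite -ltNge => xg.
  by rewrite glued_end_on_hit// mulN1r ltrD2l ltr_pM2r ?invr_gt0//; lra.
move=> h; case: (boolP (tk n.+1 w <= t%:E)%E) => nt; last first.
  have := glued_end_before (- 1) m reg nt; rewrite ltNge => /negP[]; apply: le_trans (ltW h).
  by rewrite lerDl divr_ge0 ?ltW// subr_gt0.
split=> //; apply/negP; rewrite -ltNge.
by move: h; rewrite glued_end_on_hit// mulN1r ltrD2l ltr_pM2r ?invr_gt0//; lra.
Qed.

(** * Agreement with the extended-real formulas *)

Let ediv (a b : R) : b != 0 -> (a%:E / b%:E = (a / b)%:E)%E.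
Proof. by move=> b0; rewrite inver (negbTE b0) -EFinM. Qed.

Lemma slopeE k : sl k = if odd k then 1 - rho else 1 + rho.
Proof. by rewrite /slope -signr_odd; case: (odd k); rewrite ?expr1 ?expr0; ring. Qed.

Let rho0 : 0 <= rho. Proof. by case/andP: hrho. Qed.
Let rho1 : rho <= 1. Proof. by case/andP: hrho. Qed.
Let sle_gt0 : 0 < 1 + rho. Proof. exact: ltr_wpDr. Qed.

Let regular1 : regular 1.
Proof. by case=> // _; rewrite slopeE. Qed.

Let regular_lt n : rho < 1 -> regular n.
Proof. by move=> r1 k _; rewrite slopeE; case: (odd k) => //; rewrite subr_gt0. Qed.

Let regular2 n : regular n.+2 -> rho < 1.
Proof. by move=> /(_ 1%N isT); rewrite slopeE/= subr_gt0. Qed.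

Lemma hit_level_closed n : hit_level n.+1 = eta / Num.sqrt (2 * (1 + rho)) + (eta - nu) / Num.sqrt 2 *
  ((n.+1)./2%:R / Num.sqrt (1 - rho) + n./2%:R / Num.sqrt (1 + rho)).
Proof.
elim: n => [|n IH].
  rewrite /hit_level big_ord_recr big_ord0/= add0r !mul0r addr0 mulr0 addr0 /gap_sd slopeE/=.
  by rewrite expr0 mul1r /alpha/= subr0.
rewrite hit_levelS IH /gap_sd slopeE exprS -signr_odd /alpha/= uphalf_half.
move: (n./2) => k; case: (odd n) => /=.
  by rewrite expr1 (sqrtrM _ (ler0n _ 2)) add1n -(@natr1 _ k) !invfM; ring.
by rewrite expr0 [in X in _ + X = _](sqrtrM _ (ler0n _ 2)) add0n -(@natr1 _ k) !invfM; ring.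
Qed.

(** For [n = 0] the term [0 / sqrt (1 - rho)] is [0] even if [rho = 1]; from [n = 1] on, regularity
    includes [rho < 1]. *)
Lemma u_hit_level n : regular n.+1 -> u_ eta nu rho n.+1 = (hit_level n.+1)%:E.
Proof.
move=> reg; rewrite hit_level_closed /u_ /=.
have s1 : Num.sqrt (2 * (1 + rho)) != 0 by rewrite gt_eqF// sqrtr_gt0 mulr_gt0.
have s2 : Num.sqrt (1 + rho) != 0 by rewrite gt_eqF// sqrtr_gt0.
rewrite (@ediv _ _ s1) (@ediv _ _ s2); case: n reg => [_|n /regular2 r1].
  by rewrite /= !mul0e !mul0r adde0 addr0 mule0 mulr0 adde0 addr0.
have s3 : Num.sqrt (1 - rho) != 0 by rewrite gt_eqF// sqrtr_gt0 subr_gt0.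
by rewrite ediv// -!EFinD -EFinM -EFinD.
Qed.

Let E n x := [set w | x <= gp n t w].
Let mE n x : measurable (E n x). Proof. exact: gap_measurable_ge. Qed.

Let q m n x : \bar R := ((x - al n.+1)%:E / (Num.sqrt (2 * (1 + (-1) ^+ m * rho) * t))%:E)%E.
Let v n : \bar R := (u_ eta nu rho n.+1 / (Num.sqrt t)%:E)%E.
Let st_neq0 : Num.sqrt t != 0. Proof. by rewrite gt_eqF// sqrtr_gt0. Qed.

Let v_fin n : regular n.+1 -> v n = (hit_level n.+1 / Num.sqrt t)%:E.
Proof. by move=> reg; rewrite /v u_hit_level// ediv. Qed.

Let q_fin m n x : 0 < sl m -> q m n x = ((x - al n.+1) / (gap_sd m * Num.sqrt t))%:E.
Proof.
move=> sm; rewrite /q -/(slope rho m) (sqrtrM t); last by rewrite mulr_ge0// slope_ge0.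
by rewrite ediv// mulf_neq0// gt_eqF// gap_sd_gt0.
Qed.

Let q_inf m n x : sl m = 0 -> q m n x = ((x - al n.+1)%:E * +oo)%E.
Proof. by move=> sm; rewrite /q -/(slope rho m) sm mulr0 mul0r sqrtr0 inve0. Qed.

Let cslope0 m : sl m = 0 -> cs = 0.
Proof. by move=> sm; have := slope_sq m; rewrite sm expr0n mulr0 add0r => /eqP; rewrite sqrf_eq0 => /eqP. Qed.

Let gap_flat n m w : m = n \/ m = n.+1 -> sl m = 0 -> (tk n.+1 w <= t%:E)%E -> gp m t w = al n.+1.
Proof. by move=> mn sm nt; rewrite (gap_on_hit mn nt) sm (cslope0 sm) !mul0r subrr addr0. Qed.

(** If the slope vanishes, the gap stays at [al n.+1] after the hit: the event is empty, in
    accordance with [Phi] at [-oo]. *)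
Lemma prob_below_E n m x : m = n \/ m = n.+1 -> regular n.+1 -> x < al n.+1 ->
  P (S n.+1 `\` E m x) = (Phi (q m n x - v n)%E)%:E.
Proof.
move=> mn reg xa; have [sm|] := ltP 0 (sl m).
  by rewrite prob_below// q_fin// v_fin// -EFinB.
rewrite le_eqVlt ltNge slope_ge0 orbF => /eqP sm.
rewrite q_inf// v_fin// lt0_muley ?lte_fin ?subr_lt0// Phi_ninfty.
rewrite (_ : _ `\` _ = set0) ?measure0//; apply/seteqP; split => w //= [nt].
by rewrite /E /= (gap_flat mn)// ltW.
Qed.

(** With a vanishing slope and [x] equal to [al n.+1] the event would be all of [S n.+1], whereas
    the formula has [0 / 0]; hence the last hypothesis. *)
Lemma prob_above_E n m x : m = n \/ m = n.+1 -> regular n.+1 -> al n.+1 <= x ->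
  (sl m = 0 -> x != al n.+1) ->
  P (E m x `&` S n.+1) = (1 - Phi (q m n x + v n)%E)%:E.
Proof.
move=> mn reg xa xn; have [sm|] := ltP 0 (sl m).
  by rewrite prob_above// q_fin// v_fin// -EFinD.
rewrite le_eqVlt ltNge slope_ge0 orbF => /eqP sm.
have ax : al n.+1 < x by rewrite lt_neqAle eq_sym xn.
rewrite q_inf// v_fin// gt0_muley ?lte_fin ?subr_gt0// addye// Phi_pinfty subrr.
rewrite (_ : _ `&` _ = set0) ?measure0//; apply/seteqP; split => w //= [+ nt].
by rewrite /E /= (gap_flat mn)// leNgt ax.
Qed.

Let E_off n x : E n.+1 x `\` S n.+1 = E n x `\` S n.+1.
Proof.
apply/seteqP; split => w /= [xg /negP]; rewrite -ltNge => nt; split; try by apply/negP; rewrite -ltNge.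
  by rewrite /E/= -gap_before// ltW.
by rewrite /E/= gap_before// ltW.
Qed.

Let PD A n : measurable A -> P A = (P (A `&` S n) + P (A `\` S n))%E.
Proof.
by move=> mA; rewrite addeC -measureDI.
Qed.

Let pr A := fine (P A).
Let prE A : measurable A -> P A = (pr A)%:E. Proof. by move=> mA; rewrite fineK// fin_num_measure. Qed.

Let prDS A B n : measurable A -> measurable B -> A `\` S n = B `\` S n ->
  pr A - pr B = pr (A `&` S n) - pr (B `&` S n).
Proof.
move=> mA mB AB.
have split_ C : measurable C -> pr C = pr (C `&` S n) + pr (C `\` S n).
  move=> mC; apply: EFin_inj; rewrite EFinD -!prE//; first exact: PD.
    exact: measurableD.
  exact: measurableI.
by rewrite (split_ A mA) (split_ B mB) AB; ring.
Qed.

Lemma prob_step n x : regular n.+1 -> ~ (rho = 1 /\ x = eta) ->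
  pr (E n.+1 x) = pr (E n x) + p_ eta nu rho t x n.+1.
Proof.
move=> reg rx; apply/eqP; rewrite addrC -subr_eq; apply/eqP.
rewrite (prDS (mE _ _) (mE _ _) (E_off n x)).
have n0 : n = n \/ n = n.+1 by left.
have n1 : n.+1 = n \/ n.+1 = n.+1 by right.
rewrite /p_ -/(q n n x) -/(q n.+1 n x) -/(v n); case: ifPn => [xa|].
  (* For [x] below the level only the complement within [S n.+1] has a closed form; the unknown
     [pr (S n.+1)] cancels in the difference. *)
  have compl m : m = n \/ m = n.+1 -> pr (E m x `&` S n.+1) = pr (S n.+1) - Phi (q m n x - v n)%E.
    move=> mn; have -> : Phi (q m n x - v n)%E = pr (S n.+1 `\` E m x) by rewrite /pr prob_below_E.
    apply/eqP; rewrite eq_sym subr_eq addrC; apply/eqP; apply: EFin_inj.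
    rewrite EFinD -!prE//; [|exact: measurableI|exact: measurableD].
    by rewrite setIC; apply: measureDI.
  by rewrite !compl//; ring.
rewrite -leNgt => ax.
(* Regularity excludes a vanishing slope in phase [n], so it can only occur in phase [n.+1]; this
   forces [rho = 1] and [n = 0], where the level is [eta]. *)
have sm0 m : m = n \/ m = n.+1 -> sl m = 0 -> x != al n.+1.
  case=> -> sm; first by have := reg n (ltnSn n); rewrite sm ltxx.
  apply/eqP => xal; apply: rx.
  have r1 : rho = 1.
    by move: sm; rewrite slopeE; case: (odd n.+1) => sm; [lra|have := sle_gt0; lra].
  split=> //; move: reg; rewrite xal; case: (n) => // n' /regular2.
  by rewrite r1 ltxx.
have above m : m = n \/ m = n.+1 -> pr (E m x `&` S n.+1) = 1 - Phi (q m n x + v n)%E.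
  by move=> mn; rewrite /pr prob_above_E//; exact: sm0.
by rewrite !above//; move: (Phi _) => a; move: (Phi _) => b; ring.
Qed.

Section Perfect_correlation.
Hypothesis r1 : rho = 1.

Let sl1 : sl 1 = 0. Proof. by rewrite slopeE/= r1 subrr. Qed.

(** From [tk 1] on, [gp 1] is stuck at [eta], which differs from [nu]. *)
Let tau2 w : tk 2 w = +oo%E.
Proof.
apply/eqP; rewrite eq_le leey/= leNgt; apply/negP => fin2.
have := fin2; rewrite tauS => /(hit_attained (@gap_continuous _ _ _ _ _ _ _ cX cY 1%N w)).
move=> [c _ [c0 kc]]; rewrite (gap_after cX cY X0 Y0 kc) sl1 (cslope0 sl1) !mul0r subrr addr0.
by rewrite /alpha/= => nE; have := hnu; rewrite nE ltxx.
Qed.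

Lemma no_second_reflection n : S n.+2 = set0.
Proof.
apply/seteqP; split => w //= nt; have : (tk 2 w <= tk n.+2 w)%E by exact: u_le_trans.
by rewrite tau2 => /le_trans/(_ nt); rewrite leNgt ltry.
Qed.

(** From [u_ 2] on the level is [+oo], so both arguments of [Phi] are the same infinity. *)
Lemma p_perfect n x : p_ eta nu rho t x n.+2 = 0.
Proof.
have s1 : Num.sqrt (2 * (1 + rho)) != 0 by rewrite gt_eqF// sqrtr_gt0 mulr_gt0.
have s2 : Num.sqrt (1 + rho) != 0 by rewrite gt_eqF// sqrtr_gt0.
have s3 : Num.sqrt (1 - rho) = 0 by rewrite r1 subrr sqrtr0.
have vy : v n.+1 = +oo%E.
  rewrite /v /u_ -[n.+2 == 0%N]/false (@ediv _ _ s1) (@ediv _ _ s2) s3 inve0.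
  rewrite gt0_muley ?lte_fin ?ltr0n// addye//.
  rewrite gt0_muley ?lte_fin ?divr_gt0 ?subr_gt0// addey//.
  by rewrite inver (negbTE st_neq0) gt0_mulye// lte_fin invr_gt0 sqrtr_gt0.
have below m : x < al n.+2 -> (q m n.+1 x - v n.+1 = -oo)%E.
  move=> xa; rewrite vy; have [sm|] := ltP 0 (sl m); first by rewrite q_fin.
  rewrite le_eqVlt ltNge slope_ge0 orbF => /eqP sm.
  by rewrite q_inf// lt0_muley// lte_fin subr_lt0.
have above m : al n.+2 <= x -> (q m n.+1 x + v n.+1 = +oo)%E.
  move=> ax; rewrite vy; have [sm|] := ltP 0 (sl m); first by rewrite q_fin.
  rewrite le_eqVlt ltNge slope_ge0 orbF => /eqP sm; rewrite q_inf//.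
  move: ax; rewrite le_eqVlt => /predU1P[->|ax]; first by rewrite subrr mul0e add0e.
  by rewrite gt0_muley ?lte_fin ?subr_gt0.
rewrite /p_ -/(q n.+1 n.+1 x) -/(q n.+2 n.+1 x) -/(v n.+1); case: ifPn => [xa|].
  by rewrite !below// subrr.
by rewrite -leNgt => ax; rewrite !above// subrr.
Qed.

End Perfect_correlation.

Let irregular n : ~ regular n.+1 -> rho = 1 /\ (0 < n)%N.
Proof.
move=> nreg; have r1 : rho = 1.
  apply/eqP; rewrite eq_le rho1 leNgt; apply/negP => r1; apply: nreg; exact: regular_lt.
by split=> //; case: n nreg => // /(_ regular1).
Qed.

Let prob_step' n x : ~ (rho = 1 /\ x = eta) ->
  pr (E n.+1 x) = pr (E n x) + p_ eta nu rho t x n.+1.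
Proof.
move=> rx; have [reg|] := pselect (regular n.+1); first exact: prob_step.
move=> /irregular[r1]; case: n => // n _; rewrite (p_perfect r1) addr0.
by have := E_off n.+1 x; rewrite (no_second_reflection r1) !setD0 => ->.
Qed.

Let prob_base x : pr (E 0 x) = p_ eta nu rho t x 0.
Proof.
have s0 : 0 < sl 0 by rewrite slopeE.
have sg0 := gap_sd_gt0 s0.
have reg0 : regular 0 by [].
rewrite /pr /E (_ : [set w | _] = [set w | x / gap_sd 0 <= glued_end 1 0 0 w]).
  rewrite (glued_end_normal _ _ (expr1n _ _) s0).1 /p_ /=.
  (* [q] subtracts [al 1], so its value at [al 1 - x] has numerator [- x]. *)
  have := @q_fin 0 0 (al 1 - x) s0; rewrite /q expr0 mul1r.
  have -> : al 1 - x - al 1 = - x by ring.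
  move=> ->; congr (Phi _%:E); field.
  by rewrite !lt0r_neq0// sqrtr_gt0.
have glued0 w : glued_end 1 0 0 w = gp 0 t w / gap_sd 0.
  have t0' : (tk 0%N w <= t%:E)%E by rewrite tk0 lee_fin ltW.
  rewrite (gap_after cX cY X0 Y0 t0') /glued_end glued_hit//.
  by rewrite /override eqxx /hit_level big_ord0 /alpha/=; ring.
by apply/seteqP; split => w /=; rewrite glued0 ler_pM2r ?invr_gt0.
Qed.

Lemma prob_gap n x : ~ [/\ rho = 1, x = eta & (0 < n)%N] ->
  P [set w | x <= gp n t w] = (\sum_(0 <= k < n.+1) p_ eta nu rho t x k)%:E.
Proof.
rewrite -/(E n x) prE//; elim: n => [_|n IH rx].
  by rewrite big_nat1 prob_base.
have rx' : ~ (rho = 1 /\ x = eta) by move=> [r1 xe]; apply: rx.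
have rx'' : ~ [/\ rho = 1, x = eta & (0 < n)%N] by move=> [r1 xe _]; apply: rx'.
rewrite big_nat_recr//= prob_step'//.
by have [->] := IH rx''.
Qed.

(** * Almost sure finiteness of the number of reflections *)

Let glued_end_sign n w : regular n.+1 -> (tk n.+1 w <= t%:E)%E ->
  hit_level n.+1 <= glued_end 1 n n.+1 w \/ hit_level n.+1 <= glued_end (- 1) n n.+1 w.
Proof.
move=> reg nt; have sn := reg n (ltnSn n); have nn : n = n \/ n = n.+1 by left.
rewrite !(glued_end_on_hit _ nn reg sn nt) mul1r mulN1r mulNr.
by move: (_ / _) => z; have [|] := leP 0 z; [left|right]; lra.
Qed.

(** The reflection principle as a union bound: after [tk n.+1] the continuations with [e = 1] and
    [e = - 1] are mirror images about [hit_level n.+1], so at least one of them ends at or above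
    it. *)
Let S_le n : regular n.+1 -> pr (S n.+1) <= 2 * Phi (- hit_level n.+1 / Num.sqrt t)%:E.
Proof.
move=> reg; have sn := reg n (ltnSn n).
have [e1 _] := glued_end_normal n.+1 (hit_level n.+1) (expr1n _ _) sn.
have [|e2 _] := @glued_end_normal (- 1) n n.+1 (hit_level n.+1) _ sn; first by rewrite sqrrN expr1n.
set A := [set w | _ <= glued_end 1 _ _ w] in e1; set B := [set w | _ <= glued_end (- 1) _ _ w] in e2.
have mglued e : e ^+ 2 = 1 -> measurable [set w | hit_level n.+1 <= glued_end e n n.+1 w].
  move=> ee; have U k : override (e * sl n / gap_sd n) phase_coefX n.+1 k ^+ 2 +
      override (- (e * cs / gap_sd n)) phase_coefY n.+1 k ^+ 2 = 1.
    by rewrite /override; case: eqP => _; [exact: gap_sd_unit|exact: phase_coef_unit].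
  have [mg _] := glued_normal hF hX hY XY stop tk_le n.+1 0 U t0.
  have mW := Fmeas_measurable hF (ltW t0) mg.
  rewrite (_ : [set w | _] = glued_end e n n.+1 @^-1` [set` `[hit_level n.+1, +oo[]).
    by have := mW measurableT _ (measurable_itv `[hit_level n.+1, +oo[); rewrite setTI.
  by apply/seteqP; split => w /=; rewrite in_itv/= andbT.
have mA : measurable A by apply: mglued; rewrite expr1n.
have mB : measurable B by apply: mglued; rewrite sqrrN expr1n.
rewrite -lee_fin -prE//.
apply: (@le_trans _ _ (P (A `|` B))).
  apply: le_measure; rewrite ?inE//; first exact: measurableU.
  by move=> w /= nt; exact: glued_end_sign.
apply: (@le_trans _ _ (P A + P B)%E); first exact: measureU2.
by rewrite e1 e2 -EFinD lee_fin; lra.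
Qed.

(** Each phase after the first covers a distance [eta - nu], and [gap_sd] is at most 2 because no
    slope exceeds 2. *)
Let hit_level_ge n : rho < 1 -> n%:R * ((eta - nu) / 2) <= hit_level n.+1.
Proof.
move=> r1; elim: n => [|n IH].
  by rewrite mul0r hit_levelS /hit_level big_ord0 add0r divr_ge0 ?sqrtr_ge0// ltW// al_step.
rewrite hit_levelS -natr1 mulrDl mul1r lerD//.
have en : 0 < eta - nu by rewrite subr_gt0.
have -> : eps n.+1 * (al n.+2 - al n.+1) = eta - nu.
  rewrite /alpha/= exprS -signr_odd.
  by case: (odd n) => /=; rewrite ?expr1 ?expr0; ring.
have s4 : gap_sd n.+1 <= 2.
  have -> : 2 = Num.sqrt (2 ^+ 2) :> R by rewrite sqrtr_sqr ger0_norm.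
  rewrite ler_sqrt ?exprn_ge0// expr2 ler_pM2l// slopeE.
  by case: (odd n.+1); have := rho0; have := rho1; lra.
have s0 : 0 < gap_sd n.+1 by apply: gap_sd_gt0; exact: (@regular_lt n.+2 r1 n.+1 (ltnSn _)).
by rewrite ler_pM2l// lef_pV2 ?posrE.
Qed.

Lemma prob_hit_cvg0 : pr (S n.+2) @[n --> \oo] --> 0.
Proof.
have [r1|r1] := ltP rho 1; last first.
  have r1' : rho = 1 by apply/eqP; rewrite eq_le rho1.
  apply: cvg_near_cst; apply: nearW => n; by rewrite (no_second_reflection r1') /pr measure0.
pose c := (eta - nu) / 2 / Num.sqrt t.
have c0 : 0 < c by rewrite !divr_gt0 ?subr_gt0 ?sqrtr_gt0.
apply: (@cvg_dist_bound _ (fun n => 2 * Phi (- (c * n.+1%:R))%:E)) => [n|].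
  rewrite subr0 ger0_norm ?fine_ge0//; apply: (le_trans (S_le (regular_lt r1))).
  rewrite ler_pM2l//; apply: le_Phi; rewrite lee_fin mulNr lerN2.
  have -> : c * n.+1%:R = n.+1%:R * ((eta - nu) / 2) / Num.sqrt t by rewrite /c; ring.
  by rewrite ler_pM2r ?invr_gt0 ?sqrtr_gt0// hit_level_ge.
rewrite -[X in _ --> X](mulr0 (2 : R)); apply: cvgM; first exact: cvg_cst.
apply: (cvg_comp _ _ _ (@cvg_Phi_ninfty R)); apply/cvgNrNy.
apply/cvgryPge => A; exists (Num.truncn (A / c)) => // n /= An.
by rewrite mulrC -ler_pdivrMr// (le_trans (ltW (truncnS_gt _)))// ler_nat ltnS.
Qed.

(** * The process with all reflections *)

Let count n w : R := \sum_(1 <= i < n.+1) ((tk i w <= t%:E)%E)%:R.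

(** The number of reflections may be smaller than [n], but reflections not yet performed leave the
    gap at time [t] unchanged. *)
Let count_gap n w : (t%:E < tk n.+1 w)%E ->
  exists2 k : nat, count n w = k%:R & gp k t w = gp n t w.
Proof.
elim: n => [_|n IH tn]; first by exists 0%N => //; rewrite /count big_geq.
have cS : count n.+1 w = count n w + ((tk n.+1 w <= t%:E)%E)%:R by rewrite /count big_nat_recr.
have [nt|nt] := leP (tk n.+1 w) t%:E; last first.
  have [k ck gk] := IH nt; exists k; first by rewrite cS ck leNgt nt addr0.
  by rewrite gk gap_before// ltW.
exists n.+1 => //; rewrite /count (eq_big_nat _ _ (F2 := fun=> 1)) => [|i /andP[_ i2]].
  by rewrite sumr_const_nat subSS subn0.
by rewrite (le_trans (u_le_trans tk_le w _) nt).
Qed.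

Let Nrefl_count n w : (t%:E < tk n.+1 w)%E -> Nrefl eta nu rho X Y t w = (count n w)%:E.
Proof.
move=> tn; rewrite /Nrefl; apply/cvg_lim => //; apply: cvg_near_cst.
exists n.+1 => // m /= nm; rewrite (big_cat_nat _ nm)//=.
rewrite [X in (_ + X)%E]big_nat_cond [X in (_ + X)%E]big1 ?adde0 ?sumEFin//.
move=> i /andP[/andP[ni _] _].
by rewrite leNgt (lt_le_trans tn (u_le_trans tk_le w ni)).
Qed.

Let Ylim_eq n w : (t%:E < tk n.+1 w)%E -> X t w - Ylim eta nu rho X Y t w = gp n t w.
Proof.
move=> tn; have [k ck <-] := count_gap tn.
by rewrite /Ylim (Nrefl_count tn) ck /= natrK.
Qed.

Hypothesis hcomp : measure_is_complete P.

Let Elim x := [set w | x <= X t w - Ylim eta nu rho X Y t w].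

Let Elim_off x n : Elim x `\` S n.+1 = E n x `\` S n.+1.
Proof.
apply/seteqP; split => w /= [xg /negP]; rewrite -ltNge => nt; split; try by apply/negP; rewrite -ltNge.
  by rewrite /E/= -(Ylim_eq nt).
by rewrite /Elim/= (Ylim_eq nt).
Qed.

(** Apart from the event that all reflections occur before [t], the limit process is locally one of
    the [Yn]; that event is null, and completeness takes care of the part inside it. *)
Lemma measurable_Ylim x : measurable [set w | x <= X t w - Ylim eta nu rho X Y t w].
Proof.
rewrite -/(Elim x) (_ : Elim x = (\bigcup_n (E n x `\` S n.+1)) `|` (Elim x `&` \bigcap_n S n.+2)).
  apply: measurableU; first by apply: bigcupT_measurable => n; exact: measurableD.
  apply: hcomp; exists (\bigcap_n S n.+2); split; last by move=> w [].
    by apply: bigcapT_measurable => n.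
  have m : measurable (\bigcap_n S n.+2) by apply: bigcapT_measurable => n.
  rewrite prE//; congr EFin; apply/eqP; rewrite eq_le {2}/pr fine_ge0// andbT.
  apply: (ler_cvg_to (cvg_cst _) (@prob_hit_cvg0)); apply: nearW => n.
  by apply: fine_le; rewrite ?fin_num_measure//; apply: le_measure; rewrite ?inE// => w; apply.
apply/seteqP; split => w.
  move=> xw; have [[n nS]|H] := pselect (exists n, ~ S n.+1 w).
    by left; exists n => //; rewrite -Elim_off.
  by right; split=> // n _; apply: contrapT => nS; apply: H; exists n.+1.
by case=> [[n _]|[]//]; rewrite -Elim_off => -[].
Qed.

Let mElim x : measurable (Elim x) := measurable_Ylim x.

Lemma prob_gap_lim x : ~ (rho = 1 /\ x = eta) ->
  (\sum_(0 <= k < n) p_ eta nu rho t x k)%:E @[n --> \oo] -->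
  P [set w | x <= X t w - Ylim eta nu rho X Y t w].
Proof.
move=> rx; rewrite -/(Elim x) prE//.
apply: cvg_EFin; first exact: nearW.
(* The two shifts align the partial sum of [n.+2] terms with [E n.+1], which agrees with [Elim] off
   [S n.+2]. *)
rewrite -(cvg_shiftS (fun n => \sum_(0 <= k < n) p_ eta nu rho t x k)).
rewrite -(cvg_shiftS (fun n => \sum_(0 <= k < n.+1) p_ eta nu rho t x k)).
apply: (cvg_dist_bound _ prob_hit_cvg0) => n.
have <- : pr (E n.+1 x) = \sum_(0 <= k < n.+2) p_ eta nu rho t x k.
  by apply: EFin_inj; rewrite -prE// prob_gap// => -[r1 xe _]; apply: rx.
rewrite (prDS (mE _ _) (mElim x) (esym (Elim_off x n.+1))).
have le1 A : measurable A -> 0 <= pr (A `&` S n.+2) <= pr (S n.+2).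
  move=> mA; rewrite {1}/pr fine_ge0//=; apply: fine_le; rewrite ?fin_num_measure//; try exact: measurableI.
  by apply: le_measure; rewrite ?inE//; exact: measurableI.
have := le1 _ (mE n.+1 x); have := le1 _ (mElim x).
move: (pr _) (pr _) (pr _) => a b c /andP[? ?] /andP[? ?].
by rewrite ler_norml; apply/andP; split; lra.
Qed.

End Assembly.

Lemma within_continuous_comp {R : realType} (A : set R) (f g : R -> R) :
  {within A, continuous f} -> continuous g -> (forall r, A (g r)) -> continuous (f \o g).
Proof.
move=> /subspace_continuousP cf cg Ag r.
apply: (@cvg_comp _ _ _ g f _ (within A (nbhs (g r)))); last exact: cf.
by move=> U HU; apply: (@filterS _ (nbhs r) _ _ _ _ (@cg r _ HU)) => s /=; apply; exact: Ag.
Qed.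

(** * Reduction to everywhere continuous paths *)

Section Same_paths.
Context {T : Type} {R : realType}.
Variables (eta nu rho : R) (BX BY X Y : R -> T -> R) (w : T).
Hypotheses (eX : forall r, 0 <= r -> BX r w = X r w) (eY : forall r, 0 <= r -> BY r w = Y r w).

(** Only nonnegative times are ever read: hits are restricted to them, and [fine] of a reflection
    time is nonnegative. *)
Lemma eq_tau_Btilde k : tau eta nu rho BX BY k w = tau eta nu rho X Y k w /\
  forall r, 0 <= r -> Btilde eta nu rho BX BY k r w = Btilde eta nu rho X Y k r w.
Proof.
elim: k => [|k [IHt IHb]].
  by split; [exact: erefl|move=> r r0; rewrite /Btilde/= eX].
have tE : tau eta nu rho BX BY k.+1 w = tau eta nu rho X Y k.+1 w.
  rewrite !tauS IHt; congr (ereal_inf (_ @` _)).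
  by apply/seteqP; split => s /= [s0 ks xs]; split=> //; rewrite -xs /gap
    /Yn /correlated eX// eY// IHb.
split=> // r r0; rewrite !BtildeS /reflection tE !IHb//.
by apply: fine_ge0; exact: tau_ge0.
Qed.

Lemma eq_Yn k r : 0 <= r -> Yn eta nu rho BX BY k r w = Yn eta nu rho X Y k r w.
Proof. by move=> r0; rewrite /Yn /correlated eY// (eq_tau_Btilde k).2. Qed.

Lemma eq_Ylim r : 0 <= r -> Ylim eta nu rho BX BY r w = Ylim eta nu rho X Y r w.
Proof.
move=> r0; have NE : Nrefl eta nu rho BX BY r w = Nrefl eta nu rho X Y r w.
  by rewrite /Nrefl; apply: eq_eseriesr => n _; rewrite (eq_tau_Btilde n).1.
by rewrite /Ylim NE eq_Yn.
Qed.

End Same_paths.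

Section Regular_version.
Context {d : measure_display} {T : measurableType d} {R : realType}.
Variables (P : probability T R) (F : R -> set (set T)) (G : set T).
Hypotheses (hF : is_filtration F) (Pcomplete : measure_is_complete P).
Hypotheses (FG : F 0 G) (nG : P.-negligible (~` G)).

(** Measurability of [A] is a consequence: inside [G] it coincides with [B], and its part outside
    [G] is measurable by completeness. *)
Lemma prob_eq_mod_negligible (A B : set T) : measurable B -> A `&` G = B `&` G -> P A = P B.
Proof.
move=> mB AB; have mG : measurable G by exact: filtration_sub hF _ (lexx 0) _ FG.
have nD C : P.-negligible (C `\` G) by apply: negligibleS nG; exact: subIsetr.
have mA : measurable A.
  rewrite -(setUIDK A G) AB; apply: measurableU; first exact: measurableI.
  exact: Pcomplete.
rewrite (measureDI P mA mG) (measureDI P mB mG) AB; congr (_ + _)%E.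
by rewrite !(measure_negligible _ (nD _))//; exact: Pcomplete.
Qed.

(** The indicator removes the exceptional paths, and freezing the process before time 0 extends
    continuity to the whole line. Adaptedness survives because [G] belongs to [F 0]. *)
Definition regular_version (B : R -> T -> R) : R -> T -> R :=
  fun r w => \1_G w * B (Num.max r 0) w.

Section One_process.
Variable B : R -> T -> R.

Lemma regular_versionE r w : G w -> 0 <= r -> regular_version B r w = B r w.
Proof. by move=> Gw r0; rewrite /regular_version indicE mem_set// mul1r max_l. Qed.

Hypothesis hB : is_brownian P F B.
Hypothesis B0 : forall w, G w -> B 0 w = 0.
Hypothesis cB : forall w, G w -> {within [set t | 0 <= t], continuous (B ^~ w)}.

Lemma regular_version_bm : bm_facts P F (regular_version B).
Proof.
have sF t : 0 <= t -> sigma_algebra setT (F t) by exact: filtration_sigma hF _.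
have aB t : 0 <= t -> Gmeas (F t) (B t).
  by move=> t0; apply/(GmeasP _ (sF _ t0)); exact: brownian_adapted hB _ t0.
have mincr s t V : 0 <= s -> s < t -> measurable V -> measurable [set w | V (B t w - B s w)].
  move=> s0 st mV; have t0 := ltW (le_lt_trans s0 st).
  have mBr r : 0 <= r -> measurable_fun setT (B r).
    by move=> r0; apply: Gmeas_measurable (sF _ r0) (filtration_sub hF r0) _; exact: aB.
  have mBB : measurable_fun setT (fun w => B t w - B s w).
    by apply: measurable_funB; exact: mBr.
  by have := mBB measurableT V mV; rewrite setTI.
have eincr s t V A : 0 <= s -> s < t ->
    A `&` (fun w => regular_version B t w - regular_version B s w) @^-1` V `&` G =
    A `&` [set w | V (B t w - B s w)] `&` G.
  move=> s0 st; have t0 := ltW (le_lt_trans s0 st).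
  by apply/seteqP; split=> w /= [[Aw +] Gw]; rewrite !regular_versionE.
have pincr s t V : 0 <= s -> s < t -> measurable V ->
    P ((fun w => regular_version B t w - regular_version B s w) @^-1` V) =
    P [set w | V (B t w - B s w)].
  move=> s0 st mV; apply: prob_eq_mod_negligible; first exact: mincr.
  by have := eincr s t V setT s0 st; rewrite !setTI.
split.
- move=> w; have [Gw|Gw] := pselect (G w).
    rewrite (_ : regular_version B ^~ w = (B ^~ w) \o (fun r => Num.max r 0)).
      apply: within_continuous_comp (cB Gw) _ _ => r /=; last by rewrite le_max lexx orbT.
      by apply: continuous_max; [exact: cvg_id|exact: cvg_cst].
    by apply/funext => r; rewrite /regular_version indicE mem_set// mul1r.
  rewrite (_ : regular_version B ^~ w = fun=> 0); first exact: cst_continuous.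
  by apply/funext => r; rewrite /regular_version indicE memNset// mul0r.
- move=> w; rewrite /regular_version maxxx indicE.
  by case: (pselect (G w)) => Gw; [rewrite B0// mulr0|rewrite memNset// mul0r].
- move=> t t0; rewrite /regular_version max_l//; apply: measurable_funM (aB _ t0).
  by apply: Gmeas_indic; [exact: sF|exact: (filtration_mono hF (lexx 0) t0)].
- by move=> s t s0 st V mV; rewrite pincr// (brownian_increment hB).
- move=> s t s0 st A V FA mV; rewrite pincr// -(brownian_independent_increment hB)//.
  apply: prob_eq_mod_negligible; last exact: eincr.
  by apply: measurableI; [exact: filtration_sub hF _ s0 _ FA|exact: mincr].
Qed.

End One_process.

Section Two_processes.
Variables BX BY : R -> T -> R.
Hypotheses (hBX : is_brownian P F BX) (hBY : is_brownian P F BY).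
Hypothesis hind : independent_processes P BX BY.

Lemma sigma_of_process_incr2 (B : R -> T -> R) s1 t1 s2 t2 (V : set R) :
  0 <= s1 -> s1 <= t1 -> 0 <= s2 -> s2 <= t2 -> measurable V ->
  sigma_of_process B ((fun w => incr B s1 t1 w * incr B s2 t2 w) @^-1` V).
Proof.
have sB : sigma_algebra setT (sigma_of_process B) by exact: smallest_sigma_algebra.
have mB t : 0 <= t -> Gmeas (sigma_of_process B) (B t).
  move=> t0; apply/(GmeasP _ sB) => U mU; apply: sub_sigma_algebra.
  by exists t, U.
move=> s10 st1 s20 st2; have t10 := le_trans s10 st1; have t20 := le_trans s20 st2.
move: V; apply/(GmeasP _ sB).
by apply: measurable_funM; apply: measurable_funB; apply: mB.
Qed.

Lemma sigma_of_process_measurable (B : R -> T -> R) : is_brownian P F B ->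
  sigma_of_process B `<=` measurable.
Proof.
move=> hB; apply: smallest_sub.
  split; [exact: measurable0|by move=> A mA; rewrite setTD; exact: measurableC|].
  by move=> A mA; exact: bigcupT_measurable.
by move=> _ [t [U [t0 mU ->]]]; apply: (filtration_sub hF t0); exact: brownian_adapted hB _ t0 _ mU.
Qed.

Lemma regular_version_indep :
  indep_incr_products P (regular_version BX) (regular_version BY).
Proof.
set X := regular_version BX; set Y := regular_version BY.
move=> s1 t1 s2 t2 s10 st1 s20 st2 V1 V2 mV1 mV2.
have t10 := le_trans s10 st1; have t20 := le_trans s20 st2.
have eG B V w : G w ->
    ((fun w => incr (regular_version B) s1 t1 w * incr (regular_version B) s2 t2 w) @^-1` V) w =
    ((fun w => incr B s1 t1 w * incr B s2 t2 w) @^-1` V) w.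
  by move=> Gw; rewrite /incr/= !regular_versionE.
have sX := sigma_of_process_incr2 (B := BX) s10 st1 s20 st2 mV1.
have sY := sigma_of_process_incr2 (B := BY) s10 st1 s20 st2 mV2.
have mX := sigma_of_process_measurable hBX sX; have mY := sigma_of_process_measurable hBY sY.
have := hind sX sY.
rewrite -(prob_eq_mod_negligible (A := (fun w => incr X s1 t1 w * incr X s2 t2 w) @^-1` V1) mX).
  rewrite -(prob_eq_mod_negligible (A := (fun w => incr Y s1 t1 w * incr Y s2 t2 w) @^-1` V2) mY).
    rewrite -(prob_eq_mod_negligible (A := (fun w => incr X s1 t1 w * incr X s2 t2 w) @^-1` V1 `&`
      (fun w => incr Y s1 t1 w * incr Y s2 t2 w) @^-1` V2) (measurableI _ _ mX mY))//.
    apply/seteqP; split=> w [[Xw Yw] Gw]; split=> //.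
      by split; [rewrite -(eG _ V1)|rewrite -(eG _ V2)].
    by split; [rewrite (eG _ V1)|rewrite (eG _ V2)].
  by apply/seteqP; split=> w [Yw Gw]; split=> //; [rewrite -(eG _ V2)|rewrite (eG _ V2)].
by apply/seteqP; split=> w [Xw Gw]; split=> //; [rewrite -(eG _ V1)|rewrite (eG _ V1)].
Qed.

End Two_processes.
End Regular_version.

Theorem proposition4 (d : measure_display) (T : measurableType d)
    (R : realType) (P : probability T R) (F : R -> set (set T))
    (BX BY : R -> T -> R)
    (hF : is_filtration F) (hFu : usual_conditions P F)
    (hBX : is_brownian P F BX) (hBY : is_brownian P F BY)
    (hind : independent_processes P BX BY)
    (eta nu rho : R) (heta : 0 < eta) (hnu : nu < eta)
    (hrho : 0 <= rho <= 1)
    (t x : R) (ht : 0 < t) :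
  (forall n : nat, ~ [/\ rho = 1, x = eta & (0 < n)%N] ->
     P [set w | x <= BX t w - Yn eta nu rho BX BY n t w] =
       (\sum_(0 <= k < n.+1) p_ eta nu rho t x k)%:E)
  /\
  (~ (rho = 1 /\ x = eta) ->
     (\sum_(0 <= k < n) p_ eta nu rho t x k)%:E @[n --> \oo] -->
       P [set w | x <= BX t w - Ylim eta nu rho BX BY t w]).
Proof.
pose G : set T := [set w | BX 0 w = 0 /\ BY 0 w = 0] `&`
  [set w | {within [set t | 0 <= t], continuous (BX ^~ w)} /\ {within [set t | 0 <= t], continuous (BY ^~ w)}].
have nG : P.-negligible (~` G).
  have : (\forall w \near almost_everywhere P, G w).
    by apply: filterI; apply: filterI; [exact: brownian_start hBX|exact: brownian_start hBY|
      exact: brownian_continuous hBX|exact: brownian_continuous hBY].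
  by [].
(* The usual conditions place the negligible complement of [G] in [F 0], so restricting the paths to
   [G] respects the filtration. *)
have FG : F 0 G.
  have [_ FC _] := filtration_sigma hF (lexx 0).
  by have := FC _ (usual_null hFu nG); rewrite setTD setCK.
have Pc := usual_complete hFu.
set X := regular_version G BX; set Y := regular_version G BY.
have hX : bm_facts P F X by apply: regular_version_bm => // w [[]] // ? ? [].
have hY : bm_facts P F Y by apply: regular_version_bm => // w [[]] // ? ? [].
have hXY := regular_version_indep hF Pc FG nG hBX hBY hind.
have t0 := ltW ht.
have eX w : G w -> forall r, 0 <= r -> BX r w = X r w by move=> Gw r r0; rewrite /X regular_versionE.
have eY w : G w -> forall r, 0 <= r -> BY r w = Y r w by move=> Gw r r0; rewrite /Y regular_versionE.
split=> [n rx|rx].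
  rewrite -(prob_gap hF heta hnu hrho hX hY hXY ht rx); apply: (prob_eq_mod_negligible hF Pc FG nG).
    exact: (gap_measurable_ge hF rho heta hnu hX hY ht n x).
  by apply/seteqP; split=> w /= [+ Gw]; rewrite /gap (eX _ Gw)// (eq_Yn _ _ _ (eX _ Gw) (eY _ Gw)).
rewrite (prob_eq_mod_negligible hF Pc FG nG (measurable_Ylim hF heta hnu hrho hX hY hXY ht Pc x)).
  exact: (prob_gap_lim hF heta hnu hrho hX hY hXY ht Pc rx).
by apply/seteqP; split=> w /= [+ Gw]; rewrite (eX _ Gw)// (eq_Ylim _ _ _ (eX _ Gw) (eY _ Gw)).
Qed.
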